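(* Let $n,m\ge1$ and let $H=(h_1,\dots,h_m):\mathbb B^n\to\mathbb R^m$ be a map whose components are invariant harmonic functions on the unit ball $\mathbb B^n\subset\mathbb C^n$. Suppose that $\|H(z)\|\le1$ for all $z\in\mathbb B^n$. Then $$\|\nabla H(z)\|\le\frac{2\,\Gamma(n+1)}{\sqrt{\pi}\,\Gamma(n+\frac12)}\,\frac{1}{1-\|z\|^2},\qquad z\in\mathbb B^n,$$ where $\|\nabla H(z)\|$ denotes the operator norm of the Jacobian matrix $\nabla H(z)\in\mathbb R^{m\times 2n}$.
   Context: $\mathbb B^n=\{z\in\mathbb C^n:\|z\|<1\}$; $\|\cdot\|$ on vectors is the Euclidean norm, and the operator norm is taken with respect to the Euclidean norms on $\mathbb R^{2n}\cong\mathbb C^n$ and $\mathbb R^m$. The Jacobian matrix is taken with respect to the real coordinates $x_1,y_1,\dots,x_n,y_n$, where $z_j=x_j+\sqrt{-1}\,y_j$. A (twice continuously differentiable) function $f$ on $\mathbb B^n$ is called invariant harmonic if $\Delta_Bf\equiv0$ on $\mathbb B^n$, where $$\Delta_Bf(z)=4(1-\|z\|^2)\sum_{i,j=1}^n(\delta_{ij}-z_i\overline z_j)\frac{\partial^2f}{\partial z_i\partial\overline z_j}(z)$$ and $\delta_{ij}$ is the Kronecker delta. *)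

(* Defs.v *)
From HB Require Import structures.
From mathcomp Require Import all_boot all_order all_algebra.
From mathcomp Require Import all_classical all_reals all_analysis.
From mathcomp Require Export complex.

Set Implicit Arguments.
Unset Strict Implicit.
Unset Printing Implicit Defensive.

Import Order.TTheory GRing.Theory Num.Theory.
Import numFieldNormedType.Exports.
Import ComplexField.

Local Open Scope classical_set_scope.
Local Open Scope ring_scope.
Local Open Scope complex_scope.

Definition enorm (R : realType) (k : nat) (v : 'rV[R]_k) : R :=
  Num.sqrt (\sum_(i < k) (v 0 i) ^+ 2).

Definition cnorm (R : realType) (n : nat) (z : 'rV[R[i]]_n) : R :=
  Num.sqrt (\sum_(j < n) (Normc.normc (z 0 j)) ^+ 2).

Definition cball (R : realType) (n : nat) : set 'rV[R[i]]_n :=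
  [set z | cnorm z < 1].

(* The indices of the real coordinates x_j and y_j in R^(n*2), which are
   ordered row by row: x_1, y_1, ..., x_n, y_n. *)
Definition xidx (n : nat) (j : 'I_n) : 'I_(n * 2) := mxvec_index j 0.
Definition yidx (n : nat) (j : 'I_n) : 'I_(n * 2) := mxvec_index j 1.

Definition r2c (R : realType) (n : nat) (x : 'rV[R]_(n * 2)) : 'rV[R[i]]_n :=
  \row_j (x 0 (xidx j) +i* x 0 (yidx j)).

Definition c2r (R : realType) (n : nat) (z : 'rV[R[i]]_n) : 'rV[R]_(n * 2) :=
  mxvec (\matrix_(j < n, k < 2)
           if k == 0 then complex.Re (z 0 j) else complex.Im (z 0 j)).

Lemma c2rK (R : realType) (n : nat) : cancel (@c2r R n) (@r2c R n).
Proof.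
move=> z; apply/rowP => j; rewrite mxE /c2r /xidx /yidx !mxvecE !mxE /=.
by case: (z 0 j).
Qed.

Lemma r2cK (R : realType) (n : nat) : cancel (@r2c R n) (@c2r R n).
Proof.
move=> x; apply/rowP => k; case/mxvec_indexP: k => j k.
rewrite /c2r mxvecE !mxE /=; case: (eqVneq k 0) => [->//|k0].
rewrite /yidx /=; congr (x 0 (mxvec_index j _)).
by apply/val_inj; case: k k0 => [[|[|]]].
Qed.

(* All partial derivatives of order at most 2 exist and are continuous at every
   point of U (meant for U open). *)
Definition C2_on (R : realType) (k : nat) (U : set 'rV[R]_k)
    (f : 'rV[R]_k -> R) : Prop :=
  let pd (l : 'I_k) (g : 'rV[R]_k -> R) : 'rV[R]_k -> R :=
    'D_(delta_mx 0 l) g in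
  forall x, U x ->
    [/\ {for x, continuous f},
        forall l, derivable f x (delta_mx 0 l) /\
          {for x, continuous (pd l f)}
      & forall l l', derivable (pd l f) x (delta_mx 0 l') /\
          {for x, continuous (pd l' (pd l f))}].

(* Partial derivative, along the l-th real coordinate, of a complex-valued
   function: taken separately on the real and imaginary parts. *)
Definition cpartial (R : realType) (n : nat) (l : 'I_(n * 2))
    (g : 'rV[R[i]]_n -> R[i]) (z : 'rV[R[i]]_n) : R[i] :=
  'D_(delta_mx 0 l) (fun x : 'rV[R]_(n * 2) => complex.Re (g (r2c x))) (c2r z)
  +i* 'D_(delta_mx 0 l)
        (fun x : 'rV[R]_(n * 2) => complex.Im (g (r2c x))) (c2r z).

(* Wirtinger derivatives d/dz_j = (d/dx_j - i d/dy_j) / 2 and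
   d/dzbar_j = (d/dx_j + i d/dy_j) / 2. *)
Definition dz (R : realType) (n : nat) (j : 'I_n)
    (g : 'rV[R[i]]_n -> R[i]) (z : 'rV[R[i]]_n) : R[i] :=
  2^-1 * (cpartial (xidx j) g z - (0 +i* 1) * cpartial (yidx j) g z).

Definition dzbar (R : realType) (n : nat) (j : 'I_n)
    (g : 'rV[R[i]]_n -> R[i]) (z : 'rV[R[i]]_n) : R[i] :=
  2^-1 * (cpartial (xidx j) g z + (0 +i* 1) * cpartial (yidx j) g z).

Definition DeltaB (R : realType) (n : nat) (f : 'rV[R[i]]_n -> R)
    (z : 'rV[R[i]]_n) : R[i] :=
  4 * (1 - cnorm z ^+ 2)%:C *
  \sum_(i < n) \sum_(j < n)
    ((i == j)%:R - z 0 i * (z 0 j)^*) * dz i (dzbar j (fun w => (f w)%:C)) z.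

(* Functions are total on C^n; only their values on the open ball matter. *)
Definition invariant_harmonic (R : realType) (n : nat)
    (f : 'rV[R[i]]_n -> R) : Prop :=
  C2_on [set x : 'rV[R]_(n * 2) | @cball R n (r2c x)] (f \o @r2c R n) /\
  forall z, @cball R n z -> DeltaB f z = 0.

(* The m x 2n Jacobian matrix with respect to x_1, y_1, ..., x_n, y_n.
   'J acts on row vectors from the right, hence the transpose. *)
Definition grad (R : realType) (n m : nat) (H : 'rV[R[i]]_n -> 'rV[R]_m)
    (z : 'rV[R[i]]_n) : 'M[R]_(m, n * 2) :=
  ('J (H \o @r2c R n) (c2r z))^T.

Definition opnorm (R : realType) (m k : nat) (A : 'M[R]_(m, k)) : R :=
  sup [set enorm (A *m v^T)^T | v in [set v : 'rV[R]_k | enorm v <= 1]].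

Definition Gamma (R : realType) (a : R) : R :=
  \int[lebesgue_measure]_(t in `]0, +oo[) (t `^ (a - 1) * expR (- t)).

(* Main.v *)
(** Write s = |x|^2, tau = i x, A_kl = delta_kl - x_k x_l - tau_k tau_l, so that f
   is invariant harmonic iff sum_kl A_kl D_k D_l f = 0 in the real coordinates of
   the ball. Moebius automorphisms of the ball preserve this equation, and move
   any tangent vector at any point to a multiple of the first coordinate vector
   at 0; so it is enough to bound D_1 f(0) when |f| <= 1.
   For a radial bump omega(s) supported in ]0, 1[, the divergence theorem shows
   that the integral of f(x) x_1 r^(-n-1) omega(s/r) does not depend on r; letting
   r tend to 0 gives D_1 f(0) \int x_1^2 omega = \int f x_1 omega, hence
   |D_1 f(0)| \int x_1^2 omega <= \int |x_1| omega. The two moments are compared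
   with Gaussian ones: averaging omega(s/t) against e^(-t) dt/t multiplies the
   d-th moment by Gamma(n + d/2) and turns omega into a function that lies
   between M e^(-s/a) and M e^(-s), where a < 1 is arbitrary.
   Integrals over R^N are replaced by Riemann sums over a refining lattice:
   they factor over the coordinates, and the divergence theorem becomes a
   telescoping sum. *)

Require Import Defs.
From mathcomp Require Import all_boot all_order all_algebra.
From mathcomp Require Import all_classical all_reals all_analysis.
From mathcomp Require Import measurable_realfun ring lra zify.

Set Implicit Arguments.
Unset Strict Implicit.
Unset Printing Implicit Defensive.

Import Order.TTheory GRing.Theory Num.Theory.
Import numFieldNormedType.Exports.
Local Open Scope classical_set_scope.
Local Open Scope ring_scope.

(** * Riemann sums over a lattice *)

(** The constant is a ratio of moments: for the density e^(-|x|^2) on R^(2n), \int |x_1| divided by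
    \int x_1^2 equals 2 / sqrt pi, and the Gamma quotient is the price of passing from [omega] to
    this density. Bumps of full dimension take the place of the sphere, so no surface measure and no
    boundary values of f occur. The obstacle is that the equation is not in divergence form: the
    rows of A_kl have divergence -2n x_k. A radial weight q has to absorb this drift. It solves a
    first-order equation with a pole at s = 1, whence the support in s <= b < 1. The factor 1 / (1 -
    |z|^2) is the norm of the inverse differential at 0 of the automorphism that sends 0 to z; the
    extreme direction is that of z itself. *)

Section LatticeSums.
Variable R : realType.

Definition lsize (m : nat) : nat := ((m.+1 ^ 3).*2).+1.
(* The lattice has mesh (m + 1)^-2 in the box [- (m + 1), m + 1]^N. *)
Definition step (m : nat) : R := ((m.+1 ^ 2)%:R)^-1.
Definition node (m : nat) (k : 'I_(lsize m)) : R :=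
  (k%:R - (m.+1 ^ 3)%:R) * step m.

Lemma step_gt0 m : 0 < step m.
Proof. by rewrite invr_gt0 ltr0n expn_gt0. Qed.

Lemma step_le1 m : step m <= 1.
Proof. by rewrite invf_le1 ?ltr0n ?expn_gt0// ler1n expn_gt0. Qed.

Lemma step_cvg0 : step m @[m --> \oo] --> (0 : R).
Proof.
apply: (@squeeze_cvgr _ _ _ _ (fun _ => 0) (@harmonic R)).
- near=> m; rewrite ltW ?step_gt0//= lef_pV2 ?posrE ?ltr0n ?expn_gt0//.
  by rewrite ler_nat expnS expn1 leq_pmulr.
- exact: cvg_cst.
- exact: cvg_harmonic.
Unshelve. all: by end_near. Qed.

Lemma node_rev m k : node (@rev_ord (lsize m) k) = - node k.
Proof.
rewrite /node -mulNr; congr (_ * _) => /=.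
have := ltn_ord k; rewrite {2}/lsize ltnS => kle.
by rewrite subSS natrB// -addnn natrD; ring.
Qed.

Definition lsum1 (m : nat) (f : R -> R) : R :=
  step m * \sum_(k < lsize m) f (node k).

Lemma lsum1_indic m (r : R) : 0 <= r ->
  lsum1 m (fun x => (`|x| <= r)%R%:R) <= 2 * r + step m.
Proof.
move=> r0; rewrite /lsum1 -natr_sum -big_mkcond/= sum1_card.
set A := (X in #|X|); set T := Num.truncn (r / step m).
have T0 : 0 <= r / step m by rewrite divr_ge0// ltW// step_gt0.
have leA : (#|A| <= T.*2.+1)%N.
  (* The indices that count lie in a run of 2T + 1 integers centred at (m + 1)^3, the index of the
     node 0. If T exceeds this centre, the subtraction truncates to 0 and the run still covers
     them. *)
  have -> : T.*2.+1 = size (iota (m.+1 ^ 3 - T) T.*2.+1) by rewrite size_iota.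
  rewrite cardE -(size_map val); apply: uniq_leq_size.
    by rewrite map_inj_uniq ?enum_uniq//; exact: val_inj.
  move=> _ /mapP[k + ->]; rewrite mem_enum => kA.
  have : `|node k| <= r by [].
  rewrite /node normrM (gtr0_norm (step_gt0 _)) -ler_pdivlMr ?step_gt0// => kr.
  rewrite mem_iota /=; set c := (m.+1 ^ 3)%N in kr *.
  have [ck|/ltnW kc] := leqP c k.
    have : (k - c <= T)%N.
      by rewrite /T Num.Theory.truncn_ge_nat// natrB// (le_trans (ler_norm _)).
    by move: ck; clear; lia.
  have : (c - k <= T)%N.
    rewrite /T Num.Theory.truncn_ge_nat// natrB// (le_trans _ kr)//.
    by rewrite distrC ler_norm.
  by move: kc; clear; lia.
have : #|A|%:R <= 2 * (r / step m) + 1.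
  apply: (@le_trans _ _ T.*2.+1%:R); first by rewrite ler_nat.
  rewrite -addn1 natrD lerD2r -muln2 natrM mulrC ler_pM2l//.
  by rewrite Num.Theory.truncn_le.
rewrite -(ler_pM2l (step_gt0 m)) => /le_trans; apply.
by rewrite mulrDr mulr1 lerD2r mulrCA (mulrC (step m)) divfK// gt_eqF// step_gt0.
Qed.

Variable N : nat.

Definition lpoint (m : nat) (a : {ffun 'I_N -> 'I_(lsize m)}) : 'rV[R]_N :=
  \row_i node (a i).

Definition lsum (m : nat) (f : 'rV[R]_N -> R) : R :=
  step m ^+ N * \sum_a f (@lpoint m a).

Lemma lsumD m f g : lsum m (fun x => f x + g x) = lsum m f + lsum m g.
Proof. by rewrite /lsum big_split mulrDr. Qed.

Lemma lsumZ m c f : lsum m (fun x => c * f x) = c * lsum m f.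
Proof. by rewrite /lsum -mulr_sumr mulrCA. Qed.

Lemma lsumB m f g : lsum m (fun x => f x - g x) = lsum m f - lsum m g.
Proof. by rewrite /lsum sumrB mulrBr. Qed.

Lemma eq_lsum m f g : f =1 g -> lsum m f = lsum m g.
Proof. by move=> fg; congr (_ * _); apply: eq_bigr => a _; exact: fg. Qed.

Lemma ler_lsum m f g : (forall x, f x <= g x) -> lsum m f <= lsum m g.
Proof.
move=> fg; rewrite /lsum ler_pM2l ?exprn_gt0 ?step_gt0//.
by apply: ler_sum => a _; exact: fg.
Qed.

Lemma lsum_ge0 m f : (forall x, 0 <= f x) -> 0 <= lsum m f.
Proof.
move=> f0; rewrite /lsum mulr_ge0 ?exprn_ge0 ?(ltW (step_gt0 _))//.
by apply: sumr_ge0 => a _; exact: f0.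
Qed.

Lemma ler_norm_lsum m f : `|lsum m f| <= lsum m (fun x => `|f x|).
Proof.
rewrite /lsum normrM ger0_norm ?exprn_ge0 ?(ltW (step_gt0 _))//.
by rewrite ler_pM2l ?exprn_gt0 ?step_gt0//; exact: ler_norm_sum.
Qed.

Lemma lsum_prod m (F : 'I_N -> R -> R) :
  lsum m (fun x => \prod_i F i (x 0 i)) = \prod_i lsum1 m (F i).
Proof.
rewrite /lsum /lsum1 big_split/= prodr_const card_ord; congr (_ * _).
rewrite bigA_distr_bigA/=; apply: eq_bigr => a _.
by apply: eq_bigr => i _; rewrite mxE.
Qed.

(** All error terms are estimated through this bound. It is uniform in [m], since [step m <= 1]. *)
Lemma lsum_box m (r C : R) (f : 'rV[R]_N -> R) : 0 <= r -> 0 <= C ->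
  (forall x, `|f x| <= C) ->
  (forall (x : 'rV[R]_N) i, r < `|x 0 i| -> f x = 0) ->
  `|lsum m f| <= C * (2 * r + step m) ^+ N.
Proof.
move=> r0 C0 fC f0; apply: (le_trans (ler_norm_lsum _ _)).
apply: (@le_trans _ _
    (lsum m (fun x => C * \prod_i (`|x 0 i| <= r)%R%:R))).
  apply: ler_lsum => x; have [xr|] := pselect (forall i, `|x 0 i| <= r).
    by rewrite big1 ?mulr1// => i _; rewrite xr.
  move=> /existsNP[i /negP]; rewrite -ltNge => xi.
  by rewrite (f0 _ _ xi) normr0 mulr_ge0// prodr_ge0.
rewrite lsumZ ler_wpM2l//.
rewrite (lsum_prod m (fun _ u => (`|u| <= r)%R%:R)).
apply: (@le_trans _ _ (\prod_(i < N) (2 * r + step m))).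
  apply: ler_prod => i _; rewrite lsum1_indic// andbT.
  by rewrite /lsum1 mulr_ge0 ?(ltW (step_gt0 _))// sumr_ge0.
by rewrite prodr_const card_ord.
Qed.

Definition flip (i : 'I_N) (x : 'rV[R]_N) : 'rV[R]_N :=
  \row_j (if j == i then - x 0 j else x 0 j).

(** The lattice is symmetric about 0, so the flip permutes its points and the cancellation is exact
    for every [m]. *)
Lemma lsum_odd m i (f : 'rV[R]_N -> R) : (forall x, f (flip i x) = - f x) -> lsum m f = 0.
Proof.
move=> fo; suff : lsum m f = - lsum m f by move=> h; lra.
rewrite {1}/lsum /lsum -mulrN; congr (_ * _).
pose h (a : {ffun 'I_N -> 'I_(lsize m)}) : {ffun 'I_N -> 'I_(lsize m)} :=
  [ffun j => if j == i then rev_ord (a j) else a j].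
have hK : cancel h h.
  move=> a; apply/ffunP => j; rewrite !ffunE.
  by case: eqP => // _; rewrite rev_ordK.
rewrite [LHS](reindex_inj (can_inj hK))/= -sumrN; apply: eq_bigr => a _.
rewrite -fo; congr f; apply/rowP => j; rewrite !mxE ffunE.
by case: eqP => // _; rewrite node_rev.
Qed.

(** Stands for the vanishing of the integral of [f] over R^N. *)
Definition null (f : 'rV[R]_N -> R) : Prop := lsum m f @[m --> \oo] --> (0 : R).

Lemma nullD f g : null f -> null g -> null (fun x => f x + g x).
Proof.
move=> f0 g0; rewrite /null; under eq_fun do rewrite lsumD.
by rewrite -(addr0 0); exact: cvgD.
Qed.

Lemma nullZ c f : null f -> null (fun x => c * f x).
Proof.
move=> f0; rewrite /null; under eq_fun do rewrite lsumZ.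
by rewrite -(mulr0 c); exact: cvgMr.
Qed.

Lemma null_sum (I : finType) (F : I -> 'rV[R]_N -> R) :
  (forall i, null (F i)) -> null (fun x => \sum_i F i x).
Proof.
move=> F0; elim: (index_enum I) => [|i r IH].
  rewrite /null (_ : lsum^~ _ = cst 0); first exact: cvg_cst.
  by apply/funext => m; rewrite /lsum big1 ?mulr0// => a _; rewrite big_nil.
by rewrite /null; under eq_fun do under eq_lsum do rewrite big_cons; exact: nullD.
Qed.

Lemma eq_null f g : f =1 g -> null f -> null g.
Proof. by move=> /funext ->. Qed.

End LatticeSums.

(** * Mean values along a line and uniform continuity *)

Section LineCalculus.
Variable R : realType.

Lemma is_derive_line (V W : normedModType R) (f : V -> W) (x v : V) t l :
  is_derive (x + t *: v) v f l ->
  is_derive t 1 (fun s : R => f (x + s *: v)) l.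
Proof.
have E : (fun h : R => h^-1 *: (((fun s : R => f (x + s *: v)) \o shift t)
              (h *: 1) - f (x + t *: v)))
    = (fun h => h^-1 *: ((f \o shift (x + t *: v)) (h *: v) - f (x + t *: v))).
  apply/funext => h /=; congr (_ *: (f _ - _)).
  by rewrite scaler1 scalerDl addrCA.
by move=> [df <-]; split; [rewrite /derivable E|rewrite /derive E].
Qed.

(** The ranges of [t] and [c] are symmetric about 0, which treats both signs of [a] at once and is
    precise enough for error estimates. *)
Lemma line_MVT (V : normedModType R) (f f' : V -> R) (x v : V) (a : R) :
  (forall t : R, `|t| <= `|a| -> is_derive (x + t *: v) v f (f' (x + t *: v))) ->
  exists2 c : R, `|c| <= `|a| & f (x + a *: v) - f x = a * f' (x + c *: v).
Proof.
move=> fd; pose g s := f (x + s *: v).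
have gd (t : R) : `|t| <= `|a| -> is_derive t (1 : R) g (f' (x + t *: v)).
  by move=> ta; apply/is_derive_line/fd.
have gc (u w : R) : (forall t : R, t \in `[u, w] -> `|t| <= `|a|) ->
    {within `[u, w], continuous g}.
  by move=> uw; apply: derivable_within_continuous => t /uw/gd [].
have gE : f (x + a *: v) - f x = g a - g 0 by rewrite /g scale0r addr0.
have [a0|a0] := leP 0 a.
  have ta (t : R) : t \in `[0, a] -> `|t| <= `|a|.
    by rewrite in_itv/= => /andP[t0 ta]; rewrite !ger0_norm.
  have [c /ta ca E] := MVT_segment a0
    (fun t tI => gd t (ta t (subset_itv_oo_cc tI))) (gc _ _ ta).
  by exists c => //; rewrite gE E subr0 mulrC.
have ta (t : R) : t \in `[a, 0] -> `|t| <= `|a|.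
  by rewrite in_itv/= => /andP[ta t0]; rewrite !ler0_norm ?lerN2// ltW.
have [c /ta ca E] := MVT_segment (ltW a0)
  (fun t tI => gd t (ta t (subset_itv_oo_cc tI))) (gc _ _ ta).
by exists c => //; rewrite gE -opprB E sub0r mulrN opprK mulrC.
Qed.

Lemma coord_le_norm n (x : 'rV[R]_n) i : `|x 0 i| <= `|x|.
Proof.
rewrite [leRHS]/Num.Def.normr/= mx_normrE.
exact: (le_bigmax _ (fun k : 'I_1 * 'I_n => `|x k.1 k.2|) (0, i)).
Qed.

Lemma norm_rV_le n (x : 'rV[R]_n) (r : R) :
  0 <= r -> (forall i, `|x 0 i| <= r) -> `|x| <= r.
Proof.
move=> r0 xr; rewrite [leLHS]/Num.Def.normr/= mx_normrE.
by apply: bigmax_le => // -[i j] _ /=; rewrite ord1.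
Qed.

(** Only [x] is confined to the ball: [y] may leave it, as an intermediate point of a difference
    quotient can. Compactness enters through near coverings, with a radius tending to 0 from the
    right as parameter. *)
Lemma heine_rV n (D : 'rV[R]_n -> R) (r : R) : continuous D ->
  forall e : R, 0 < e -> exists2 d, 0 < d &
    forall x y, `|x| <= r -> `|x - y| < d -> `|D x - D y| < e.
Proof.
move=> cD e e0.
have : compact [set x : 'rV[R]_n | `|x| <= r].
  apply: bounded_closed_compact.
    by exists r; split; [exact: num_real|move=> M rM x /= /le_trans; apply; exact: ltW].
  have : closed [set y : R | y <= r] by exact: closed_le.
  by move/(closed_comp (fun _ _ => @norm_continuous _ _ _)); apply.
move/compact_near_coveringP => /(_ R (0^'+)
  (fun d x => forall y, `|x - y| < d -> `|D x - D y| < e)).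
case=> [x _|d /= d0 dP].
  have e2 : 0 < e / 2 by rewrite divr_gt0.
  have [d /= d0 dP] : nbhs_ball x (fun t => `|D x - D t| < e / 2).
    by apply/nbhs_ballP; exact: (cvgrPdist_lt _ _).1 (cD x) _ e2.
  exists (ball x (d / 2), [set t | 0 < t < d / 2]).
    split => /=; first by apply: nbhsx_ballx; rewrite divr_gt0.
    by near=> t; apply/andP; split; near: t; [exact: nbhs_right_gt|apply: nbhs_right_lt; rewrite divr_gt0].
  move=> [y t] /= [xy /andP[t0 td]] z yz.
  have xz : `|x - z| < d.
    rewrite -(subrKA y) (le_lt_trans (ler_normD _ _))// [ltRHS]splitr ltrD//.
      by move: xy; rewrite -ball_normE.
    exact: lt_trans td.
  have xy' : `|x - y| < d.
    move: xy; rewrite -ball_normE /= => /lt_trans; apply.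
    by rewrite ltr_pdivrMr// mulr_natr mulr2n ltrDl.
  rewrite -(subrKA (D x)) (le_lt_trans (ler_normD _ _))// [ltRHS]splitr ltrD//.
    by rewrite distrC; apply: dP; rewrite -ball_normE.
  by apply: dP; rewrite -ball_normE.
exists (d / 2); first by rewrite divr_gt0.
move=> x y xr xy; apply: (dP (d / 2)) => //=.
- by rewrite sub0r normrN gtr0_norm ?divr_gt0// ltr_pdivrMr// mulr_natr mulr2n ltrDl.
- by rewrite divr_gt0.
Unshelve. all: by end_near. Qed.

End LineCalculus.

(** * The divergence theorem on the lattice *)

Section NullDerivative.
Variables (R : realType) (N : nat).

Lemma cube_step m : (m.+1 ^ 3)%:R * step R m = m.+1%:R.
Proof.
by rewrite expnS natrM -mulrA mulfV ?mulr1// pnatr_eq0 -lt0n expn_gt0.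
Qed.

(** The shift by one mesh is realized by the cyclic successor on indices. The two differ only at the
    last node, and there [V] vanishes on both sides: at the coordinate m + 1 + step and at the
    wrapped one, -(m + 1). *)
Lemma lsum_shift m (i : 'I_N) (V : 'rV[R]_N -> R) (r : R) : r + 1 <= m.+1%:R ->
  (forall x : 'rV[R]_N, r < `|x 0 i| -> V x = 0) ->
  lsum m (fun x => V (x + step R m *: delta_mx 0 i)) = lsum m V.
Proof.
move=> rm V0; rewrite /lsum; congr (_ * _).
pose h (a : {ffun 'I_N -> 'I_(lsize m)}) : {ffun 'I_N -> 'I_(lsize m)} :=
  [ffun j => if j == i then ordS (a j) else a j].
pose h' (a : {ffun 'I_N -> 'I_(lsize m)}) : {ffun 'I_N -> 'I_(lsize m)} :=
  [ffun j => if j == i then ord_pred (a j) else a j].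
have hK : cancel h h'.
  by move=> a; apply/ffunP => j; rewrite !ffunE; case: eqP => // _; rewrite ordSK.
rewrite [RHS](reindex_inj (can_inj hK))/=; apply: eq_bigr => a _.
have r1 : r < m.+1%:R by apply: lt_le_trans rm; rewrite ltrDl.
have e0 := @step_gt0 R m.
have [aP|] := eqVneq (val (a i)) (m.+1 ^ 3).*2.
  rewrite !V0//.
    rewrite !mxE ffunE eqxx /node /= aP modnn sub0r mulNr cube_step normrN.
    by rewrite ger0_norm.
  rewrite !mxE !eqxx /node /= aP mulr1 -addnn natrD addrK cube_step.
  by rewrite ger0_norm ?addr_ge0// ?(ltW e0)// (lt_trans r1)// ltrDl.
move=> aP; congr V; apply/rowP => j; rewrite !mxE ffunE eqxx /=.
case: eqP => [->|_]; last by rewrite mulr0 addr0.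
rewrite mulr1 /node /= modn_small; last first.
  by rewrite /lsize ltnS ltn_neqAle aP -ltnS ltn_ord.
by rewrite -natr1; ring.
Qed.

(** The difference quotient of [V] over one mesh has lattice sum 0 by [lsum_shift]. By the mean
    value theorem and uniform continuity it is uniformly close to [D], and the difference lives in a
    fixed cube. *)
Lemma null_derive (i : 'I_N) (V D : 'rV[R]_N -> R) (r : R) :
  (forall x, is_derive x (delta_mx 0 i) V (D x)) -> continuous D ->
  (forall (x : 'rV[R]_N) j, r < `|x 0 j| -> V x = 0) ->
  (forall (x : 'rV[R]_N) j, r < `|x 0 j| -> D x = 0) -> null D.
Proof.
wlog r0 : r / 0 <= r => [pos dV cD V0 D0|dV cD V0 D0].
  apply: (pos (Num.max r 0)) => //; first by rewrite le_max lexx orbT.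
    by move=> x j; rewrite gt_max => /andP[rx _]; exact: V0 rx.
  by move=> x j; rewrite gt_max => /andP[rx _]; exact: D0 rx.
pose C : R := (2 * (r + 1) + 1) ^+ N.
have C0 : 0 < C by rewrite exprn_gt0//; lra.
apply/cvgr0Pnorm_le => e e0.
have [d d0 dP] := heine_rV (r + 1) cD (divr_gt0 e0 C0).
near=> m.
have s0 := @step_gt0 R m; have s1 := step_le1 R m.
have sd : step R m < d by near: m; apply: (cvgr_lt 0 (@step_cvg0 R)).
have rm : r + 1 <= m.+1%:R.
  rewrite -natr1 lerD2r; near: m; exact: nbhs_infty_ger.
pose E x := D x - (step R m)^-1 * (V (x + step R m *: delta_mx 0 i) - V x).
have -> : lsum m D = lsum m E.
  rewrite /E lsumB lsumZ lsumB (lsum_shift rm) ?subrr ?mulr0 ?subr0//.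
  by move=> x /V0.
(* The cube grows by 1 because a shift of length at most 1 can push an outer point into the
   support. *)
have E0 (x : 'rV[R]_N) j : r + 1 < `|x 0 j| -> E x = 0.
  move=> rx; have rx' : r < `|x 0 j| by apply: lt_trans rx; rewrite ltrDl.
  rewrite /E (D0 _ _ rx') (V0 _ _ rx') (V0 _ j) ?(subr0, mulr0)//.
  rewrite !mxE; case: (j == i); rewrite ?mulr0 ?addr0// mulr1.
  rewrite -(ltrD2r 1) (lt_le_trans rx)//.
  have -> : x 0 j = x 0 j + step R m - step R m by rewrite addrK.
  by rewrite (le_trans (ler_normB _ _))// addrK lerD2l gtr0_norm.
have Ee x : `|E x| <= e / C.
  have [xr|/existsNP[j /negP]] := pselect (forall j, `|x 0 j| <= r + 1);
    last by rewrite -ltNge => /E0 ->; rewrite normr0 divr_ge0 ?ltW.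
  have [c cs] := @line_MVT R _ V D x (delta_mx 0 i) (step R m)
    (fun t _ => dV (x + t *: delta_mx 0 i)).
  rewrite /E => ->; rewrite mulKf ?gt_eqF// ltW// dP//.
    by apply: norm_rV_le => //; lra.
  rewrite opprD addNKr normrN (le_lt_trans _ sd)//.
  rewrite (gtr0_norm s0) in cs; apply: (le_trans _ cs); rewrite normrZ -[leRHS]mulr1.
  rewrite ler_wpM2l//; apply: norm_rV_le => // j; rewrite mxE.
  by case: (_ && _); rewrite ?normr1 ?normr0.
have r1 : 0 <= r + 1 by lra.
apply: (le_trans (lsum_box _ r1 (ltW (divr_gt0 e0 C0)) Ee E0)).
rewrite mulrAC ler_pdivrMr// ler_pM2l// /C lerXn2r// ?nnegrE; lra.
Unshelve. all: by end_near. Qed.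

End NullDerivative.

(** * Functions with continuous partial derivatives *)

Section Caratheodory.
Variable R : realType.

Lemma cvg_rV (T : Type) (F : set_system T) {FF : Filter F} n
    (Phi : T -> 'rV[R]_n) (l : 'rV[R]_n) :
  (forall k, Phi t 0 k @[t --> F] --> l 0 k) -> Phi t @[t --> F] --> l.
Proof.
move=> Pl; apply/cvgrPdist_le => e e0.
have : \forall t \near F, forall k, `|l 0 k - Phi t 0 k| <= e.
  by apply: filter_forall => k; exact: (cvgrPdist_le _ _).1 (Pl k) _ e0.
apply: filterS => t tl; apply: norm_rV_le => [|k]; first exact: ltW.
by rewrite !mxE.
Qed.

Lemma cvg_fsum (T : Type) (F : set_system T) {FF : Filter F} (I : finType)
    (f : I -> T -> R) (l : I -> R) : (forall i, f i t @[t --> F] --> l i) ->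
  \sum_i f i t @[t --> F] --> \sum_i l i.
Proof. by move=> fl; apply: cvg_big => // -[x y]; exact: add_continuous. Qed.

(** Going from [x] to [y] one coordinate at a time, every increment is a mean value of one partial
    derivative. The factors [g k] are these mean values, so they tend to [f' k x]. Chain rule and
    differentiability then follow from limits of sums and products. *)
Lemma caratheodory n (f : 'rV[R]_n -> R) (f' : 'I_n -> 'rV[R]_n -> R)
    (x : 'rV[R]_n) :
  (\forall y \near x, forall k, is_derive y (delta_mx 0 k) f (f' k y)) ->
  (forall k, {for x, continuous (f' k)}) ->
  exists g : 'I_n -> 'rV[R]_n -> R, (forall k, g k y @[y --> x] --> f' k x) /\
    \forall y \near x, f y - f x = \sum_k (y 0 k - x 0 k) * g k y.
Proof.
move=> /(@nbhs_ballP R 'rV[R]_n)[d /= d0 df] cf'.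
pose p (y : 'rV[R]_n) (j : nat) : 'rV[R]_n :=
  \row_i (if (i < j)%N then y 0 i else x 0 i).
have pS (y : 'rV[R]_n) (k : 'I_n) : p y k.+1 = p y k + (y 0 k - x 0 k) *: delta_mx 0 k.
  apply/rowP => i; rewrite !mxE eqxx/= ltnS leq_eqVlt.
  have [->|ik] := eqVneq i k; first by rewrite eqxx ltnn mulr1 subrKC.
  by rewrite (inj_eq val_inj) (negbTE ik) mulr0 addr0.
have px (y : 'rV[R]_n) (k : 'I_n) (t : R) : `|t| <= `|y 0 k - x 0 k| ->
    `|p y k + t *: delta_mx 0 k - x| <= `|y - x|.
  move=> ty; apply: norm_rV_le => // i; rewrite !mxE eqxx/=.
  have yx j : `|y 0 j - x 0 j| <= `|y - x|.
    by have := coord_le_norm (y - x) j; rewrite !mxE.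
  have [->|ik] := eqVneq i k.
    by rewrite ltnn mulr1 addrAC subrr add0r (le_trans ty).
  by rewrite mulr0 addr0; case: ifP => _ //; rewrite subrr normr0.
have ex (ky : 'I_n * 'rV[R]_n) : exists xi : 'rV[R]_n,
    `|xi - x| <= `|ky.2 - x| /\ (ball x d ky.2 ->
    f (p ky.2 ky.1.+1) - f (p ky.2 ky.1)
      = (ky.2 0 ky.1 - x 0 ky.1) * f' ky.1 xi).
  case: ky => k y /=; have [yd|yd] := pselect (ball x d y); last first.
    (* Outside the ball the intermediate point defaults to [x], so that it is never farther from [x]
       than [y] is. *)
    by exists x; split=> //; rewrite subrr normr0.
  have [t ty|c cy E] := @line_MVT R _ f (f' k) (p y k) (delta_mx 0 k) (y 0 k - x 0 k).
    apply: df; rewrite -ball_normE /= distrC.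
    by apply: le_lt_trans (px y k t ty) _; move: yd; rewrite -ball_normE /= distrC.
  exists (p y k + c *: delta_mx 0 k); split; first exact: px.
  by rewrite pS.
have [xi xiP] := choice ex.
exists (fun k y => f' k (xi (k, y))); split=> [k|].
  pose z (y : 'rV[R]_n) : 'rV[R]_n := xi (k, y).
  suff zx : z @ nbhs x --> x by exact: cvg_comp zx (cf' k).
  apply/(@cvgrPdist_lt _ 'rV[R]_n) => e e0.
  apply/(@nbhs_ballP R 'rV[R]_n); exists e => // y.
  rewrite -ball_normE/= distrC => yx.
  by rewrite distrC (le_lt_trans (xiP (k, y)).1).
apply/(@nbhs_ballP R 'rV[R]_n); exists d => //= y yd.
have -> : f y - f x = f (p y n) - f (p y 0%N).
  by congr (f _ - f _); apply/rowP => i; rewrite mxE ?ltn_ord.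
rewrite -(telescope_sumr (fun j => f (p y j)) (leq0n n)) big_mkord.
by apply: eq_bigr => k _; rewrite ((xiP (k, y)).2 yd).
Qed.

(** Substituting [Phi] into the factorization of [caratheodory] turns the difference quotient into a
    sum of products of convergent factors. *)
Lemma chain_derive (U : normedModType R) n (f : 'rV[R]_n -> R)
    (f' : 'I_n -> 'rV[R]_n -> R) (Phi : U -> 'rV[R]_n) (w v : U) (p : 'I_n -> R) :
  (\forall y \near Phi w, forall k, is_derive y (delta_mx 0 k) f (f' k y)) ->
  (forall k, {for Phi w, continuous (f' k)}) ->
  (forall k, is_derive w v (fun u => Phi u 0 k) (p k)) ->
  is_derive w v (fun u => f (Phi u)) (\sum_k p k * f' k (Phi w)).
Proof.
move=> df cf' dPhi; have [g [gf' gE]] := caratheodory df cf'.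
have cPhi : Phi (h *: v + w) @[h --> 0^'] --> Phi w.
  apply: cvg_rV => k.
  have : is_derive (w + 0 *: v) v (fun u => Phi u 0 k) (p k).
    by rewrite scale0r addr0.
  move=> /is_derive_line[/derivable1_diffP/differentiable_continuous + _].
  rewrite /prop_for /continuous_at scale0r addr0 => c0.
  have -> : (fun t : R => Phi (t *: v + w) 0 k) = (fun s => Phi (w + s *: v) 0 k).
    by apply/funext => t; rewrite addrC.
  by apply: cvg_trans c0; apply: cvg_app; exact: cvg_within.
have L : h^-1 *: (((fun u => f (Phi u)) \o shift w) (h *: v) - f (Phi w))
    @[h --> 0^'] --> \sum_k p k * f' k (Phi w).
  have H : \sum_k (h^-1 * (Phi (h *: v + w) 0 k - Phi w 0 k)) *
      g k (Phi (h *: v + w)) @[h --> 0^'] --> \sum_k p k * f' k (Phi w).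
    apply: cvg_fsum => k; apply: cvgM.
      by have [/[swap] <-] := dPhi k.
    exact: cvg_comp cPhi (gf' k).
  apply: cvg_trans H; apply: near_eq_cvg.
  have gE' : \forall h \near 0^', f (Phi (h *: v + w)) - f (Phi w) =
    \sum_k (Phi (h *: v + w) 0 k - Phi w 0 k) * g k (Phi (h *: v + w)).
    exact: cPhi _ gE.
  apply: filterS gE' => h /= ->.
  by rewrite /GRing.scale/= mulr_sumr; apply: eq_bigr => k _; rewrite mulrA.
split; first by apply/cvg_ex; eexists; exact: L.
exact/cvg_lim.
Qed.

Lemma is_derive_coord n (x v : 'rV[R]_n) k :
  is_derive x v (fun u : 'rV[R]_n => u 0 k) (v 0 k).
Proof.
have E : (fun h : R => h^-1 *: (((fun u : 'rV[R]_n => u 0 k) \o shift x) (h *: v)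
    - x 0 k)) @ 0^' --> v 0 k.
  apply: cvg_near_cst; near=> h.
  rewrite /= !mxE addrK /GRing.scale/= mulKf//.
  by near: h; exact: nbhs_dnbhs_neq.
by split; [apply/cvg_ex; eexists; exact: E|exact/cvg_lim].
Unshelve. all: by end_near. Qed.

Lemma differentiable_eps (V W : normedModType R) (F : V -> W)
    (df : {linear V -> W}) (x : V) : continuous df ->
  (forall e : R, 0 < e ->
    \forall y \near x, `|F y - F x - df (y - x)| <= e * `|y - x|) ->
  differentiable F x.
Proof.
move=> cdf Fe; have E : F \o shift x = cst (F x) + df +o_ 0 id.
  apply/eqaddoP => e /Fe; rewrite (near_shift 0 x); apply: filterS => h.
  by rewrite /= subr0 addrK !fctE /= opprD addrA.
by apply/diff_locallyP; rewrite (diff_unique cdf E).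
Qed.

Lemma C1_differentiable n m (F : 'rV[R]_n -> 'rV[R]_m)
    (F' : 'I_n -> 'I_m -> 'rV[R]_n -> R) (x : 'rV[R]_n) :
  (\forall y \near x, forall k i,
    is_derive y (delta_mx 0 k) (fun u => F u 0 i) (F' k i y)) ->
  (forall k i, {for x, continuous (F' k i)}) ->
  differentiable F x.
Proof.
move=> dF cF.
have car i : exists g : 'I_n -> 'rV[R]_n -> R,
    (forall k, g k y @[y --> x] --> F' k i x) /\
    \forall y \near x, F y 0 i - F x 0 i = \sum_k (y 0 k - x 0 k) * g k y.
  apply: (@caratheodory n (fun u => F u 0 i) (fun k => F' k i)) => [|k].
    by apply: filterS dF => y dy k.
  exact: cF.
have [g gP] := choice car.
pose M : 'M[R]_(n, m) := \matrix_(k, i) F' k i x.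
pose df : {linear 'rV[R]_n -> 'rV[R]_m} := mulmxr M.
have dfE v i : df v 0 i = \sum_k v 0 k * F' k i x.
  by rewrite /df /= mxE; apply: eq_bigr => k _; rewrite mxE.
have cdf : continuous df.
  move=> v; apply: (@cvg_rV 'rV[R]_n (nbhs v) _ m df) => i.
  under eq_fun do rewrite dfE.
  rewrite dfE; apply: cvg_fsum => k; apply: cvgM; last exact: cvg_cst.
  exact: coord_continuous.
apply: (differentiable_eps cdf) => e e0.
pose d := e / (n%:R + 1).
have n0 : 0 < n%:R + 1 :> R by rewrite ltr_wpDl.
have d0 : 0 < d by rewrite divr_gt0.
have H1 i : \forall y \near x, forall k, `|F' k i x - g i k y| <= d.
  apply: (@filter_forall _ _ (fun k y => `|F' k i x - g i k y| <= d) (nbhs x)) => k.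
  exact: (cvgrPdist_le _ _).1 ((gP i).1 k) _ d0.
have H : \forall y \near x, forall i, (forall k, `|F' k i x - g i k y| <= d) /\
    F y 0 i - F x 0 i = \sum_k (y 0 k - x 0 k) * g i k y.
  pose P i y := (forall k, `|F' k i x - g i k y| <= d) /\
    F y 0 i - F x 0 i = \sum_k (y 0 k - x 0 k) * g i k y.
  apply: (@filter_forall _ _ P (nbhs x)) => i.
  exact: filterI (H1 i) (gP i).2.
apply: filterS H => y H; apply: norm_rV_le => [|i]; first by rewrite mulr_ge0// ltW.
have [h1 h2] := H i.
have -> : (F y - F x - df (y - x)) 0 i = F y 0 i - F x 0 i - df (y - x) 0 i.
  by rewrite 4!mxE.
rewrite h2 dfE -sumrB.
apply: (le_trans (ler_norm_sum _ _ _)).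
apply: (@le_trans _ _ (\sum_(k < n) `|y - x| * d)).
  apply: ler_sum => k _; have := coord_le_norm (y - x) k; rewrite !mxE => yxk.
  rewrite -mulrBr normrM ler_pM//.
  by rewrite distrC h1.
rewrite sumr_const card_ord -mulr_natl mulrCA mulrC ler_wpM2r//.
by rewrite /d mulrCA ler_piMr ?(ltW e0)// ler_pdivrMr// mul1r lerDl.
Qed.

(** Links the total differential, through which the Jacobian is defined, to the partial derivatives
    in which the rest of the proof is written. *)
Lemma C1_diff n m (F : 'rV[R]_n -> 'rV[R]_m)
    (F' : 'I_n -> 'I_m -> 'rV[R]_n -> R) (x v : 'rV[R]_n) i :
  (\forall y \near x, forall k i,
    is_derive y (delta_mx 0 k) (fun u => F u 0 i) (F' k i y)) ->
  (forall k i, {for x, continuous (F' k i)}) ->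
  'd F x v 0 i = \sum_k v 0 k * F' k i x.
Proof.
move=> dF cF; have difF := C1_differentiable dF cF.
rewrite -(deriveE v difF) derive_mx; last exact: diff_derivable.
rewrite mxE; apply: derive_val.
apply: (@chain_derive _ n (fun u => F u 0 i) (fun k => F' k i) id x v).
- by apply: filterS dF => y dy k.
- by move=> k; exact: cF.
- by move=> k; exact: is_derive_coord.
Qed.

End Caratheodory.

Section DeriveRules.
Variables (R : realType) (V : normedModType R) (x v : V).
Implicit Types (f g : V -> R).

Lemma drvD f g df dg : is_derive x v f df -> is_derive x v g dg ->
  is_derive x v (fun y => f y + g y) (df + dg).
Proof. exact: is_deriveD. Qed.

Lemma drvB f g df dg : is_derive x v f df -> is_derive x v g dg ->
  is_derive x v (fun y => f y - g y) (df - dg).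
Proof. exact: is_deriveB. Qed.

Lemma drvN f df : is_derive x v f df -> is_derive x v (fun y => - f y) (- df).
Proof. exact: is_deriveN. Qed.

Lemma drvM f g df dg : is_derive x v f df -> is_derive x v g dg ->
  is_derive x v (fun y => f y * g y) (df * g x + f x * dg).
Proof.
move=> hf hg; have := is_deriveM hf hg.
by rewrite /GRing.scale/= addrC [g x * _]mulrC.
Qed.

Lemma drvC (c : R) : is_derive x v (fun _ => c) 0.
Proof. exact: is_derive_cst. Qed.

Lemma drvS (I : finType) (F : I -> V -> R) (dF : I -> R) :
  (forall i, is_derive x v (F i) (dF i)) ->
  is_derive x v (fun y => \sum_i F i y) (\sum_i dF i).
Proof.
move=> h; elim: (index_enum I) => [|i r IH].
  by under eq_fun do rewrite big_nil; rewrite big_nil; exact: drvC.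
by under eq_fun do rewrite big_cons; rewrite big_cons; exact: drvD.
Qed.

Lemma drvV f df : is_derive x v f df -> f x != 0 ->
  is_derive x v (fun y => (f y)^-1) (- df / f x ^+ 2).
Proof.
move=> [hf <-] fx0; split; first exact: derivableV.
by rewrite deriveV// /GRing.scale/= mulrC -exprVn mulrN mulNr.
Qed.

Lemma line_is_derive f l :
  is_derive (0 : R) (1 : R) (fun s : R => f (x + s *: v)) l -> is_derive x v f l.
Proof.
have E : (fun h : R => h^-1 *: (((fun s : R => f (x + s *: v)) \o shift 0)
              (h *: 1) - f (x + 0 *: v)))
    = (fun h => h^-1 *: ((f \o shift x) (h *: v) - f x)).
  apply/funext => h /=; congr (_ *: (f _ - f _)); last by rewrite scale0r addr0.
  by rewrite scaler1 addr0 addrC.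
by move=> [df <-]; split; [rewrite /derivable -E|rewrite /derive -E].
Qed.

Lemma drv_comp (g : R -> R) f df dg :
  is_derive (f x) (1 : R) g dg -> is_derive x v f df ->
  is_derive x v (fun y => g (f y)) (dg * df).
Proof.
move=> hg hf; apply: line_is_derive.
have hf' : is_derive (x + 0 *: v) v f df by rewrite scale0r addr0.
apply: (@is_derive1_comp _ g (fun s => f (x + s *: v))).
  by rewrite scale0r addr0.
exact: is_derive_line hf'.
Qed.

End DeriveRules.

Lemma is_deriveE (R : realType) (V : normedModType R) (x v : V) (f : V -> R) l l' :
  is_derive x v f l -> l = l' -> is_derive x v f l'.
Proof. by move=> ? <-. Qed.

Section ContinuityRules.
Variables (R : realType) (V : topologicalType) (x : V).
Implicit Types (f g : V -> R).

Lemma ctsC (c : R) : {for x, continuous (fun _ : V => c)}.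
Proof. exact: cvg_cst. Qed.

Lemma ctsD f g : {for x, continuous f} -> {for x, continuous g} ->
  {for x, continuous (fun y => f y + g y)}.
Proof. exact: cvgD. Qed.

Lemma ctsB f g : {for x, continuous f} -> {for x, continuous g} ->
  {for x, continuous (fun y => f y - g y)}.
Proof. exact: cvgB. Qed.

Lemma ctsN f : {for x, continuous f} -> {for x, continuous (fun y => - f y)}.
Proof. exact: cvgN. Qed.

Lemma ctsM f g : {for x, continuous f} -> {for x, continuous g} ->
  {for x, continuous (fun y => f y * g y)}.
Proof. exact: cvgM. Qed.

Lemma ctsV f : {for x, continuous f} -> f x != 0 ->
  {for x, continuous (fun y => (f y)^-1)}.
Proof. by move=> cf f0; exact: cvgV. Qed.

Lemma ctsS (I : finType) (F : I -> V -> R) :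
  (forall i, {for x, continuous (F i)}) -> {for x, continuous (fun y => \sum_i F i y)}.
Proof. by move=> cF; apply: (@cvg_fsum R V (nbhs x)). Qed.

Lemma cts_near_cst f c : (\forall y \near x, f y = c) -> {for x, continuous f}.
Proof.
move=> fc; rewrite /prop_for /continuous_at (nbhs_singleton fc).
exact: cvg_near_cst fc.
Qed.

Lemma cts_comp (U : topologicalType) (W : topologicalType) (g : U -> W) (f : V -> U) :
  {for f x, continuous g} -> {for x, continuous f} ->
  {for x, continuous (fun y => g (f y))}.
Proof. by move=> cg cf; exact: (@continuous_comp _ _ _ f g). Qed.

End ContinuityRules.

(** * The flux of an invariant harmonic function *)

Section Flux.
Variables (R : realType) (N : nat).
Implicit Types x : 'rV[R]_N.

Definition sqn x : R := \sum_i x 0 i ^+ 2.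

Lemma sqn_ge0 x : 0 <= sqn x.
Proof. by apply: sumr_ge0 => i _; exact: sqr_ge0. Qed.

Lemma sqn_gt1 x j : 1 < `|x 0 j| -> 1 < sqn x.
Proof.
move=> xj; rewrite /sqn (bigD1 j)//= -real_normK ?num_real// ltr_wpDr//.
  by apply: sumr_ge0 => i _; exact: sqr_ge0.
by rewrite expr_gt1.
Qed.

Lemma d_coord x l k :
  is_derive x (delta_mx 0 l) (fun y : 'rV[R]_N => y 0 k) (l == k)%:R.
Proof.
by have := @is_derive_coord R N x (delta_mx 0 l) k; rewrite mxE eqxx eq_sym.
Qed.

Lemma sum_delta (F : 'I_N -> R) l : \sum_k (l == k)%:R * F k = F l.
Proof.
rewrite (bigD1 l)//= eqxx mul1r big1 ?addr0// => k kl.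
by rewrite eq_sym (negbTE kl) mul0r.
Qed.

Lemma d_sqn x l : is_derive x (delta_mx 0 l) sqn (2 * x 0 l).
Proof.
apply: (@is_deriveE _ _ _ _ _ (\sum_k 2 * ((l == k)%:R * x 0 k))); last first.
  by rewrite -mulr_sumr sum_delta.
apply: drvS => k; apply: is_deriveE (drvM (d_coord _ _ _) (d_coord _ _ _)) _.
by rewrite mulrC; ring.
Qed.

Lemma continuous_sqn : continuous sqn.
Proof.
by move=> x; apply: ctsS => k; apply: ctsM; exact: coord_continuous.
Qed.

Lemma open_ball_sqn x : sqn x < 1 -> \forall y \near x, sqn y < 1.
Proof. by move=> x1; exact: (cvgr_lt _ (continuous_sqn (x:=x))). Qed.

Variable J : 'M[R]_N.
Hypotheses (JT : J^T = - J) (JJ : J *m J = - 1%:M).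

(** For the complex structure this is the vector i x; what is used of [J] is that it is skew with
    square -1. *)
Definition tau x k : R := \sum_l x 0 l * J l k.

Lemma d_tau x l k : is_derive x (delta_mx 0 l) (tau^~ k) (J l k).
Proof.
apply: (@is_deriveE _ _ _ _ _ (\sum_j (l == j)%:R * J j k)); last exact: sum_delta.
apply: drvS => j; apply: is_deriveE (drvM (d_coord _ _ _) (drvC _ _ _)) _.
by rewrite mulr0 addr0.
Qed.

Lemma J_anti k l : J k l = - J l k.
Proof. by have /matrixP/(_ l k) := JT; rewrite !mxE. Qed.

Lemma J_diag k : J k k = 0.
Proof. by have := J_anti k k => h; lra. Qed.

Lemma tau_tau x k : \sum_l tau x l * J l k = - x 0 k.
Proof.
rewrite /tau; under eq_bigr do rewrite mulr_suml.
rewrite exchange_big/=.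
have -> : - x 0 k = \sum_j (k == j)%:R * - x 0 j by rewrite sum_delta.
apply: eq_bigr => j _; under eq_bigr do rewrite -mulrA.
rewrite -mulr_sumr; have /matrixP/(_ j k) := JJ; rewrite !mxE => ->.
by rewrite eq_sym mulrN mulrC mulrN.
Qed.

Lemma x_tau x : \sum_l x 0 l * tau x l = 0.
Proof.
suff : \sum_l x 0 l * tau x l = - \sum_l x 0 l * tau x l by move=> h; lra.
rewrite /tau; under eq_bigr do rewrite mulr_sumr.
rewrite [LHS]exchange_big/= -sumrN; apply: eq_bigr => j _.
by rewrite -sumrN; apply: eq_bigr => l _; rewrite (J_anti j l); ring.
Qed.

(** The derivatives are given as functions [f1] and [f2], so that a composition with an automorphism
    can supply its own by explicit formulas. *)
Definition harmonic_data (f : 'rV[R]_N -> R) (f1 : 'I_N -> 'rV[R]_N -> R)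
    (f2 : 'I_N -> 'I_N -> 'rV[R]_N -> R) : Prop :=
  forall x, sqn x < 1 ->
  [/\ {for x, continuous f},
      forall k, is_derive x (delta_mx 0 k) f (f1 k x) /\ {for x, continuous (f1 k)},
      forall k l, is_derive x (delta_mx 0 l) (f1 k) (f2 k l x) /\
        {for x, continuous (f2 k l)}
    & \sum_k \sum_l ((k == l)%:R - x 0 k * x 0 l - tau x k * tau x l) * f2 k l x
      = 0].

Section FluxIdentity.
Variables (f : 'rV[R]_N -> R) (f1 : 'I_N -> 'rV[R]_N -> R)
  (f2 : 'I_N -> 'I_N -> 'rV[R]_N -> R).
Hypothesis harm : harmonic_data f f1 f2.
Variables (n : nat) (i0 : 'I_N) (q Y Y' : R -> R).
Hypothesis Nn : N%:R = 2 * n%:R :> R.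

(** The field [V] below is Green's field q (f A grad h - h A grad f) for f and the solution h =
    x_i0, plus the radial field 2 Y f h x; here [B] is A grad f and [W] is q A grad h + 2 Y h x.
    Since x . A grad f = (1 - s) E and div (A grad f) = -2n E, the terms with [E] cancel exactly
    when (1 - s) q' = n q + Y, which is the definition of [q']. *)
Let q' s := (Y s + n%:R * q s) / (1 - s).
Let E x := \sum_k x 0 k * f1 k x.
Let T x := \sum_k tau x k * f1 k x.
Let B l x := f1 l x - x 0 l * E x - tau x l * T x.
Let W l x := (l == i0)%:R * q (sqn x)
  + x 0 l * (x 0 i0 * (2 * Y (sqn x) - q (sqn x))) - tau x l * (tau x i0 * q (sqn x)).
Let V l x := f x * W l x - x 0 i0 * q (sqn x) * B l x.

Let W' l x := (l == i0)%:R * (q' (sqn x) * (2 * x 0 l))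
  + (x 0 i0 * (2 * Y (sqn x) - q (sqn x))
     + x 0 l * ((l == i0)%:R * (2 * Y (sqn x) - q (sqn x))
                + x 0 i0 * (2 * (Y' (sqn x) * (2 * x 0 l)) - q' (sqn x) * (2 * x 0 l))))
  - (J l l * (tau x i0 * q (sqn x))
     + tau x l * (J l i0 * q (sqn x) + tau x i0 * (q' (sqn x) * (2 * x 0 l)))).
Let E' l x := f1 l x + \sum_k x 0 k * f2 k l x.
Let T' l x := \sum_k J l k * f1 k x + \sum_k tau x k * f2 k l x.
Let B' l x := f2 l l x - (E x + x 0 l * E' l x) - (J l l * T x + tau x l * T' l x).
Let V' l x := f1 l x * W l x + f x * W' l x
  - (((l == i0)%:R * q (sqn x) + x 0 i0 * (q' (sqn x) * (2 * x 0 l))) * B l x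
     + x 0 i0 * q (sqn x) * B' l x).

Lemma sum_x2 x : \sum_l x 0 l * x 0 l = sqn x.
Proof. by apply: eq_bigr => l _; rewrite expr2. Qed.

Lemma sum_delta_r (F : 'I_N -> R) : \sum_l (l == i0)%:R * F l = F i0.
Proof. by under eq_bigr do rewrite eq_sym; exact: sum_delta. Qed.

Lemma natr_sum_const (c : R) : N%:R * c = \sum_(l < N) c.
Proof. by rewrite sumr_const card_ord mulr_natl. Qed.

Lemma sum_dW x : sqn x < 1 ->
  \sum_l W' l x = 4 * x 0 i0 * ((n%:R + 1) * Y (sqn x) + sqn x * Y' (sqn x)).
Proof.
move=> x1.
have -> : \sum_l W' l x =
    2 * q' (sqn x) * (\sum_l (l == i0)%:R * x 0 l)
    + (N%:R * (x 0 i0 * (2 * Y (sqn x) - q (sqn x))))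
    + (2 * Y (sqn x) - q (sqn x)) * (\sum_l (l == i0)%:R * x 0 l)
    + x 0 i0 * (4 * Y' (sqn x) - 2 * q' (sqn x)) * (\sum_l x 0 l * x 0 l)
    - (tau x i0 * q (sqn x) * \sum_l J l l
       + q (sqn x) * (\sum_l tau x l * J l i0)
       + tau x i0 * 2 * q' (sqn x) * (\sum_l x 0 l * tau x l)).
  rewrite natr_sum_const !mulr_sumr.
  rewrite -!big_split/= -sumrB; apply: eq_bigr => l _.
  by rewrite /W'; ring.
rewrite sum_delta_r sum_x2 x_tau tau_tau (eq_bigr (fun=> 0)) => [|l _]; last first.
  exact: J_diag.
rewrite big1 // Nn /q'.
by field; rewrite subr_eq0 gt_eqF.
Qed.

(** The k-th row of A has divergence -N x_k: the terms x_k x_l contribute -(N + 1) x_k, and the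
    terms tau_k tau_l contribute x_k because J^2 = -1. *)
Lemma sum_dB x : sqn x < 1 -> \sum_l B' l x = - (N%:R * E x).
Proof.
move=> x1; have [_ _ _ L] := harm x1.
have -> : \sum_l B' l x = \sum_k \sum_l
     ((k == l)%:R - x 0 k * x 0 l - tau x k * tau x l) * f2 k l x
     - N%:R * E x - E x - T x * \sum_l J l l
     - \sum_k (\sum_l tau x l * J l k) * f1 k x.
  have -> : \sum_k \sum_l
     ((k == l)%:R - x 0 k * x 0 l - tau x k * tau x l) * f2 k l x
    = \sum_l f2 l l x - \sum_l x 0 l * (\sum_k x 0 k * f2 k l x)
      - \sum_l tau x l * (\sum_k tau x k * f2 k l x).
    rewrite exchange_big/= -!sumrB; apply: eq_bigr => l _.
    rewrite !mulr_sumr.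
    have -> : f2 l l x = \sum_k (l == k)%:R * f2 k l x.
      by rewrite (sum_delta (fun k => f2 k l x)).
    by rewrite -!sumrB; apply: eq_bigr => k _; rewrite (eq_sym k l); ring.
  have -> : \sum_k (\sum_l tau x l * J l k) * f1 k x
      = \sum_l tau x l * (\sum_k J l k * f1 k x).
    under eq_bigr do rewrite mulr_suml.
    rewrite exchange_big/=; apply: eq_bigr => l _; rewrite mulr_sumr.
    by apply: eq_bigr => k _; rewrite mulrA.
  rewrite natr_sum_const [in T x * _]mulr_sumr.
  rewrite {2}/E -!sumrB; apply: eq_bigr => l _.
  by rewrite /B' /E' /T'; ring.
rewrite L big1 => [|l _]; last exact: J_diag.
have -> : \sum_k (\sum_l tau x l * J l k) * f1 k x = - E x.
  by rewrite /E -sumrN; apply: eq_bigr => k _; rewrite tau_tau mulNr.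
by ring.
Qed.

(** These are all the terms of div V that contain first derivatives of [f]; the choice of [q'] makes
    them cancel. *)
Lemma flux_cancel x : sqn x < 1 ->
  \sum_l f1 l x * W l x
  - \sum_l ((l == i0)%:R * q (sqn x) + x 0 i0 * (q' (sqn x) * (2 * x 0 l))) * B l x
  + x 0 i0 * q (sqn x) * (N%:R * E x) = 0.
Proof.
move=> x1.
have -> : \sum_l f1 l x * W l x = f1 i0 x * q (sqn x)
    + x 0 i0 * (2 * Y (sqn x) - q (sqn x)) * E x - tau x i0 * q (sqn x) * T x.
  have -> : f1 i0 x * q (sqn x) = \sum_l (l == i0)%:R * (f1 l x * q (sqn x)).
    by rewrite sum_delta_r.
  rewrite /E /T !mulr_sumr -big_split/= -sumrB; apply: eq_bigr => l _.
  by rewrite /W; ring.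
have xB : \sum_l x 0 l * B l x = (1 - sqn x) * E x.
  have -> : \sum_l x 0 l * B l x = E x - E x * (\sum_l x 0 l * x 0 l)
      - T x * (\sum_l x 0 l * tau x l).
    by rewrite {1}/E !mulr_sumr -!sumrB; apply: eq_bigr => l _; rewrite /B; ring.
  by rewrite x_tau sum_x2; ring.
have -> : \sum_l ((l == i0)%:R * q (sqn x) + x 0 i0 * (q' (sqn x) * (2 * x 0 l))) * B l x
    = q (sqn x) * B i0 x + 2 * x 0 i0 * q' (sqn x) * ((1 - sqn x) * E x).
  rewrite -xB -(sum_delta_r (fun l => B l x)) !mulr_sumr -big_split/=.
  by apply: eq_bigr => l _; ring.
rewrite /B Nn /q'.
by field; rewrite subr_eq0 gt_eqF.
Qed.

Lemma sum_dV x : sqn x < 1 ->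
  \sum_l V' l x = 4 * (f x * (x 0 i0 * ((n%:R + 1) * Y (sqn x) + sqn x * Y' (sqn x)))).
Proof.
move=> x1.
have -> : \sum_l V' l x = f x * (\sum_l W' l x)
  + (\sum_l f1 l x * W l x
  - \sum_l ((l == i0)%:R * q (sqn x) + x 0 i0 * (q' (sqn x) * (2 * x 0 l))) * B l x
  - x 0 i0 * q (sqn x) * \sum_l B' l x).
  rewrite !mulr_sumr -!sumrB -big_split/=; apply: eq_bigr => l _.
  by rewrite /V'; ring.
rewrite sum_dB// mulrN opprK flux_cancel// sum_dW//; ring.
Qed.

Variable b : R.
Hypotheses (b1 : b < 1) (qb : forall s, b < s -> q s = 0)
  (Yb : forall s, b < s -> Y s = 0) (Y'b : forall s, b < s -> Y' s = 0).
Hypotheses (dq : forall s : R, s < 1 -> is_derive s (1 : R) q (q' s))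
  (dY : forall s : R, is_derive s (1 : R) Y (Y' s)) (cY' : continuous Y').

Let d_radial (g g' : R -> R) x l : is_derive (sqn x) (1 : R) g (g' (sqn x)) ->
  is_derive x (delta_mx 0 l) (fun y => g (sqn y)) (g' (sqn x) * (2 * x 0 l)).
Proof. by move=> dg; exact: drv_comp dg (d_sqn x l). Qed.

Let d_W x l : sqn x < 1 -> is_derive x (delta_mx 0 l) (W l) (W' l x).
Proof.
move=> x1; have Dq := d_radial l (dq x1); have DY := d_radial l (dY (sqn x)).
have Dp : is_derive x (delta_mx 0 l) (fun y => 2 * Y (sqn y) - q (sqn y))
    (2 * (Y' (sqn x) * (2 * x 0 l)) - q' (sqn x) * (2 * x 0 l)).
  by apply: is_deriveE (drvB (drvM (drvC _ _ _) DY) Dq) _; ring.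
apply: is_deriveE (drvB (drvD (drvM (drvC _ _ _) Dq)
  (drvM (d_coord _ _ _) (drvM (d_coord _ _ _) Dp)))
  (drvM (d_tau _ _ _) (drvM (d_tau _ _ _) Dq))) _.
by rewrite /W' eqxx mul1r; ring.
Qed.

Let d_B x l : sqn x < 1 -> is_derive x (delta_mx 0 l) (B l) (B' l x).
Proof.
move=> x1; have [_ _ D2 _] := harm x1.
have DE : is_derive x (delta_mx 0 l) E (E' l x).
  apply: is_deriveE (drvS (fun k => drvM (d_coord x l k) (D2 k l).1)) _.
  by rewrite big_split/= (sum_delta (fun k => f1 k x)).
have DT : is_derive x (delta_mx 0 l) T (T' l x).
  apply: is_deriveE (drvS (fun k => drvM (d_tau x l k) (D2 k l).1)) _.
  by rewrite big_split.
apply: is_deriveE (drvB (drvB (D2 l l).1 (drvM (d_coord _ _ _) DE))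
  (drvM (d_tau _ _ _) DT)) _.
by rewrite /B' eqxx mul1r.
Qed.

Let d_V x l : sqn x < 1 -> is_derive x (delta_mx 0 l) (V l) (V' l x).
Proof.
move=> x1; have [_ D1 _ _] := harm x1.
apply: is_deriveE (drvB (drvM (D1 l).1 (d_W l x1))
  (drvM (drvM (d_coord _ _ _) (d_radial l (dq x1))) (d_B l x1))) _.
by rewrite /V'.
Qed.

Let c_tau x l : {for x, continuous (tau^~ l)}.
Proof. by apply: ctsS => k; apply: ctsM; [exact: coord_continuous|exact: ctsC]. Qed.

Let c_coord x l : {for x, continuous (fun y : 'rV[R]_N => y 0 l)}.
Proof. exact: coord_continuous. Qed.

Let c_radial (g : R -> R) x : {for sqn x, continuous g} ->
  {for x, continuous (fun y => g (sqn y))}.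
Proof. by move=> cg; apply: cts_comp => //; exact: continuous_sqn. Qed.

Let c_dV x l : sqn x < 1 -> {for x, continuous (V' l)}.
Proof.
move=> x1; have [Cf C1 C2 _] := harm x1.
have cf1 k := (C1 k).2; have cf2 k j := (C2 k j).2.
have der_c (g : R -> R) s g' : is_derive s (1 : R) g g' -> {for s, continuous g}.
  by move=> [/derivable1_diffP/differentiable_continuous].
have cq0 : {for sqn x, continuous q} by exact: der_c (dq x1).
have cY0 : {for sqn x, continuous Y} by exact: der_c (dY _).
have cq := c_radial cq0; have cY := c_radial cY0; have cYd := c_radial (cY' (x:=sqn x)).
have cq'd : {for x, continuous (fun y => q' (sqn y))}.
  apply: ctsM; first by apply: ctsD => //; apply: ctsM => //; exact: ctsC.
  apply: ctsV; last by rewrite subr_eq0 gt_eqF.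
  by apply: ctsB; [exact: ctsC|exact: continuous_sqn].
have cE : {for x, continuous E} by apply: ctsS => k; exact: ctsM.
have cT : {for x, continuous T} by apply: ctsS => k; exact: ctsM.
have cx k := @c_coord x k; have ct k := @c_tau x k.
have cp := ctsB (ctsM (@ctsC R _ x 2) cY) cq.
have cW : {for x, continuous (W l)} := ctsB (ctsD (ctsM (@ctsC R _ x _) cq)
  (ctsM (cx l) (ctsM (cx i0) cp))) (ctsM (ct l) (ctsM (ct i0) cq)).
have cB0 : {for x, continuous (B l)} :=
  ctsB (ctsB (cf1 l) (ctsM (cx l) cE)) (ctsM (ct l) cT).
have c2x : {for x, continuous (fun y : 'rV[R]_N => 2 * y 0 l)} :=
  ctsM (@ctsC R _ x _) (cx l).
have cqx := ctsM cq'd c2x.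
have cW' : {for x, continuous (W' l)} := ctsB (ctsD (ctsM (@ctsC R _ x _) cqx)
  (ctsD (ctsM (cx i0) cp) (ctsM (cx l) (ctsD (ctsM (@ctsC R _ x _) cp)
    (ctsM (cx i0) (ctsB (ctsM (@ctsC R _ x _) (ctsM cYd c2x)) cqx))))))
  (ctsD (ctsM (@ctsC R _ x _) (ctsM (ct i0) cq))
    (ctsM (ct l) (ctsD (ctsM (@ctsC R _ x _) cq) (ctsM (ct i0) cqx)))).
have cE' : {for x, continuous (E' l)} :=
  ctsD (cf1 l) (ctsS (fun k => ctsM (cx k) (cf2 k l))).
have cT' : {for x, continuous (T' l)} :=
  ctsD (ctsS (fun k => ctsM (@ctsC R _ x _) (cf1 k))) (ctsS (fun k => ctsM (ct k) (cf2 k l))).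
have cB' : {for x, continuous (B' l)} :=
  ctsB (ctsB (cf2 l l) (ctsD cE (ctsM (cx l) cE'))) (ctsD (ctsM (@ctsC R _ x _) cT) (ctsM (ct l) cT')).
exact: (ctsB (ctsD (ctsM (cf1 l) cW) (ctsM Cf cW'))
  (ctsD (ctsM (ctsD (ctsM (@ctsC R _ x _) cq) (ctsM (cx i0) cqx)) cB0) (ctsM (ctsM (cx i0) cq) cB'))).
Qed.

Let dV_out x l : b < sqn x -> V' l x = 0.
Proof.
move=> bx; rewrite /V' /W' /W /q' qb// Yb// Y'b//.
by rewrite !(mulr0, mul0r, addr0, subr0).
Qed.

Let V_out x l : b < sqn x -> V l x = 0.
Proof.
by move=> bx; rewrite /V /W qb// Yb// !(mulr0, mul0r, addr0, subr0).
Qed.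

Let near_out x (P : 'rV[R]_N -> Prop) : (forall y, b < sqn y -> P y) ->
  b < sqn x -> \forall y \near x, P y.
Proof.
move=> bP bx; have : \forall y \near x, b < sqn y.
  exact: (cvgr_gt _ (continuous_sqn (x:=x)) _ bx).
by apply: filterS => y; exact: bP.
Qed.

(** Since [V] vanishes for s > b, it extends by 0 across the unit sphere, where the equation for [q]
    has its pole and [f] is no longer controlled. Each component is differentiated along its own
    coordinate only. *)
Lemma null_flux : null (fun x => f x *
  (x 0 i0 * ((n%:R + 1) * Y (sqn x) + sqn x * Y' (sqn x)))).
Proof.
have dVn l : null (V' l).
  apply: (@null_derive R N l (V l) (V' l) 1).
  - move=> x; have [x1|x1] := ltP (sqn x) 1; first exact: d_V.
    have bx := lt_le_trans b1 x1; rewrite (dV_out l bx).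
    apply: (near_eq_is_derive _ (drvC x (delta_mx 0 l) 0)).
    by apply: (near_out (P := fun y => 0 = V l y)) bx => y /V_out ->.
  - move=> x; have [x1|x1] := ltP (sqn x) 1; first exact: c_dV.
    apply: (@cts_near_cst _ _ _ _ 0).
    by apply: near_out (lt_le_trans b1 x1) => y; exact: dV_out.
  - by move=> x j xj; apply: V_out; exact: lt_trans (sqn_gt1 xj).
  - by move=> x j xj; apply: dV_out; exact: lt_trans (sqn_gt1 xj).
apply: (eq_null _ (nullZ 4^-1 (null_sum dVn))) => x.
have [x1|x1] := ltP (sqn x) 1; first by rewrite sum_dV// mulKf.
have bx := lt_le_trans b1 x1.
rewrite big1 => [|l _]; last exact: dV_out.
by rewrite Yb// Y'b// !(mulr0, addr0).
Qed.

End FluxIdentity.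

End Flux.

(** * Antiderivatives of functions supported away from 0 *)

Section Antiderivative.
Variable R : realType.
Implicit Types (g : R -> R) (s : R).

Lemma drvX (V : normedModType R) (x v : V) (f : V -> R) df k :
  is_derive x v f df ->
  is_derive x v (fun y => f y ^+ k.+1) (k.+1%:R * f x ^+ k * df).
Proof.
move=> hf; elim: k => [|k IH].
  by apply: is_deriveE hf _; rewrite expr0 !mul1r.
under eq_fun do rewrite exprS.
apply: is_deriveE (drvM hf IH) _.
by rewrite -[k.+2%:R]natr1 !exprS; ring.
Qed.

Lemma drv_id s : is_derive s (1 : R) (fun t : R => t) 1.
Proof. exact: is_derive_id. Qed.

Lemma is_derive_continuous g s l : is_derive s (1 : R) g l -> {for s, continuous g}.
Proof. by move=> [/derivable1_diffP/differentiable_continuous]. Qed.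

Lemma ctsX (V : topologicalType) (x : V) (f : V -> R) k :
  {for x, continuous f} -> {for x, continuous (fun y => f y ^+ k)}.
Proof.
move=> cf; elim: k => [|k IH]; first exact: ctsC.
rewrite (_ : (fun y => _) = fun y => f y * f y ^+ k); first exact: ctsM.
by apply/funext => y; rewrite exprS.
Qed.

Lemma continuousR g : (forall s : R, {for s, continuous g}) -> continuous g.
Proof. by []. Qed.

Lemma near_lt s a : s < a -> \forall t \near s, t < a.
Proof. exact: lt_nbhsl. Qed.

Lemma near_gt s a : a < s -> \forall t \near s, a < t.
Proof. exact: lt_nbhsr. Qed.

Lemma d_near_0 g s : (\forall t \near s, g t = 0) -> is_derive s (1 : R) g 0.
Proof.
move=> g0; apply: (near_eq_is_derive _ (drvC s 1 0)).
by apply: filterS g0 => t ->.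
Qed.

(** The integral starts at 0 < a, so the fundamental theorem is applied at interior points only;
    below [a] the antiderivative is locally 0. *)
Lemma antiderivative g a b : 0 < a -> continuous g ->
  (forall s, s <= a -> g s = 0) -> (forall s, b <= s -> g s = 0) ->
  exists G : R -> R, [/\ forall s : R, is_derive s (1 : R) G (g s), forall s, s <= a -> G s = 0
              & forall s, b <= s -> G s = G b].
Proof.
move=> a0 cg ga gb.
pose G s := \int[lebesgue_measure]_(t in [set` `[0, s]]) g t.
have Ga s : s <= a -> G s = 0.
  move=> sa; rewrite /G (@eq_Rintegral _ _ _ _ _ (fun=> 0)) => [|t]; last first.
    by rewrite inE/= in_itv/= => /andP[_ /le_trans/(_ sa)]; exact: ga.
  by rewrite Rintegral_cst// mul0r.
have dG s : is_derive s (1 : R) G (g s).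
  have [sa|sa] := ltP s a.
    rewrite ga ?ltW//; apply: d_near_0.
    by apply: filterS (near_lt sa) => t /ltW; exact: Ga.
  have s0 := lt_le_trans a0 sa.
  have s1 : s < s + 1 by rewrite ltrDl.
  have ig : lebesgue_measure.-integrable `[0, s + 1] (EFin \o g).
    apply: continuous_compact_integrable; first exact: segment_compact.
    exact: continuous_subspaceT.
  have [DG] := continuous_FTC1_closed s1 ig s0 (cg s).
  by rewrite derive1E => <-; exact: derivableP.
exists G; split=> // s bs.
have cG : {within `[b, s], continuous G}.
  by apply: derivable_within_continuous => t _; case: (dG t).
have [c + E] := MVT_segment bs (fun t _ => dG t) cG.
rewrite in_itv/= => /andP[bc _].
by move: E; rewrite gb// mul0r => /eqP; rewrite subr_eq0 => /eqP.
Qed.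

End Antiderivative.

Arguments ctsX {R V x f} k _.

(** * Independence of the scale for first radial moments of f *)

Section RadialNull.
Variables (R : realType) (N n' : nat) (J : 'M[R]_N).
Hypotheses (JT : J^T = - J) (JJ : J *m J = - 1%:M).
Let n := n'.+1.
Hypothesis Nn : N%:R = 2 * n%:R :> R.
Variables (f : 'rV[R]_N -> R) (f1 : 'I_N -> 'rV[R]_N -> R)
  (f2 : 'I_N -> 'I_N -> 'rV[R]_N -> R).
Hypothesis harm : harmonic_data J f f1 f2.
Variables (i0 : 'I_N) (omega : R -> R) (a b r : R).
Hypotheses (a0 : 0 < a) (ab : a <= b) (b1 : b < 1) (r0 : 0 < r) (r1 : r <= 1).
Hypotheses (comega : continuous omega).
Hypotheses (omegaa : forall s, s <= a -> omega s = 0)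
  (omegab : forall s, b <= s -> omega s = 0).

(** Put s^(n+1) Y = G(s/r) - G(s) with G' = s^n omega. Then the factor (n+1) Y + s Y' of [null_flux]
    is s^(-n) (s^(n+1) Y)' = r^(-n-1) omega(s/r) - omega(s). Two scales are compared because G alone
    is a nonzero constant beyond [b], whereas the difference vanishes there. *)
Lemma null_harmonic_radial : null (fun x => f x * (x 0 i0 *
  (r^-1 ^+ n.+1 * omega (sqn x / r) - omega (sqn x)))).
Proof.
have cw (s : R) : {for s, continuous omega} by exact: comega.
have cidR (s : R) : {for s, continuous (fun t : R => t)} by exact: cvg_id.
have cg (s : R) : {for s, continuous (fun t : R => omega t * t ^+ n)} :=
  ctsM (cw s) (ctsX n (cidR s)).
have [G [dG Ga Gb]] : exists G : R -> R, [/\ forall s : R, is_derive s (1 : R) G (omega s * s ^+ n),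
    forall s, s <= a -> G s = 0 & forall s, b <= s -> G s = G b].
  apply: antiderivative => // s sa.
  - by rewrite omegaa// mul0r.
  - by rewrite omegab// mul0r.
have rV := invr_gt0 r.
pose D s := G (s / r) - G s.
pose D' s := omega (s / r) * (s / r) ^+ n / r - omega s * s ^+ n.
have dD' (s : R) : is_derive s (1 : R) D (D' s).
  have dsr : is_derive s (1 : R) (fun t => t / r) r^-1.
    by apply: is_deriveE (drvM (drv_id s) (drvC s 1 r^-1)) _; rewrite mulr0 addr0 mul1r.
  exact: (drvB (drv_comp (f := fun t : R => t / r) (dG (s / r)) dsr) (dG s)).
have ra_a : r * a <= a by rewrite ler_piMl// ltW.
have sra s : s <= r * a -> s / r <= a by rewrite ler_pdivrMr// [a * r]mulrC.
have bsr s : b <= s -> b <= s / r.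
  move=> bs; rewrite ler_pdivlMr// (le_trans _ bs)// ler_piMr//.
  exact/ltW/(lt_le_trans a0).
have Da s : s <= r * a -> D s = 0.
  by move=> sa; rewrite /D !Ga ?subrr ?sra// (le_trans sa).
have D'a s : s <= r * a -> D' s = 0.
  by move=> sa; rewrite /D' !omegaa ?sra ?(le_trans sa)// !mul0r subrr.
have Db s : b <= s -> D s = 0.
  by move=> bs; rewrite /D Gb ?bsr// [G s]Gb// subrr.
have D'b s : b <= s -> D' s = 0.
  by move=> bs; rewrite /D' !omegab ?bsr// !mul0r subrr.
have ra0 : 0 < r * a by rewrite mulr_gt0.
pose Y s := s^-1 ^+ n.+1 * D s.
pose Y' s := - n.+1%:R * s^-1 ^+ n.+2 * D s + s^-1 ^+ n.+1 * D' s.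
have Ya s : s <= r * a -> Y s = 0 by move=> sa; rewrite /Y Da ?mulr0.
have Yb s : b <= s -> Y s = 0 by move=> bs; rewrite /Y Db ?mulr0.
have Y'a s : s <= r * a -> Y' s = 0.
  by move=> sa; rewrite /Y' Da ?D'a// !mulr0 addr0.
have Y'b s : b <= s -> Y' s = 0.
  by move=> bs; rewrite /Y' Db ?D'b// !mulr0 addr0.
have dY (s : R) : is_derive s (1 : R) Y (Y' s).
  have [sa|sa] := ltP s (r * a).
    rewrite Y'a ?ltW//; apply: d_near_0.
    by apply: filterS (near_lt sa) => t /ltW; exact: Ya.
  have s0 : s != 0 by rewrite gt_eqF// (lt_le_trans ra0).
  apply: is_deriveE (drvM (drvX n (drvV (drv_id s) s0)) (dD' s)) _.
  by rewrite /Y'; congr (_ * _ + _); rewrite !exprS; field.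
have cDs (s : R) : {for s, continuous D} := is_derive_continuous (dD' s).
have cY (s : R) : {for s, continuous Y} := is_derive_continuous (dY s).
have cY' : continuous Y'.
  apply: continuousR => s; have [sa|sa] := ltP s (r * a).
    apply: (@cts_near_cst _ _ _ _ 0).
    by apply: filterS (near_lt sa) => t /ltW; exact: Y'a.
  have s0 : s != 0 by rewrite gt_eqF// (lt_le_trans ra0).
  have cI : {for s, continuous (fun t : R => t^-1)} by exact: ctsV.
  have csr := ctsM (cidR s) (@ctsC R _ s r^-1).
  have comsr : {for s, continuous (fun t : R => omega (t / r))} :=
    cts_comp (f := fun t : R => t / r) (cw _) csr.
  exact: (ctsD (ctsM (ctsM (@ctsC R _ s _) (ctsX n.+2 cI)) (cDs s))
    (ctsM (ctsX n.+1 cI) (ctsB (ctsM (ctsM comsr (ctsX n csr)) (@ctsC R _ s _))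
      (ctsM (cw s) (ctsX n (cidR s)))))).
have c1s (s : R) : {for s, continuous (fun t : R => 1 - t)} by exact: (ctsB (@ctsC R _ s 1)).
have cYQ (s : R) : {for s, continuous (fun t : R => Y t * (1 - t) ^+ n')} :=
  ctsM (cY s) (ctsX n' (c1s s)).
have [Q0 [dQ0 _ Q0b]] : exists Q0 : R -> R, [/\
    forall s : R, is_derive s (1 : R) Q0 (Y s * (1 - s) ^+ n'),
    forall s, s <= r * a -> Q0 s = 0 & forall s, b <= s -> Q0 s = Q0 b].
  apply: antiderivative => // s sa.
  - by rewrite Ya// mul0r.
  - by rewrite Yb// mul0r.
(* The equation (1 - s) q' = n q + Y integrates to q = (1 - s)^(-n) \int (1 - s)^(n-1) Y. The
   constant of integration is chosen so that [q] vanishes for s >= b. *)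
pose Q s := Q0 s - Q0 b.
pose q s := (1 - s)^-1 ^+ n * Q s.
have qb s : b < s -> q s = 0.
  by move=> /ltW bs; rewrite /q /Q Q0b// subrr mulr0.
have dq (s : R) : s < 1 -> is_derive s (1 : R) q ((Y s + n%:R * q s) / (1 - s)).
  move=> s1; have s0 : 1 - s != 0 by rewrite subr_eq0 gt_eqF.
  have d1 := drvX n' (drvV (drvB (drvC _ _ 1) (drv_id s)) s0).
  apply: is_deriveE (drvM d1 (drvB (dQ0 s) (drvC _ _ (Q0 b)))) _.
  rewrite /q /Q -/n /n !exprS; set Z := Q0 s - Q0 b.
  have e1 : (1 - s)^-1 ^+ n' * (1 - s) ^+ n' = 1.
    by rewrite -exprMn mulVf// expr1n.
  set u := (1 - s)^-1 ^+ n' in e1 *; set w := (1 - s) ^+ n' in e1 *.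
  rewrite [in RHS](_ : Y s = Y s * (u * w)); last by rewrite e1 mulr1.
  by rewrite expr0; field.
have := null_flux JT JJ harm i0 Nn b1 qb (fun s bs => Yb s (ltW bs))
  (fun s bs => Y'b s (ltW bs)) dq dY cY'.
apply: eq_null => x; congr (_ * (_ * _)); set s := sqn x.
rewrite natr1; have [->|s0] := eqVneq s 0.
  have Y0 : Y 0 = 0 by exact/Ya/ltW.
  have w0 : omega 0 = 0 by exact/omegaa/ltW.
  by rewrite Y0 !mul0r w0 !mulr0 subrr addr0.
have e1 : s^-1 ^+ n * s ^+ n = 1 by rewrite -exprMn mulVf// expr1n.
rewrite /Y /Y' /D' exprMn !(exprS _ n.+1) !(exprS _ n).
set u := s^-1 ^+ n in e1 *; set w := s ^+ n in e1 *; set rr := r^-1 ^+ n.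
rewrite [in RHS](_ : omega s = omega s * (u * w)); last by rewrite e1 mulr1.
rewrite [in RHS](_ : omega (s / r) = omega (s / r) * (u * w)); last first.
  by rewrite e1 mulr1.
by field; rewrite s0 gt_eqF.
Qed.

End RadialNull.

(** * Scaling of absolute moments *)

Section RadialScaling.
Variables (R : realType) (N d : nat) (i0 : 'I_N).

Let absX (u : R) := `|u| ^+ d.+1.

Lemma drv_mul_absX (u : R) :
  is_derive u (1 : R) (fun v => v * absX v) (d.+2%:R * absX u).
Proof.
have [u0|u0|->] := ltgtP u 0.
- have E : (fun v : R => - (- v) ^+ d.+2) = (fun v : R => v * (- v) ^+ d.+1).
    by apply/funext => v; rewrite [in LHS]exprS mulNr opprK.
  have H : is_derive u (1 : R) (fun v : R => v * (- v) ^+ d.+1) (d.+2%:R * absX u).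
    rewrite -E; apply: is_deriveE (drvN (drvX d.+1 (drvN (drv_id u)))) _.
    by rewrite /absX ltr0_norm// mulrN1 opprK.
  apply: near_eq_is_derive H; apply: filterS (near_lt u0) => v v0.
  by rewrite /absX ltr0_norm.
- have H : is_derive u (1 : R) (fun v : R => v ^+ d.+2) (d.+2%:R * absX u).
    apply: is_deriveE (drvX d.+1 (drv_id u)) _.
    by rewrite /absX gtr0_norm// mulr1.
  apply: near_eq_is_derive H; apply: filterS (near_gt u0) => v v0.
  by rewrite /absX gtr0_norm// exprS.
- have L : h^-1 *: (((fun v => v * absX v) \o shift 0) (h *: 1) - 0 * absX 0)
      @[h --> 0^'] --> (0 : R).
    have cA : absX h @[h --> (0 : R)^'] --> (0 : R).
      have : {for (0 : R), continuous absX} := ctsX d.+1 (@norm_continuous R R 0).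
      rewrite /prop_for /continuous_at {2}/absX normr0 expr0n/= => c0.
      by apply: cvg_trans c0; apply: cvg_app; exact: cvg_within.
    apply: cvg_trans cA; apply: near_eq_cvg; near=> h.
    rewrite /= addr0 mul0r subr0 /GRing.scale/= mulr1 mulKf//.
    by near: h; exact: nbhs_dnbhs_neq.
  have -> : d.+2%:R * absX 0 = 0 by rewrite /absX normr0 expr0n mulr0.
  split; first by apply/cvg_ex; eexists; exact: L.
  exact/cvg_lim.
Unshelve. all: by end_near. Qed.

Let p (x : 'rV[R]_N) := absX (x 0 i0).

(** The factor |u| may have a corner at 0. In a direction l other than [i0] it is constant, and for
    l = i0 the extra factor u removes the corner. So the field x p(x) has every derivative that its
    divergence requires. *)
Lemma drv_coord_absX x l : is_derive x (delta_mx 0 l)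
  (fun y : 'rV[R]_N => y 0 l * p y) ((1 + (l == i0)%:R * d.+1%:R) * p x).
Proof.
have [->|li] := eqVneq l i0.
  have H := drv_comp (f := fun y : 'rV[R]_N => y 0 i0) (drv_mul_absX (x 0 i0))
    (d_coord x i0 i0).
  by apply: is_deriveE H _; rewrite eqxx mulr1 mul1r /p -[d.+2%:R]natr1 addrC.
have H : is_derive x (delta_mx 0 l) p 0.
  apply: line_is_derive; rewrite (_ : (fun s => _) = fun=> p x).
    exact: drvC.
  apply/funext => s; rewrite /p !mxE eqxx eq_sym (negbTE li) mulr0 addr0//.
apply: is_deriveE (drvM (d_coord x l l) H) _.
by rewrite eqxx mul1r mulr0 addr0 mul0r addr0 mul1r.
Qed.

Variables (omega : R -> R) (a b : R).
Hypotheses (a0 : 0 < a) (ab : a <= b).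
Hypotheses (comega : forall s : R, {for s, continuous omega})
  (omegaa : forall s, s <= a -> omega s = 0)
  (omegab : forall s, b <= s -> omega s = 0).
Variables (beta t : R).
Hypotheses (t0 : 0 < t) (Nbeta : N%:R + d.+1%:R = 2 * beta).

(** Divergence theorem for the field x p(x) eta(s). As [p] is homogeneous of degree d + 1, its
    divergence is 2 p (beta eta + s eta') = 2 p s^(1-beta) (s^beta eta)'. With s^beta eta = G(s/t) -
    G(s) and G' = s^(beta-1) omega this is twice the function in the statement. *)
Lemma null_scaling :
  null (fun x => p x * (t `^ (- beta) * omega (sqn x / t) - omega (sqn x))).
Proof.
have cw (s : R) : {for s, continuous omega} by exact: comega.
have cpow (s e : R) : 0 < s -> {for s, continuous (fun u : R => u `^ e)}.
  by move=> s0; apply: is_derive_continuous (is_derive1_powR e s0).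
have [G [dG Ga Gb]] : exists G : R -> R, [/\
    forall s : R, is_derive s (1 : R) G (omega s * s `^ (beta - 1)),
    forall s, s <= a -> G s = 0 & forall s, b <= s -> G s = G b].
  apply: antiderivative => // [|s sa|s sb].
  - apply: continuousR => s; have [sa|sa] := ltP s a.
      apply: (@cts_near_cst _ _ _ _ 0).
      by apply: filterS (near_lt sa) => u /ltW /omegaa ->; rewrite mul0r.
    by have := ctsM (cw s) (cpow s (beta - 1) (lt_le_trans a0 sa)).
  - by rewrite omegaa// mul0r.
  - by rewrite omegab// mul0r.
pose lo := Num.min a (t * a); pose hi := Num.max b (t * b).
have lo0 : 0 < lo by rewrite lt_min a0 mulr_gt0.
have st_lo s : s <= lo -> s <= a /\ s / t <= a.
  by rewrite le_min => /andP[sa sta]; rewrite ler_pdivrMr// [a * t]mulrC.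
have st_hi s : hi <= s -> b <= s /\ b <= s / t.
  by rewrite ge_max => /andP[sb stb]; rewrite ler_pdivlMr// [b * t]mulrC.
pose D s := G (s / t) - G s.
pose D' s := omega (s / t) * (s / t) `^ (beta - 1) / t - omega s * s `^ (beta - 1).
have dD (s : R) : is_derive s (1 : R) D (D' s).
  have dst : is_derive s (1 : R) (fun u : R => u / t) t^-1.
    by apply: is_deriveE (drvM (drv_id s) (drvC s 1 t^-1)) _; rewrite mulr0 addr0 mul1r.
  exact: (drvB (drv_comp (f := fun u : R => u / t) (dG (s / t)) dst) (dG s)).
have Dlo s : s <= lo -> D s = 0 by move=> /st_lo[? ?]; rewrite /D !Ga ?subrr.
have D'lo s : s <= lo -> D' s = 0.
  by move=> /st_lo[? ?]; rewrite /D' !omegaa// !mul0r subrr.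
have Dhi s : hi <= s -> D s = 0.
  by move=> /st_hi[h1 h2]; rewrite /D (Gb _ h1) (Gb _ h2) subrr.
have D'hi s : hi <= s -> D' s = 0.
  by move=> /st_hi[? ?]; rewrite /D' !omegab// !mul0r subrr.
pose eta s := s `^ (- beta) * D s.
pose eta' s := - beta * s `^ (- beta - 1) * D s + s `^ (- beta) * D' s.
have etalo s : s <= lo -> eta s = 0 by move=> /Dlo h; rewrite /eta h mulr0.
have eta'lo s : s <= lo -> eta' s = 0.
  by move=> sl; rewrite /eta' Dlo// D'lo// !mulr0 addr0.
have etahi s : hi <= s -> eta s = 0 by move=> /Dhi h; rewrite /eta h mulr0.
have eta'hi s : hi <= s -> eta' s = 0.
  by move=> sl; rewrite /eta' Dhi// D'hi// !mulr0 addr0.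
have deta (s : R) : is_derive s (1 : R) eta (eta' s).
  have [sl|sl] := ltP s lo.
    rewrite eta'lo ?ltW//; apply: d_near_0.
    by apply: filterS (near_lt sl) => u /ltW; exact: etalo.
  exact: (drvM (is_derive1_powR (- beta) (lt_le_trans lo0 sl)) (dD s)).
have cD (s : R) : {for s, continuous D} := is_derive_continuous (dD s).
have ceta (s : R) : {for s, continuous eta} := is_derive_continuous (deta s).
have ceta' (s : R) : {for s, continuous eta'}.
  have [sl|sl] := ltP s lo.
    apply: (@cts_near_cst _ _ _ _ 0).
    by apply: filterS (near_lt sl) => u /ltW; exact: eta'lo.
  have s0 := lt_le_trans lo0 sl.
  have cst_ : {for s, continuous (fun u : R => u / t)}.
    by apply: ctsM; [exact: cvg_id|exact: ctsC].
  have cost := cts_comp (f := fun u : R => u / t) (cw _) cst_.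
  have cpst := cts_comp (f := fun u : R => u / t) (cpow (s / t) (beta - 1)
    (divr_gt0 s0 t0)) cst_.
  exact: (ctsD (ctsM (ctsM (@ctsC _ _ s _) (cpow s _ s0)) (cD s))
    (ctsM (cpow s _ s0) (ctsB (ctsM (ctsM cost cpst) (@ctsC _ _ s _))
      (ctsM (cw s) (cpow s _ s0))))).
pose V l (x : 'rV[R]_N) := x 0 l * p x * eta (sqn x).
pose V' l (x : 'rV[R]_N) := (1 + (l == i0)%:R * d.+1%:R) * p x * eta (sqn x)
  + x 0 l * p x * (eta' (sqn x) * (2 * x 0 l)).
have far (x : 'rV[R]_N) j : hi + 1 < `|x 0 j| -> hi <= sqn x.
  move=> xj; have hi0 : 0 < hi by rewrite lt_max (lt_le_trans a0).
  have x1 : 1 < `|x 0 j| by apply: lt_trans xj; rewrite ltrDr.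
  apply: (@le_trans _ _ (`|x 0 j| ^+ 2)).
    by rewrite expr2 (le_trans _ (ler_peMr _ (ltW x1)))// ltW// (lt_trans _ xj)// ltrDl.
  rewrite real_normK ?num_real// /sqn (bigD1 j)//= lerDl.
  by apply: sumr_ge0 => i _; exact: sqr_ge0.
have cp (x : 'rV[R]_N) : {for x, continuous p}.
  apply: ctsX; apply: (cts_comp (f := fun y : 'rV[R]_N => y 0 i0)).
    exact: norm_continuous.
  exact: coord_continuous.
have Vnull l : null (V' l).
  apply: (@null_derive R N l (V l) (V' l) (hi + 1)).
  - move=> x; exact: (drvM (drv_coord_absX x l) (drv_comp (deta _) (d_sqn x l))).
  - suff : forall x : 'rV[R]_N, {for x, continuous (V' l)} by [].
    move=> x; have csq : {for x, continuous (@sqn R N)} by exact: continuous_sqn.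
    have ce := cts_comp (ceta (sqn x)) csq.
    have ce' := cts_comp (ceta' (sqn x)) csq.
    have cx : {for x, continuous (fun y : 'rV[R]_N => y 0 l)}.
      exact: coord_continuous.
    exact: (ctsD (ctsM (ctsM (@ctsC _ _ x _) (cp x)) ce)
      (ctsM (ctsM cx (cp x)) (ctsM ce' (ctsM (@ctsC _ _ x 2) cx)))).
  - by move=> x j /far h; rewrite /V etahi// mulr0.
  - by move=> x j /far h; rewrite /V' etahi// eta'hi// mul0r !mulr0 addr0.
apply: (eq_null _ (nullZ 2^-1 (null_sum Vnull))) => x.
set s := sqn x.
have -> : \sum_l V' l x = 2 * p x * (beta * eta s + s * eta' s).
  have -> : \sum_l V' l x = (\sum_(l < N) 1 + d.+1%:R * \sum_l (l == i0)%:R * 1)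
      * (p x * eta s) + 2 * p x * eta' s * \sum_l x 0 l * x 0 l.
    rewrite mulrDl !mulr_suml mulr_sumr !mulr_suml mulr_sumr -!big_split/=.
    by apply: eq_bigr => l _; rewrite /V' -/s; ring.
  rewrite sum_x2 sumr_const card_ord (sum_delta_r i0 (fun=> 1)) mulr1 Nbeta -/s.
  by ring.
rewrite -!mulrA mulKf//; congr (_ * _).
have [sl|sl] := leP s lo.
  have [h1 h2] := st_lo _ sl.
  by rewrite etalo// eta'lo// !omegaa// !mulr0 subrr addr0.
have s0 := lt_trans lo0 sl.
rewrite /eta /eta' /D'.
have e1 : s * s `^ (- beta - 1) = s `^ (- beta).
  by rewrite -{1}(powRr1 (ltW s0)) -powRD ?(gt_eqF s0) ?implybT// addrC subrK.
have e2 : s * (s `^ (- beta) * s `^ (beta - 1)) = 1.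
  rewrite -powRD ?(gt_eqF s0) ?implybT// -{1}(powRr1 (ltW s0)).
  rewrite -powRD ?(gt_eqF s0) ?implybT//.
  by rewrite (_ : 1 + _ = 0) ?powRr0//; ring.
have e3 : (s / t) `^ (beta - 1) / t = s `^ (beta - 1) * t `^ (- beta).
  rewrite powRM ?invr_ge0 ?ltW// -mulrA; congr (_ * _).
  rewrite -!(powR_inv1 (ltW t0)) -powRrM -powRD ?(gt_eqF t0) ?implybT//.
  by congr (_ `^ _); ring.
rewrite -(mulrA (omega (s / t))) e3.
have -> : beta * (s `^ (- beta) * D s) + s * (- beta * s `^ (- beta - 1) * D s +
    s `^ (- beta) * (omega (s / t) * (s `^ (beta - 1) * t `^ (- beta))
      - omega s * s `^ (beta - 1)))
  = beta * (s `^ (- beta) * D s) - beta * (s * s `^ (- beta - 1)) * D s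
    + (s * (s `^ (- beta) * s `^ (beta - 1))) * (t `^ (- beta) * omega (s / t)
      - omega s).
  by ring.
by rewrite e1 e2 mul1r mulrA subrr add0r.
Qed.

End RadialScaling.

(** * Gaussian moments *)

Section RiemannSums.
Variable R : realType.

Lemma cvg_diff0 (T : Type) (F : set_system T) {FF : Filter F} (f g : T -> R) (l : R) :
  f t - g t @[t --> F] --> (0 : R) -> g t @[t --> F] --> l -> f t @[t --> F] --> l.
Proof.
move=> fg gl; rewrite -[l]add0r (_ : f = fun t => (f t - g t) + g t); last first.
  by apply/funext => t; rewrite subrK.
exact: cvgD.
Qed.

(** Folds the sum onto [0, m + 1]. The last term corrects the left Riemann sum: the node 0 occurs
    once, not twice, and the nodes at distance m + 1 are missing from it. *)
Lemma lsum1_even (m : nat) (g : R -> R) :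
  lsum1 m (fun u => g `|u|) =
  2 * (step R m * \sum_(k < m.+1 ^ 3) g (k%:R * step R m))
  + step R m * (2 * g m.+1%:R - g 0).
Proof.
rewrite /lsum1 (eq_bigr (fun k : 'I_(lsize m) =>
    g (`|k%:R - (m.+1 ^ 3)%:R| * step R m))) => [|k _]; last first.
  by rewrite /node normrM (gtr0_norm (@step_gt0 R m)).
rewrite -(big_mkord xpredT (fun k => g (`|k%:R - (m.+1 ^ 3)%:R| * step R m))) /lsize.
move: (@cube_step R m); move: (m.+1 ^ 3)%N (step R m) => c e ce.
rewrite (@big_cat_nat _ _ _ c) //=; last by rewrite -addnn -addnS leq_addr.
have -> : \sum_(0 <= k < c) g (`|k%:R - c%:R| * e) = \sum_(k < c) g (k.+1%:R * e).
  rewrite big_nat_rev/= big_mkord; apply: eq_bigr => k _; congr (g (_ * _)).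
  rewrite add0n distrC natrB ?ltn_ord// opprB addrC subrK ger0_norm//.
have -> : \sum_(c <= k < c.*2.+1) g (`|k%:R - c%:R| * e) = \sum_(k < c.+1) g (k%:R * e).
  rewrite -{1}[c]add0n big_addn -addnn -addnS addKn big_mkord.
  by apply: eq_bigr => k _; rewrite natrD addrK ger0_norm.
rewrite big_ord_recr/=.
have -> : \sum_(k < c) g (k.+1%:R * e) =
    \sum_(k < c) g (k%:R * e) - g 0 + g (c%:R * e).
  have E : \sum_(k < c.+1) g (k%:R * e) = g 0 + \sum_(k < c) g (k.+1%:R * e).
    by rewrite big_ord_recl/= mul0r.
  by move: E; rewrite big_ord_recr/= => E; lra.
by rewrite ce; ring.
Qed.

(** The mean value theorem is applied to [G] and then to [g]. The margin r < x - e is needed because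
    the intermediate points are only known to lie within e of x, on either side. *)
Lemma riemann_cell (G g g' : R -> R) (K r x e : R) : 0 <= e -> r < x - e ->
  (forall u, r < u -> is_derive u (1 : R) G (g u)) ->
  (forall u, r < u -> is_derive u (1 : R) g (g' u)) ->
  (forall u, `|g' u| <= K) ->
  `|e * g x - (G (x + e) - G x)| <= K * e ^+ 2.
Proof.
move=> e0 rx dG dg gK.
have near_x t : `|t| <= `|e| -> r < x + t.
  rewrite (ger0_norm e0) ler_norml => /andP[et _].
  by rewrite (lt_le_trans rx)// lerD2l.
have [c ce] := @line_MVT R R G g x 1 e
  (fun t te => dG _ (eq_ind_r (fun z => r < x + z) (near_x t te) (mulr1 t))).
have [c' c'c] := @line_MVT R R g g' x 1 c
  (fun t tc => dg _ (eq_ind_r (fun z => r < x + z) (near_x t (le_trans tc ce)) (mulr1 t))).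
rewrite ![_ *: (1 : R)]mulr1 => E1 E2.
rewrite E2 -mulrBr normrM -[g x - _]opprB normrN E1 normrM mulrCA expr2.
rewrite (ger0_norm e0) in ce *.
by rewrite mulrCA [leRHS]mulrC -mulrA ler_wpM2l// ler_pM.
Qed.

(** The (m + 1)^3 cells have total error at most (m + 1)^3 K step^2 = K / (m + 1); the mesh (m +
    1)^-2 is chosen so that it beats the growth of the box. As r < 0, the first cell keeps its
    margin to the left of 0. *)
Lemma lsum1_cvg (G g g' : R -> R) (K r L : R) : r < 0 ->
  (forall u, r < u -> is_derive u (1 : R) G (g u)) ->
  (forall u, r < u -> is_derive u (1 : R) g (g' u)) ->
  (forall u, `|g' u| <= K) -> (forall u, `|g u| <= K) ->
  G m.+1%:R - G 0 @[m --> \oo] --> L ->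
  lsum1 m (fun u => g `|u|) @[m --> \oo] --> 2 * L.
Proof.
move=> r0 dG dg g'K gK GL.
have K0 : 0 <= K := le_trans (normr_ge0 _) (gK 0).
have s0 : step R m @[m --> \oo] --> (0 : R) := @step_cvg0 R.
have H1 : step R m * (2 * g m.+1%:R - g 0) @[m --> \oo] --> (0 : R).
  apply/cvgr0Pnorm_le => e e0; near=> m.
  have h : `|step R m * (2 * g m.+1%:R - g 0)| <= step R m * (3 * K + 1).
    rewrite normrM (gtr0_norm (@step_gt0 R m)) ler_wpM2l ?(ltW (@step_gt0 R m))//.
    rewrite (le_trans (ler_normB _ _))// normrM ger0_norm//.
    have := gK m.+1%:R; have := gK 0; lra.
  apply: (le_trans h); rewrite -ler_pdivlMr; last lra.
  near: m; apply: (cvgr_le 0 s0); rewrite divr_gt0//; lra.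
have H2 : step R m * (\sum_(k < m.+1 ^ 3) g (k%:R * step R m)) @[m --> \oo] --> L.
  have E (m : nat) : G m.+1%:R - G 0 =
      \sum_(k < m.+1 ^ 3) (G (k%:R * step R m + step R m) - G (k%:R * step R m)).
    have := telescope_sumr (fun k => G (k%:R * step R m)) (leq0n (m.+1 ^ 3)).
    rewrite big_mkord mul0r cube_step => <-; apply: eq_bigr => k _.
    by rewrite -natr1 mulrDl mul1r.
  have D0 : step R m * (\sum_(k < m.+1 ^ 3) g (k%:R * step R m))
      - (G m.+1%:R - G 0) @[m --> \oo] --> (0 : R).
    apply/cvgr0Pnorm_le => e e0; near=> m.
      have e1 := @step_gt0 R m.
    have er : step R m < - r.
      by near: m; apply: (cvgr_lt 0 s0); rewrite oppr_gt0.
    rewrite E mulr_sumr -sumrB (le_trans (ler_norm_sum _ _ _))//.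
    apply: (@le_trans _ _ (\sum_(k < m.+1 ^ 3) K * step R m ^+ 2)).
      apply: ler_sum => k _; apply: (riemann_cell (ltW e1) _ dG dg g'K).
      have : 0 <= k%:R * step R m by rewrite mulr_ge0// ltW.
      lra.
    rewrite sumr_const card_ord -mulr_natl mulrCA expr2 [X in K * X]mulrA cube_step.
    have -> : m.+1%:R * step R m = @harmonic R m.
      by rewrite /step /= expnS expn1 natrM invfM mulrA mulfV ?mul1r ?pnatr_eq0.
    rewrite mulrC.
    apply: (@le_trans _ _ (harmonic m * (K + 1))).
      by rewrite ler_wpM2l//; [exact: harmonic_ge0|lra].
    rewrite -ler_pdivlMr; last lra.
    near: m; apply: (cvgr_le 0 (@cvg_harmonic R)); rewrite divr_gt0//; lra.
  exact: cvg_diff0 D0 GL.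
under eq_fun do rewrite lsum1_even.
by rewrite -(addr0 (2 * L)); apply: cvgD => //; apply: cvgMr.
Unshelve. all: by end_near. Qed.

(** Starting the integral at r < 0 makes [G] differentiable at 0 as well. *)
Lemma gauss_antiderivative (r : R) : r < 0 -> exists G : R -> R,
  (forall u, r < u -> is_derive u (1 : R) G (gauss_fun u)) /\
  G x - G 0 @[x --> +oo] --> (Num.sqrt pi / 2 : R).
Proof.
move=> r0; pose mu := @lebesgue_measure R.
pose G x := \int[mu]_(t in [set` `[r, x]]) gauss_fun t.
have gi (a b : R) : mu.-integrable `[a, b] (EFin \o gauss_fun).
  apply: continuous_compact_integrable; first exact: segment_compact.
  exact/continuous_subspaceT/continuous_gauss_fun.
exists G; split=> [u ru|].
  have u1 : u < u + 1 by rewrite ltrDl.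
  have [DG] := continuous_FTC1_closed u1 (gi r (u + 1)) ru (continuous_gauss_fun (x:=u)).
  by rewrite derive1E => <-; exact: derivableP.
have I0 : gauss_integral_proof.integral0_gauss x @[x --> +oo] --> (Num.sqrt pi / 2 : R).
  have H : Num.sqrt ((gauss_integral_proof.integral0_gauss x : R) ^+ 2) @[x --> +oo]
      --> Num.sqrt (pi / 4 : R).
    apply: continuous_cvg; first exact: sqrt_continuous.
    exact: gauss_integral_proof.cvg_integral0_gauss_sqr.
  move: H; rewrite sqrtrM ?pi_ge0// sqrtrV// (_ : 4 = 2 ^+ 2 :> R); last by ring.
  rewrite sqrtr_sqr ger0_norm//; apply: cvg_trans; apply: near_eq_cvg.
  near=> x; rewrite sqrtr_sqr ger0_norm//.
  exact: gauss_integral_proof.integral0_gauss_ge0.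
apply: cvg_trans I0; apply: near_eq_cvg; near=> x.
have x0 : 0 <= x by near: x; exact: nbhs_pinfty_ge.
rewrite /gauss_integral_proof.integral0_gauss /G Rintegral_itvB ?bnd_simp//; last exact: ltW.
rewrite Rintegral_itv_obnd_cbnd//.
by apply: integrableS (gi 0 x) => //; exact: subset_itv_oc_cc.
Unshelve. all: by end_near. Qed.

(** From |u|^j <= 1 + u^4 <= 5 (1 + u^2 / 2)^2 <= 5 e^(u^2). *)
Lemma pow_gauss_le j (u : R) : (j <= 4)%N -> `|u| ^+ j * gauss_fun u <= 5.
Proof.
move=> j4; rewrite /gauss_fun expRN ler_pdivrMr ?expR_gt0//.
have h1 : `|u| ^+ j <= 1 + u ^+ 4.
  have u4 : u ^+ 4 = `|u| ^+ 4 by rewrite -normrX ger0_norm// exprn_even_ge0.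
  rewrite u4; have [u1|u1] := leP `|u| 1.
    by rewrite (le_trans (exprn_ile1 _ (normr_ge0 u) u1))// lerDl exprn_ge0.
  by rewrite (le_trans (ler_weXn2l (ltW u1) j4))// lerDr.
have h2 : 1 + u ^+ 2 / 2 <= expR (u ^+ 2 / 2) := expR_ge1Dx _.
have h3 : expR (u ^+ 2) = expR (u ^+ 2 / 2) ^+ 2.
  by rewrite -expRM_natr; congr expR; field.
have h4 : (1 + u ^+ 2 / 2) ^+ 2 <= expR (u ^+ 2 / 2) ^+ 2.
  by rewrite lerXn2r// nnegrE ?expR_ge0// addr_ge0// divr_ge0// sqr_ge0.
have h5 : u ^+ 4 = (u ^+ 2) ^+ 2 by rewrite -exprM.
rewrite h3; rewrite h5 in h1; move: h1 h4; have := sqr_ge0 u.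
set w := u ^+ 2; set e := expR _ ^+ 2 => w0 h1 h4.
apply: (le_trans h1); apply: (@le_trans _ _ (5 * (1 + w / 2) ^+ 2)); last by rewrite ler_pM2l.
nra.
Qed.

Definition gaussk (k u : R) : R := gauss_fun (k * u).

Lemma drv_gaussk (k u : R) :
  is_derive u (1 : R) (gaussk k) (- (2 * k ^+ 2 * u * gaussk k u)).
Proof.
have h1 : is_derive u (1 : R) (fun v : R => k * v) k.
  by apply: is_deriveE (drvM (drvC u 1 k) (drv_id u)) _; rewrite mul0r add0r mulr1.
have h2 := drvN (drvX 1 h1).
have h3 := drv_comp (f := fun v : R => - (k * v) ^+ 2) (is_derive_expR _) h2.
by apply: is_deriveE h3 _; rewrite /gaussk /gauss_fun expr1; ring.
Qed.

Lemma gaussk_norm (k u : R) : gaussk k `|u| = gaussk k u.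
Proof.
rewrite /gaussk /gauss_fun; congr (expR (- _)).
by rewrite !exprMn -normrX ger0_norm ?sqr_ge0.
Qed.

Lemma gaussk_le j (k u : R) : 0 < k -> (j <= 4)%N ->
  `|u| ^+ j * gaussk k u <= 5 / k ^+ j.
Proof.
move=> k0 j4; rewrite ler_pdivlMr ?exprn_gt0// mulrAC -exprMn.
by have := pow_gauss_le (k * u) j4; rewrite normrM (gtr0_norm k0) [`|u| * k]mulrC.
Qed.

Lemma gaussk_ge0 (k u : R) : 0 <= gaussk k u.
Proof. exact: gauss_fun_ge0. Qed.

Lemma cvg_pow_gaussk (j : nat) (k : R) : 0 < k -> (j <= 3)%N ->
  m.+1%:R ^+ j * gaussk k m.+1%:R @[m --> \oo] --> (0 : R).
Proof.
move=> k0 j3; apply: (@squeeze_cvgr _ _ _ _ (fun=> 0)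
    (fun m => (5 / k ^+ j.+1) * @harmonic R m)).
- near=> m; rewrite mulr_ge0 ?gaussk_ge0//= ler_pdivlMr//.
  have := @gaussk_le j.+1 k m.+1%:R k0 j3.
  by rewrite ger0_norm// exprSr mulrAC.
- exact: cvg_cst.
- by rewrite -(mulr0 (5 / k ^+ j.+1)); apply: cvgMr; exact: cvg_harmonic.
Unshelve. all: by end_near. Qed.

Lemma lsum1_gaussk (k : R) : 0 < k ->
  lsum1 m (gaussk k) @[m --> \oo] --> Num.sqrt pi / k.
Proof.
move=> k0; have [|G [dG GL]] := @gauss_antiderivative (- (k + 1)); first lra.
have dk u : is_derive u (1 : R) (fun v : R => k * v) k.
  by apply: is_deriveE (drvM (drvC u 1 k) (drv_id u)) _; rewrite mul0r add0r mulr1.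
(* The constant 10 k + 5 dominates both the derivative, bounded by 2 k^2 (5 / k), and the function
   itself, bounded by 5. *)
have := @lsum1_cvg (fun u => G (k * u) / k) (gaussk k)
  (fun u => - (2 * k ^+ 2 * u * gaussk k u)) (10 * k + 5) (- 1) (Num.sqrt pi / 2 / k).
have -> : 2 * (Num.sqrt pi / 2 / k) = Num.sqrt pi / k by field; rewrite gt_eqF.
have -> : (fun m => lsum1 m (fun u => gaussk k `|u|)) = (fun m => lsum1 m (gaussk k)).
  apply/funext => m; congr (_ * _); apply: eq_bigr => i _.
  exact: gaussk_norm.
apply; first lra.
- move=> u u1; have ku : - (k + 1) < k * u by nra.
  apply: is_deriveE (drvM (drv_comp (f := fun v : R => k * v) (dG _ ku) (dk u))
    (drvC u 1 k^-1)) _.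
  by rewrite mulr0 addr0 mulfK// gt_eqF.
- by move=> u _; exact: drv_gaussk.
- move=> u; have -> : `|- (2 * k ^+ 2 * u * gaussk k u)|
      = 2 * k ^+ 2 * (`|u| * gaussk k u).
    rewrite normrN !normrM (ger0_norm (gaussk_ge0 _ _)) (gtr0_norm k0).
    by rewrite (ger0_norm (ler0n R 2)); ring.
  have := @gaussk_le 1 k u k0 isT; rewrite !expr1 => h.
  apply: (@le_trans _ _ (2 * k ^+ 2 * (5 / k))).
    by rewrite ler_wpM2l// mulr_ge0// sqr_ge0.
  rewrite (_ : 2 * _ * _ = 10 * k) ?lerDl//.
  by field; rewrite gt_eqF.
- move=> u; rewrite ger0_norm ?gaussk_ge0//.
  by have := @gaussk_le 0 k u k0 isT; rewrite !expr0 mul1r divr1; nra.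
- have h : G (k * m.+1%:R) - G (k * 0) @[m --> \oo] --> (Num.sqrt pi / 2 : R).
    rewrite mulr0; move/cvg_pinftyP : GL; apply.
    apply/cvgryPge => A; near=> m; rewrite mulrC -ler_pdivrMr//.
    apply: (@le_trans _ _ m%:R); last by rewrite ler_nat.
    by near: m; exact: nbhs_infty_ger.
  by under eq_fun do rewrite -mulrBl; exact: cvgM h (cvg_cst k^-1).
Unshelve. all: by end_near. Qed.

Lemma lsum1_norm_gaussk (k : R) : 0 < k ->
  lsum1 m (fun u => `|u| * gaussk k u) @[m --> \oo] --> k ^- 2.
Proof.
move=> k0; have kn : k != 0 by rewrite gt_eqF.
have := @lsum1_cvg (fun u => - (gaussk k u / (2 * k ^+ 2))) (fun u => u * gaussk k u)
  (fun u => gaussk k u - 2 * k ^+ 2 * (u ^+ 2 * gaussk k u)) (15 + 5 / k) (- 1)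
  (2 * k ^+ 2)^-1.
have -> : 2 * (2 * k ^+ 2)^-1 = k ^- 2 by field.
have -> : (fun m => lsum1 m (fun u => `|u| * gaussk k `|u|))
    = (fun m => lsum1 m (fun u => `|u| * gaussk k u)).
  by apply/funext => m; congr (_ * _); apply: eq_bigr => i _; rewrite gaussk_norm.
have k5 : 0 <= 5 / k by rewrite divr_ge0// ltW.
apply; first lra.
- move=> u _; apply: is_deriveE (drvN (drvM (drv_gaussk k u) (drvC u 1 _))) _.
  by field.
- move=> u _; apply: is_deriveE (drvM (drv_id u) (drv_gaussk k u)) _.
  by ring.
- move=> u; rewrite (le_trans (ler_normB _ _))// ger0_norm ?gaussk_ge0//.
  have p0 : 0 <= 2 * k ^+ 2 * (u ^+ 2 * gaussk k u).
    by apply: mulr_ge0; apply: mulr_ge0; rewrite ?sqr_ge0 ?gaussk_ge0.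
  rewrite (ger0_norm p0).
  have h0 := @gaussk_le 0 k u k0 isT; rewrite !expr0 mul1r divr1 in h0.
  have h2 := @gaussk_le 2 k u k0 isT; rewrite -normrX ger0_norm ?sqr_ge0// in h2.
  have : 2 * k ^+ 2 * (u ^+ 2 * gaussk k u) <= 10.
    apply: (@le_trans _ _ (2 * k ^+ 2 * (5 / k ^+ 2))).
      by rewrite ler_wpM2l// mulr_ge0// sqr_ge0.
    by rewrite (_ : 2 * _ * _ = 10)//; field.
  lra.
- move=> u; rewrite normrM (ger0_norm (gaussk_ge0 _ _)).
  have := @gaussk_le 1 k u k0 isT; rewrite !expr1; lra.
- have c0 := @cvg_pow_gaussk 0 k k0 isT.
  have h : (2 * k ^+ 2)^-1 - m.+1%:R ^+ 0 * gaussk k m.+1%:R / (2 * k ^+ 2)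
      @[m --> \oo] --> (2 * k ^+ 2)^-1 - 0 / (2 * k ^+ 2).
    apply: cvgB; first exact: cvg_cst.
    by apply: cvgM c0 _; exact: cvg_cst.
  rewrite mul0r subr0 in h; apply: cvg_trans h; apply: near_eq_cvg.
  near=> m; rewrite expr0 mul1r /gaussk mulr0 /gauss_fun expr0n/= oppr0 expR0 opprK.
  by rewrite mul1r addrC.
Unshelve. all: by end_near. Qed.

(** Integration by parts: (u gaussk)' = gaussk - 2 k^2 u^2 gaussk, so the second moment on the
    half-line is 1 / (2 k^2) times the plain Gaussian integral. *)
Lemma lsum1_sqr_gaussk (k : R) : 0 < k ->
  lsum1 m (fun u => `|u| ^+ 2 * gaussk k u) @[m --> \oo] -->
    Num.sqrt pi / (2 * k ^+ 3).
Proof.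
move=> k0; have kn : k != 0 by rewrite gt_eqF.
have [|G [dG GL]] := @gauss_antiderivative (- (k + 1)); first lra.
have dk u : is_derive u (1 : R) (fun v : R => k * v) k.
  by apply: is_deriveE (drvM (drvC u 1 k) (drv_id u)) _; rewrite mul0r add0r mulr1.
pose c := (2 * k ^+ 2)^-1.
have := @lsum1_cvg (fun u => (G (k * u) / k - u * gaussk k u) * c)
  (fun u => u ^+ 2 * gaussk k u)
  (fun u => 2 * (u * gaussk k u) - 2 * k ^+ 2 * (u ^+ 3 * gaussk k u))
  (20 / k + 5 / k ^+ 2) (- 1) (Num.sqrt pi / 2 / k * c).
have -> : 2 * (Num.sqrt pi / 2 / k * c) = Num.sqrt pi / (2 * k ^+ 3).
  by rewrite /c; field.
have -> : (fun m => lsum1 m (fun u => `|u| ^+ 2 * gaussk k `|u|))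
    = (fun m => lsum1 m (fun u => `|u| ^+ 2 * gaussk k u)).
  by apply/funext => m; congr (_ * _); apply: eq_bigr => i _; rewrite gaussk_norm.
have k5 : 0 <= 5 / k by rewrite divr_ge0// ltW.
have k52 : 0 <= 5 / k ^+ 2 by rewrite divr_ge0// sqr_ge0.
apply; first lra.
- move=> u u1; have ku : - (k + 1) < k * u by nra.
  apply: is_deriveE (drvM (drvB (drvM (drv_comp (f := fun v : R => k * v) (dG _ ku)
    (dk u)) (drvC u 1 k^-1)) (drvM (drv_id u) (drv_gaussk k u))) (drvC u 1 c)) _.
  by rewrite /c -/(gaussk k u); field.
- move=> u _; apply: is_deriveE (drvM (drvX 1 (drv_id u)) (drv_gaussk k u)) _.
  by rewrite expr1; ring.
- move=> u; rewrite (le_trans (ler_normB _ _))//.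
  have -> : `|2 * (u * gaussk k u)| = 2 * (`|u| * gaussk k u).
    by rewrite !normrM (ger0_norm (gaussk_ge0 _ _)) (ger0_norm (ler0n R 2)).
  have -> : `|2 * k ^+ 2 * (u ^+ 3 * gaussk k u)|
      = 2 * k ^+ 2 * (`|u| ^+ 3 * gaussk k u).
    rewrite normrM (normrM (u ^+ 3)) (ger0_norm (gaussk_ge0 _ _)) normrX ger0_norm//.
    by rewrite mulr_ge0// sqr_ge0.
  have h1 := @gaussk_le 1 k u k0 isT; rewrite !expr1 in h1.
  have h3 := @gaussk_le 3 k u k0 isT.
  have : 2 * k ^+ 2 * (`|u| ^+ 3 * gaussk k u) <= 10 / k.
    apply: (@le_trans _ _ (2 * k ^+ 2 * (5 / k ^+ 3))).
      by rewrite ler_wpM2l// mulr_ge0// sqr_ge0.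
    by rewrite (_ : 2 * _ * _ = 10 / k)//; field.
  lra.
- move=> u; rewrite normrM (ger0_norm (gaussk_ge0 _ _)) normrX.
  have := @gaussk_le 2 k u k0 isT; lra.
- have c0 := @cvg_pow_gaussk 1 k k0 isT.
  have h1 : G (k * m.+1%:R) - G 0 @[m --> \oo] --> (Num.sqrt pi / 2 : R).
    move/cvg_pinftyP : GL; apply.
    apply/cvgryPge => A; near=> m; rewrite mulrC -ler_pdivrMr//.
    apply: (@le_trans _ _ m%:R); last by rewrite ler_nat.
    by near: m; exact: nbhs_infty_ger.
  have h : ((G (k * m.+1%:R) - G 0) / k - m.+1%:R ^+ 1 * gaussk k m.+1%:R) * c
      @[m --> \oo] --> (Num.sqrt pi / 2 / k - 0) * c.
    apply: cvgM; last exact: cvg_cst.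
    by apply: cvgB => //; apply: cvgM h1 _; exact: cvg_cst.
  rewrite subr0 in h; apply: cvg_trans h; apply: near_eq_cvg.
  by near=> m; rewrite expr1 mulr0 mul0r; ring.
Unshelve. all: by end_near. Qed.

End RiemannSums.

(** * Comparison with the Gamma function *)

Section HalfLine.
Variable R : realType.
Local Notation mu := (@lebesgue_measure R).
Local Notation D := (`]0, +oo[%classic : set R).

Lemma gt0_halfline (t : R) : D t -> 0 < t.
Proof. by rewrite /= in_itv/= andbT. Qed.

(** The majorant is a multiple of the exponential density of rate 1/2; the other half of the decay
    of e^(-t) is left to absorb powers of t. *)
Lemma integrable_halfline (f : R -> R) (C : R) :
  (forall t : R, 0 < t -> {for t, continuous f}) ->
  (forall t, 0 < t -> `|f t| <= C * expR (- (t / 2))) ->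
  mu.-integrable D (EFin \o f).
Proof.
move=> cf fC.
have mD : measurable D by exact: measurable_itv.
have half : 0 < (2^-1 : R) by rewrite invr_gt0.
have ie : mu.-integrable D (fun t => ((2 * C)%:E * (exponential_pdf (2^-1 : R) t)%:E)%E).
  apply: integrableZl => //.
  apply: (@integrableS _ _ _ _ setT) => //.
  exact: integrable_exponential_pdf.
apply: le_integrable ie => //.
  apply/measurable_EFinP; apply: subspace_continuous_measurable_fun => //.
  apply: continuous_in_subspaceT => t; rewrite inE => /gt0_halfline; exact: cf.
move=> t /gt0_halfline t0; rewrite /= lee_fin exponential_pdfE ?(ltW t0)//.
apply: le_trans (fC t t0) _; apply: le_trans (ler_norm _).
by rewrite mulNr [2^-1 * t]mulrC mulrA (mulrAC 2) divff// mul1r.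
Qed.

(** Raise y <= e^y to the power k + 1, for y = (1 + t) / (2 (k + 1)). *)
Lemma powR_expR_le (c t : R) (k : nat) : 0 <= c -> c <= k.+1%:R -> 0 < t ->
  t `^ c <= (2 * k.+1%:R) ^+ k.+1 * expR 2^-1 * expR (t / 2).
Proof.
move=> c0 ck t0.
have t1 : 1 <= 1 + t by rewrite lerDl ltW.
have k0 : 0 < 2 * k.+1%:R :> R by rewrite mulr_gt0// ltr0n.
apply: (@le_trans _ _ ((1 + t) `^ c)).
  by apply: ge0_ler_powR => //; rewrite ?nnegrE ?lerDr// ltW// (lt_le_trans _ t1).
apply: (@le_trans _ _ ((1 + t) `^ k.+1%:R)); first exact: ler_powR.
rewrite powR_mulrn ?(le_trans _ t1)// -mulrA -expRD.
have -> : 2^-1 + t / 2 = k.+1%:R * ((1 + t) / (2 * k.+1%:R)).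
  by field; rewrite (addrC 1) natr1 pnatr_eq0.
rewrite expRM_natl -exprMn; apply: lerXn2r; rewrite ?nnegrE ?(le_trans _ t1)//.
rewrite -ler_pdivrMl// mulrC (le_trans _ (expR_ge1Dx _))//.
by rewrite lerDr.
Qed.

Lemma integrable_Gamma (c : R) : 0 <= c ->
  mu.-integrable D (EFin \o (fun t => t `^ c * expR (- t))).
Proof.
move=> c0; have [k ck] : exists k : nat, c <= k.+1%:R.
  by exists (Num.truncn c); rewrite ltW// Num.Theory.truncnS_gt.
apply: (@integrable_halfline _ ((2 * k.+1%:R) ^+ k.+1 * expR 2^-1)) => t t0.
  apply: ctsM; first exact: is_derive_continuous (is_derive1_powR c t0).
  have h : is_derive t (1 : R) (fun s : R => expR (- s)) (expR (- t) * - 1).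
    exact: drv_comp (is_derive_expR (- t)) (drvN (drv_id t)).
  exact: is_derive_continuous h.
rewrite ger0_norm ?mulr_ge0 ?powR_ge0 ?expR_ge0//.
have -> : - (t / 2) = t / 2 + - t by field.
rewrite expRD mulrA ler_wpM2r ?expR_ge0//.
exact: powR_expR_le.
Qed.

(** For a >= 1 the integrand is at least e^(-2) on [1, 2]. *)
Lemma Gamma_gt0 (a : R) : 1 <= a -> 0 < Gamma a.
Proof.
move=> a1; have a0 : 0 <= a - 1 by lra.
have mD : measurable D by exact: measurable_itv.
have i := integrable_Gamma a0.
pose f (t : R) := t `^ (a - 1) * expR (- t).
have ff t : 0 <= f t by rewrite mulr_ge0 ?powR_ge0 ?expR_ge0.
have m1 : measurable (`[1, 2]%classic : set R) by exact: measurable_itv.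
have s1 : `[1, 2]%classic `<=` D.
  by move=> t /=; rewrite !in_itv/= andbT => /andP[t1 _]; rewrite (lt_le_trans _ t1).
have i1 : mu.-integrable `[1, 2] (EFin \o f) by apply: integrableS i.
have h : \int[mu]_(t in `[1, 2]) f t <= Gamma a.
  rewrite /Gamma /Rintegral fine_le ?integrable_fin_num//.
  apply: ge0_subset_integral => //.
    by case/integrableP: i.
  by move=> t _; rewrite lee_fin.
apply: lt_le_trans h.
apply: (@lt_le_trans _ _ (\int[mu]_(t in `[1, 2]) (expR (- 2) : R))).
  have mu12 : fine (mu `[1, 2]%classic) = 1.
    by rewrite lebesgue_measure_itv/= lte_fin ltr1n -EFinD/=; lra.
  rewrite Rintegral_cst// mulr_gt0 ?expR_gt0//.
  by apply: lt_le_trans ltr01 _; rewrite -{1}mu12.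
apply: le_Rintegral => //.
  by apply: continuous_compact_integrable;
    [exact: segment_compact | move=> t; exact: cvg_cst].
move=> t; rewrite /= in_itv/= => /andP[].
move: t => t' t1' t2'; set t : R := t'; have t1 : 1 <= t by []; have t2 : t <= 2 by [].
rewrite -[leLHS]mul1r; apply: ler_pM => //; rewrite ?expR_ge0//.
  by rewrite -[leLHS](powRr0 t); exact: ler_powR.
by rewrite ler_expR; lra.
Qed.

End HalfLine.


(** * Averages of a bump over dilations *)

Section BumpAverage.
Variable R : realType.
Local Notation mu := (@lebesgue_measure R).
Local Notation D := (`]0, +oo[%classic : set R).
Variables (omega : R -> R) (a b : R).
Hypothesis comega : forall s : R, {for s, continuous omega}.
Hypothesis omega01 : forall s, 0 <= omega s <= 1.
Hypothesis a0 : 0 < a.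
Hypothesis ab : a < b.
Hypothesis b1 : b < 1.
Hypothesis omegaa : forall s, s <= a -> omega s = 0.
Hypothesis omegab : forall s, b <= s -> omega s = 0.
Hypothesis omega_gt0 : forall s, a < s -> s < b -> 0 < omega s.

Let b0 : 0 < b. Proof. exact: lt_trans ab. Qed.

Let drv_div (s t : R) : 0 < t -> is_derive t (1 : R) (fun u : R => s / u) (- s / t ^+ 2).
Proof.
move=> t0; apply: is_deriveE (drvM (drvC t 1 s) (drvV (drv_id t) _)) _.
  by rewrite gt_eqF.
by rewrite mul0r add0r mulN1r mulrN mulNr.
Qed.

Let cts_ratio (s t : R) : 0 < t -> {for t, continuous (fun u : R => omega (s / u) / u)}.
Proof.
move=> t0.
have c1 : {for t, continuous (fun u : R => s / u)}.
  exact: is_derive_continuous (drv_div s t0).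
have c2 : {for t, continuous (fun u : R => omega (s / u))} :=
  cts_comp (f := fun u : R => s / u) (@comega (s / t)) c1.
have c3 : {for t, continuous (fun u : R => u^-1)}.
  by apply: is_derive_continuous (drvV (drv_id t) _); rewrite gt_eqF.
exact: ctsM c2 c3.
Qed.

Lemma cts_expRN (t : R) : {for t, continuous (fun u : R => expR (- u))}.
Proof.
exact: is_derive_continuous (drv_comp (is_derive_expR (- t)) (drvN (drv_id t))).
Qed.

(** Where [omega (s / t)] does not vanish, s / t < b, that is 1 / t < b / s. For s = 0 both sides
    are 0, by the convention on division. *)
Let ratio_le (s t : R) : 0 <= s -> 0 < t -> 0 <= omega (s / t) / t <= b / s.
Proof.
move=> s0 t0; have /andP[w0 w1] := omega01 (s / t).
rewrite divr_ge0 ?(ltW t0)//=.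
have bs : 0 <= b / s by rewrite divr_ge0// ltW.
have [sa|sa] := leP (s / t) a; first by rewrite omegaa// mul0r.
have [sb|sb] := leP b (s / t); first by rewrite omegab// mul0r.
have sp : 0 < s.
  by have := lt_trans a0 sa; rewrite pmulr_lgt0// invr_gt0.
rewrite ler_pdivrMr// (le_trans w1)// mulrAC ler_pdivlMr// mul1r.
by move: sb; rewrite ltr_pdivrMr// => /ltW.
Qed.

Definition kern (s t : R) := omega (s / t) / t * expR (- t).

Lemma cts_kern (s t : R) : 0 < t -> {for t, continuous (kern s)}.
Proof.
move=> t0; have h := ctsM (@cts_ratio s t t0) (@cts_expRN t); exact: h.
Qed.

Lemma kern_ge0 (s t : R) : 0 <= s -> 0 < t -> 0 <= kern s t.
Proof.
by move=> s0 t0; rewrite mulr_ge0 ?expR_ge0//; case/andP: (ratio_le s0 t0).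
Qed.

Lemma integrable_kern (s : R) : 0 <= s -> mu.-integrable D (EFin \o kern s).
Proof.
move=> s0; apply: (@integrable_halfline _ _ (b / s)) => t t0; first exact: cts_kern.
have /andP[w0 w1] := ratio_le s0 t0.
rewrite ger0_norm ?kern_ge0// ler_pM ?expR_ge0// ler_expR; lra.
Qed.

(* This lies between two Gaussians because kern s vanishes unless
   s / b <= t <= s / a, while \int omega (s / t) / t dt does not depend on s. *)
Definition bump_exp (s : R) := \int[mu]_(t in D) kern s t.

Lemma bump_exp_bounds : exists2 M : R, 0 < M &
  forall s : R, 0 < s -> M * expR (- (s / a)) <= bump_exp s <= M * expR (- s).
Proof.
have [G [dG Ga Gb]] : exists G : R -> R, [/\
    forall s : R, is_derive s (1 : R) G (omega s / s),
    forall s, s <= a -> G s = 0 & forall s, b <= s -> G s = G b].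
  apply: antiderivative => // [|s sa|s sb].
  - apply: continuousR => s; have [sa|sa] := ltP s a.
      apply: (@cts_near_cst _ _ _ _ 0).
      by apply: filterS (near_lt sa) => u /ltW /omegaa ->; rewrite mul0r.
    have s0 := lt_le_trans a0 sa.
    apply: ctsM; first exact: comega.
    by apply: is_derive_continuous (drvV (drv_id s) _); rewrite gt_eqF.
  - by rewrite omegaa// mul0r.
  - by rewrite omegab// mul0r.
(* [M] is the integral of omega(u) / u, which is invariant under dilations. It is positive by the
   mean value theorem, [omega] being positive inside ]a, b[. *)
exists (G b).
  have [|c + E] := @MVT _ G (fun s => omega s / s) a b ab (fun t _ => dG t).
    by apply: derivable_within_continuous => t _; case: (dG t).
  rewrite in_itv/= => /andP[ac cb]; move: E; rewrite (Ga a)// subr0 => ->.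
  by rewrite mulr_gt0 ?subr_gt0// divr_gt0 ?omega_gt0// (lt_trans a0).
move=> s s0.
pose f (t : R) := omega (s / t) / t.
have mD : measurable D by exact: measurable_itv.
have sb0 : 0 < s / b by rewrite divr_gt0.
have sbs : s <= s / b by rewrite ler_pdivlMr// ler_piMr// ltW.
have sba : s / b < s / a by rewrite ltr_pM2l// ltf_pV2.
have f0 (t : R) : 0 < t -> t < s / b \/ s / a < t -> f t = 0.
  move=> t0 [h|h]; rewrite /f.
    by rewrite omegab ?mul0r// ler_pdivlMr// mulrC -ler_pdivlMr// ltW.
  by rewrite omegaa ?mul0r// ler_pdivrMr// mulrC -ler_pdivrMr// ltW.
have fge (t : R) : 0 < t -> 0 <= f t by move=> t0; case/andP: (ratio_le (ltW s0) t0).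
have intf : mu.-integrable D (EFin \o f).
  apply: (@integrable_halfline _ _ (b / s * expR (s / a / 2))) => t t0; first exact: cts_ratio.
  have [h|h] := leP t (s / a).
    have /andP[w0 w1] := ratio_le (ltW s0) t0.
    rewrite ger0_norm// (le_trans w1)// -mulrA ler_peMr//.
      by rewrite divr_ge0// ltW.
    rewrite -expRD -expR0 ler_expR -mulrBl divr_ge0// subr_ge0//.
  rewrite f0; [|by []|by right].
  by rewrite normr0 !mulr_ge0 ?expR_ge0 ?invr_ge0// ltW.
have If : \int[mu]_(t in D) f t = G b.
  have -> : \int[mu]_(t in D) f t = \int[mu]_(t in D `&` `[s / b, s / a]) f t.
    rewrite Rintegral_mkcondr; apply: eq_Rintegral => t; rewrite inE => /gt0_halfline t0.
    rewrite patchE; case: ifPn => // /negP; rewrite inE/= in_itv/= => /negP.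
    by rewrite negb_and -!ltNge => /orP h; exact: f0.
  have -> : D `&` `[s / b, s / a] = `[s / b, s / a]%classic.
    apply/seteqP; split=> [t []//|t ts]; split=> //; move: ts.
    by rewrite /= !in_itv/= andbT => /andP[h _]; exact: lt_le_trans h.
  (* The substitution u = s / t, carried out on antiderivatives. *)
  have dF (t : R) : 0 < t -> is_derive t (1 : R) (fun u : R => - G (s / u)) (f t).
    move=> t0; apply: is_deriveE (drvN (drv_comp (f := fun u : R => s / u)
      (dG (s / t)) (drv_div s t0))) _.
    by rewrite /f; field; rewrite !gt_eqF.
  have cF (t : R) : 0 < t -> {for t, continuous (fun u : R => - G (s / u))}.
    by move=> t0; exact: is_derive_continuous (dF t t0).
  rewrite /Rintegral (@continuous_FTC2 _ f (fun u : R => - G (s / u)))//.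
  - have sK (c : R) : s / (s / c) = c by rewrite invf_div mulrC divfK// gt_eqF.
    by rewrite -EFinB/= !sK (Ga a)// oppr0 sub0r opprK.
  - apply: continuous_in_subspaceT => t; rewrite inE/= in_itv/= => /andP[h _].
    by apply: cts_ratio; exact: lt_le_trans h.
  - split.
    + move=> t; rewrite in_itv/= => /andP[h _].
      by have [] := dF t (lt_trans sb0 h).
    + by apply: cvg_at_right_filter; exact: cF.
    + by apply: cvg_at_left_filter; apply: cF; exact: lt_trans sba.
  - move=> t; rewrite in_itv/= => /andP[h _].
    by rewrite derive1E; have [] := dF t (lt_trans sb0 h).
have intZ (c : R) : mu.-integrable D (EFin \o (fun t => c * f t)).
  rewrite (_ : _ \o _ = (fun t => (c%:E * (f t)%:E)%E)); last first.
    by apply/funext => t; rewrite /= EFinM.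
  exact: integrableZl.
rewrite -If !(mulrC (\int[mu]_(t in _) _)) -!RintegralZl//.
have ik := integrable_kern (ltW s0).
apply/andP; split; apply: le_Rintegral => // t /gt0_halfline t0.
  have [h|h] := leP t (s / a).
    by rewrite mulrC ler_wpM2l ?fge// ler_expR lerN2.
  by rewrite f0 ?mulr0 ?kern_ge0 ?(ltW s0)//; right.
have [h|h] := leP (s / b) t.
  by rewrite mulrC ler_wpM2l ?fge// ler_expR lerN2 (le_trans sbs).
by rewrite /kern -/(f t) f0 ?mul0r ?mulr0//; left.
Qed.

End BumpAverage.

(** * The Gamma factors between moments of a bump and of its average *)

Section LatticeGamma.
Variables (R : realType) (N d : nat) (i0 : 'I_N).
Local Notation mu := (@lebesgue_measure R).
Local Notation D := (`]0, +oo[%classic : set R).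

Lemma node_small m (k : 'I_(lsize m)) : `|node R k| < step R m -> node R k = 0.
Proof.
rewrite /node normrM (gtr0_norm (step_gt0 _ _)) -{2}[step R m]mul1r.
rewrite ltr_pM2r ?step_gt0//; set c := (m.+1 ^ 3)%N.
have [ck|kc] := leqP c k.
  rewrite -natrB// ger0_norm ?ler0n// ltrn1.
  by rewrite ltnS leqn0 => /eqP ->; rewrite mul0r.
rewrite distrC -(natrB _ (ltnW kc)) ger0_norm ?ler0n// ltrn1 ltnS leqn0 subn_eq0 => ck.
by move: kc; rewrite ltnNge ck.
Qed.

Let integrable_add (f g : R -> R) :
  mu.-integrable D (EFin \o f) -> mu.-integrable D (EFin \o g) ->
  mu.-integrable D (EFin \o (fun t => f t + g t)).
Proof.
move=> jf jg; have mD : measurable D by exact: measurable_itv.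
rewrite (_ : _ \o _ = (fun t => ((f t)%:E + (g t)%:E)%E)); last first.
  by apply/funext => t; rewrite /= EFinD.
exact: integrableD.
Qed.

Let integrable_scale (c : R) (f : R -> R) :
  mu.-integrable D (EFin \o f) -> mu.-integrable D (EFin \o (fun t => c * f t)).
Proof.
move=> jf; have mD : measurable D by exact: measurable_itv.
rewrite (_ : _ \o _ = (fun t => (c%:E * (f t)%:E)%E)); last first.
  by apply/funext => t; rewrite /= EFinM.
exact: integrableZl.
Qed.

Lemma Rintegral_lsum m (F : 'rV[R]_N -> R -> R) :
  (forall a, mu.-integrable D (EFin \o F (@lpoint R N m a))) ->
  mu.-integrable D (EFin \o (fun t => lsum m (F^~ t))) /\
  \int[mu]_(t in D) lsum m (F^~ t) = lsum m (fun x => \int[mu]_(t in D) F x t).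
Proof.
move=> iF; have mD : measurable D by exact: measurable_itv.
have [iS IS] : mu.-integrable D (EFin \o (fun t => \sum_a F (@lpoint R N m a) t)) /\
    \int[mu]_(t in D) \sum_a F (@lpoint R N m a) t
    = \sum_a \int[mu]_(t in D) F (@lpoint R N m a) t.
  elim: (index_enum _) => [|a s [IH1 IH2]].
    rewrite big_nil (_ : (fun t => _) = (fun=> 0)); last first.
      by apply/funext => t; rewrite big_nil.
    split; first exact: integrable0.
    by rewrite /Rintegral integral0.
  rewrite big_cons (_ : (fun t => _) = (fun t => F (@lpoint R N m a) t
     + \sum_(j <- s) F (@lpoint R N m j) t)); last first.
    by apply/funext => t; rewrite big_cons.
  rewrite RintegralD// IH2; split=> //.
  exact: integrable_add.
rewrite /lsum -IS; split; last by rewrite RintegralZl.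
exact: integrable_scale.
Qed.

Variables (omega : R -> R) (a b : R).
Hypothesis comega : forall s : R, {for s, continuous omega}.
Hypothesis omega01 : forall s, 0 <= omega s <= 1.
Hypothesis a0 : 0 < a.
Hypothesis ab : a < b.
Hypothesis b1 : b < 1.
Hypothesis omegaa : forall s, s <= a -> omega s = 0.
Hypothesis omegab : forall s, b <= s -> omega s = 0.

Let p (x : 'rV[R]_N) := `|x 0 i0| ^+ d.+1.
Let phi m (t : R) := lsum m (fun x : 'rV[R]_N => p x * omega (sqn x / t)).

Let p_ge0 x : 0 <= p x. Proof. exact: exprn_ge0. Qed.

Let phi_ge0 m t : 0 <= phi m t.
Proof. by apply: lsum_ge0 => x; rewrite mulr_ge0//; case/andP: (omega01 (sqn x / t)). Qed.

Let omega_out (t : R) (x : 'rV[R]_N) i : 0 < t -> t < `|x 0 i| ^+ 2 ->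
  omega (sqn x / t) = 0.
Proof.
move=> t0 tx; apply: omegab; rewrite ler_pdivlMr//.
apply: (@le_trans _ _ t); first by rewrite ger_pMl// ltW.
rewrite (le_trans (ltW tx))// real_normK ?num_real// /sqn (bigD1 i)//= lerDl.
by apply: sumr_ge0 => j _; exact: sqr_ge0.
Qed.

Variable beta : R.
Hypothesis Nbeta : N%:R + d.+1%:R = 2 * beta.

Let sqrt_powR (t : R) : 0 <= t -> Num.sqrt t ^+ (N + d.+1) = t `^ beta.
Proof.
move=> t0; rewrite -powR_mulrn ?sqrtr_ge0// -powR12_sqrt// -powRrM natrD Nbeta.
by congr (_ `^ _); field.
Qed.

(** The order t^beta predicted by scaling, with a constant uniform in [m]; this supplies the
    majorant for dominated convergence in t. *)
Let phi_le m (t : R) : 0 < t -> phi m t <= 3 ^+ N * t `^ beta.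
Proof.
move=> t0; set r : R := Num.sqrt t.
have r0 : 0 < r by rewrite sqrtr_gt0.
have rr : r ^+ 2 = t by rewrite sqr_sqrtr// ltW.
have out (x : 'rV[R]_N) i : r < `|x 0 i| -> omega (sqn x / t) = 0.
  by move=> rx; apply: (@omega_out t x i t0); rewrite -rr ltr_pXn2r ?nnegrE ?normr_ge0 ?(ltW r0).
(* If sqrt t is less than one mesh, the only node coordinate within sqrt t of 0 is 0 itself, and
   there [p] vanishes. So the bound holds for arbitrarily small t, although the lattice does not
   resolve the bump. *)
have [sr|rs] := leP (step R m) r; last first.
  rewrite /phi /lsum big1 ?mulr0 ?mulr_ge0 ?exprn_ge0 ?powR_ge0// => k _.
  have [xs|xs] := ltP `|node R (k i0)| (step R m).
    by rewrite /p mxE node_small// normr0 expr0n/= mul0r.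
  by rewrite (out _ i0) ?mulr0// mxE (lt_le_trans rs).
apply: (le_trans (ler_norm _)).
apply: (@le_trans _ _ (r ^+ d.+1 * (2 * r + step R m) ^+ N)).
  apply: lsum_box => [||x|x i rx].
  - exact: ltW.
  - exact/exprn_ge0/ltW.
  - have /andP[w0 w1] := omega01 (sqn x / t).
    have [xr|rx] := leP `|x 0 i0| r; last first.
      by rewrite (out _ _ rx) mulr0 normr0 exprn_ge0// ltW.
    rewrite ger0_norm ?mulr_ge0// -[leRHS]mulr1 ler_pM//.
    by apply: lerXn2r => //; rewrite nnegrE// ltW.
  - by rewrite (out _ _ rx) mulr0.
rewrite -(sqrt_powR (ltW t0)) -/r exprD mulrA mulrC -exprMn ler_wpM2r ?exprn_ge0 ?(ltW r0)//.
have s0 := step_gt0 R m.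
by apply: lerXn2r; rewrite ?nnegrE; lra.
Qed.

(** With e(t) = t^(beta-1) e^(-t), the left side is the integral over t of e(t) times the lattice
    sum of [null_scaling]. For each t that sum tends to 0, and by [phi_le] it is bounded by 2 * 3^N,
    so dominated convergence applies. *)
Lemma null_bump_exp : 1 <= beta ->
  lsum m (fun x => p x * bump_exp omega (sqn x))
    - Gamma beta * lsum m (fun x => p x * omega (sqn x)) @[m --> \oo] --> (0 : R).
Proof.
move=> beta1; have mD : measurable D by exact: measurable_itv.
have beta0 : 0 <= beta - 1 by lra.
pose phi1 m := lsum m (fun x => p x * omega (sqn x)).
have phi1E m : phi1 m = phi m 1 by apply: eq_lsum => x; rewrite divr1.
pose e (t : R) := t `^ (beta - 1) * expR (- t).
have e0 t : 0 <= e t by rewrite mulr_ge0 ?powR_ge0 ?expR_ge0.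
have ie : mu.-integrable D (EFin \o e) by exact: integrable_Gamma.
pose F (x : 'rV[R]_N) (t : R) := p x * kern omega (sqn x) t.
have ik (x : 'rV[R]_N) := integrable_kern comega omega01 a0 ab omegaa omegab (sqn_ge0 x).
have iF m := @Rintegral_lsum m F (fun k => integrable_scale _ (ik (lpoint R k))).
pose f m (t : R) := lsum m (F^~ t) - phi1 m * e t.
have fE m (t : R) : 0 < t ->
    f m t = e t * lsum m (fun x => p x * (t `^ (- beta) * omega (sqn x / t) - omega (sqn x))).
  move=> t0; rewrite mulrC; under eq_lsum do rewrite mulrBr mulrCA.
  rewrite lsumB lsumZ mulrBl /f; congr (_ - _).
  have ht : t `^ (- beta) * e t = t^-1 * expR (- t).
    rewrite /e mulrA -powRD; last by apply/implyP => _; rewrite gt_eqF.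
    by rewrite (_ : - beta + (beta - 1) = - 1) ?powR_inv1 ?(ltW t0)//; ring.
  rewrite mulrAC ht -lsumZ.
  by apply: eq_lsum => x; rewrite /F /kern; ring.
have intf m : mu.-integrable D (EFin \o f m).
  rewrite (_ : f m = fun t => lsum m (F^~ t) + (- phi1 m) * e t); last first.
    by apply/funext => t; rewrite mulNr.
  by apply: integrable_add; [case: (iF m)|exact: integrable_scale].
have If m : \int[mu]_(t in D) f m t = lsum m (fun x => p x * bump_exp omega (sqn x))
    - Gamma beta * phi1 m.
  rewrite RintegralB//; [|by case: (iF m)|exact: integrable_scale].
  rewrite (iF m).2 RintegralZl// [phi1 m * _]mulrC; congr (_ - _).
  by apply: eq_lsum => x; rewrite /F RintegralZl.
under eq_fun do rewrite -If.
have cf (t : R) : D t -> (f m t)%:E @[m --> \oo] --> (0 : R)%:E.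
  move=> /gt0_halfline t0.
  have h : f m t @[m --> \oo] --> (0 : R).
    under eq_fun do rewrite fE//.
    rewrite -(mulr0 (e t)); apply: cvgMr.
    exact: (@null_scaling R N d i0 omega a b a0 (ltW ab) comega omegaa omegab beta t t0 Nbeta).
  by apply: cvg_EFin => //; exact: nearW.
have fle m (t : R) : D t -> (`|(f m t)%:E| <= (2 * 3 ^+ N * e t)%:E)%E.
  move=> /gt0_halfline t0; rewrite abse_EFin lee_fin fE// normrM (ger0_norm (e0 t)).
  rewrite mulrC ler_wpM2r//.
  have -> : lsum m (fun x => p x * (t `^ (- beta) * omega (sqn x / t) - omega (sqn x)))
      = t `^ (- beta) * phi m t - phi m 1.
    rewrite -phi1E -lsumZ -lsumB; apply: eq_lsum => x; ring.
  have h1 : 0 <= t `^ (- beta) * phi m t <= 3 ^+ N.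
    rewrite mulr_ge0 ?powR_ge0//= powRN mulrC ler_pdivrMr ?powR_gt0//.
    exact: phi_le.
  have h2 : 0 <= phi m 1 <= 3 ^+ N.
    by rewrite phi_ge0/=; have := @phi_le m 1 ltr01; rewrite powR1 mulr1.
  rewrite ler_norml; apply/andP; split; lra.
have [|||||_ _ h] := @dominated_convergence _ _ R mu D mD (fun m => EFin \o f m) (cst (0 : R)%:E)
  (fun t => (2 * 3 ^+ N * e t)%:E).
- by move=> m; have /integrableP[] := intf m.
- exact: measurable_cst.
- by apply/aeW => t; exact: cf.
- exact: integrable_scale.
- by apply/aeW => t m; exact: fle.
move: h; rewrite integral0_eq// => /fine_cvg; exact.
Qed.

End LatticeGamma.

Section GaussMoments.
Variables (R : realType) (N : nat) (i0 : 'I_N).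

Lemma lsum_gauss_moment (d : nat) (k L : R) : 0 < k ->
  lsum1 m (fun u => `|u| ^+ d * gaussk k u) @[m --> \oo] --> L ->
  lsum m (fun x : 'rV[R]_N => `|x 0 i0| ^+ d * expR (- (k ^+ 2 * sqn x))) @[m --> \oo]
    --> L * (Num.sqrt pi / k) ^+ N.-1.
Proof.
move=> k0 cL.
pose F (i : 'I_N) (u : R) := (if i == i0 then `|u| ^+ d else 1) * gaussk k u.
have E m : lsum m (fun x : 'rV[R]_N => `|x 0 i0| ^+ d * expR (- (k ^+ 2 * sqn x)))
    = lsum1 m (fun u => `|u| ^+ d * gaussk k u) * lsum1 m (gaussk k) ^+ N.-1.
  rewrite -(@eq_lsum _ _ m (fun x => \prod_i F i (x 0 i))); last first.
    move=> x; rewrite /F big_split/=; congr (_ * _).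
      rewrite (bigD1 i0)//= eqxx big1 ?mulr1// => i ii.
      by rewrite (negbTE ii).
    rewrite /sqn mulr_sumr -sumrN expR_sum; apply: eq_bigr => i _.
    by rewrite /gaussk /gauss_fun exprMn.
  rewrite lsum_prod (bigD1 i0)//=; congr (_ * _).
    by rewrite /F eqxx.
  rewrite (eq_bigr (fun=> lsum1 m (gaussk k))) => [|i ii].
    by rewrite prodr_const; congr (_ ^+ _); rewrite cardC1 card_ord.
  rewrite /F (negbTE ii); congr (_ * _); apply: eq_bigr => j _.
  by rewrite mul1r.
under eq_fun do rewrite E.
apply: cvgM => //.
have c := lsum1_gaussk k0.
elim: N.-1 => [|j IH].
  by under eq_fun do rewrite expr0; exact: cvg_cst.
by under eq_fun do rewrite exprS; rewrite exprS; exact: cvgM.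
Qed.

End GaussMoments.

(** * The gradient at the origin *)

Section MeanValue.
Variables (R : realType) (N n' : nat) (J : 'M[R]_N).
Hypotheses (JT : J^T = - J) (JJ : J *m J = - 1%:M).
Hypothesis Nn : N%:R = 2 * n'.+1%:R :> R.
Variables (f : 'rV[R]_N -> R) (f1 : 'I_N -> 'rV[R]_N -> R)
  (f2 : 'I_N -> 'I_N -> 'rV[R]_N -> R).
Hypothesis harm : harmonic_data J f f1 f2.
Variable i0 : 'I_N.

(** Lets [null_harmonic_radial] be applied to x_i0 too, so that [f - D x_i0] can be rescaled as a
    whole. *)
Lemma harmonic_coord :
  harmonic_data J (fun x => x 0 i0) (fun k _ => (k == i0)%:R) (fun _ _ _ => 0).
Proof.
move=> x _; split.
- exact: coord_continuous.
- by move=> k; split; [exact: d_coord|exact: cst_continuous].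
- by move=> k l; split; [exact: drvC|exact: cst_continuous].
- by rewrite big1// => k _; rewrite big1// => l _; rewrite mulr0.
Qed.

Variables (omega : R -> R) (a b : R).
Hypothesis comega : forall s : R, {for s, continuous omega}.
Hypothesis omega01 : forall s, 0 <= omega s <= 1.
Hypothesis a0 : 0 < a.
Hypothesis ab : a < b.
Hypothesis b1 : b < 1.
Hypothesis omegaa : forall s, s <= a -> omega s = 0.
Hypothesis omegab : forall s, b <= s -> omega s = 0.

Let D := f1 i0 0.

(** A first-order Taylor estimate, in terms of sqrt r because the bump at scale r lives in |x|^2 <
    r. *)
Let near_zero (e : R) : 0 < e -> exists2 r : R, 0 < r <= 1 &
  forall x : 'rV[R]_N, (forall i, `|x 0 i| <= Num.sqrt r) ->
    `|f x - f 0 - \sum_k x 0 k * f1 k 0| <= N%:R * Num.sqrt r * e.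
Proof.
move=> e0; have s0 : sqn (0 : 'rV[R]_N) < 1.
  by rewrite /sqn big1 ?ltr01// => i _; rewrite mxE expr0n.
have [g [cg gE]] := @caratheodory R N f f1 0
  (filterS (fun y y1 k => let: And4 _ h _ _ := harm y1 in (h k).1) (open_ball_sqn s0))
  (fun k => let: And4 _ h _ _ := harm s0 in (h k).2).
have : \forall y \near (0 : 'rV[R]_N), (forall k, `|f1 k 0 - g k y| <= e) /\
    f y - f 0 = \sum_k (y 0 k - (0 : 'rV[R]_N) 0 k) * g k y.
  apply: filterI gE.
  apply: (@filter_forall _ _ (fun k y => `|f1 k 0 - g k y| <= e) (nbhs (0 : 'rV[R]_N))) => k.
  exact: (cvgrPdist_le _ _).1 (cg k) _ e0.
move=> /(@nbhs_ballP R 'rV[R]_N)[rho /= rho0 H].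
pose q : R := Num.min 1 (rho / 2).
have q0 : 0 < q by rewrite lt_min ltr01 divr_gt0.
have q1 : q <= 1 by rewrite ge_min lexx.
have qrho : q < rho.
  by rewrite gt_min; apply/orP; right; rewrite ltr_pdivrMr// mulr_natr mulr2n ltrDl.
exists (q ^+ 2); first by rewrite exprn_gt0//= exprn_ile1// ltW.
rewrite sqrtr_sqr gtr0_norm// => x xq.
have [|h1 h2] := H x.
  rewrite -ball_normE/= sub0r normrN (le_lt_trans _ qrho)//.
  by apply: norm_rV_le => //; exact: ltW.
rewrite h2 -sumrB (le_trans (ler_norm_sum _ _ _))//.
apply: (@le_trans _ _ (\sum_(k < N) q * e)); last first.
  by rewrite sumr_const card_ord -[(q * e) *+ N]mulr_natl mulrA.
apply: ler_sum => k _; rewrite mxE subr0 -mulrBr normrM distrC.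
by apply: ler_pM.
Qed.

(** Up to a null function, [omega] may be replaced by [w], which is concentrated in |x|^2 <= r.
    There [f - D x_i0] equals [lin] up to a small multiple of sqrt r, and [lin] is even in x_i0,
    hence orthogonal to the odd x_i0 w. *)
Lemma null_mean_value : null (fun x => (f x - D * x 0 i0) * (x 0 i0 * omega (sqn x))).
Proof.
apply/cvgrPdist_le => e e0.
(* The remainder N sqrt r (e / (2c)), the weight sqrt r * r^(-n-1) and the volume (3 sqrt r)^N = 3^N
   r^n multiply to 3^N N e / (2c): all powers of r cancel. The summand 1 keeps c positive. *)
pose c : R := 3 ^+ N * N%:R + 1.
have c0 : 0 < c by rewrite ltr_wpDl// mulr_ge0// exprn_ge0.
have [|r /andP[r0 r1] near_r] := near_zero (e := e / (2 * c)).
  by rewrite divr_gt0// mulr_gt0.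
have sr0 : 0 < Num.sqrt r by rewrite sqrtr_gt0.
have srr : Num.sqrt r ^+ 2 = r by rewrite sqr_sqrtr// ltW.
pose w (x : 'rV[R]_N) := r^-1 ^+ n'.+2 * omega (sqn x / r).
have c_omega : continuous omega by move=> s; exact: comega.
have n1 := null_harmonic_radial JT JJ Nn harm i0 a0 (ltW ab) b1 r0 r1 c_omega omegaa omegab.
have n2 := null_harmonic_radial JT JJ Nn harmonic_coord i0 a0 (ltW ab) b1 r0 r1 c_omega
  omegaa omegab.
have n3 : null (fun x => (f x - D * x 0 i0) * (x 0 i0 * (w x - omega (sqn x)))).
  by apply: eq_null (nullD n1 (nullZ (- D) n2)) => x; rewrite /w; ring.
pose lin (x : 'rV[R]_N) := f 0 + \sum_(k | k != i0) x 0 k * f1 k 0.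
have sqn_flip x : sqn (flip i0 x) = sqn x.
  by apply: eq_bigr => i _; rewrite mxE; case: eqP => // _; rewrite sqrrN.
have odd m : lsum m (fun x => lin x * (x 0 i0 * w x)) = 0.
  apply: (@lsum_odd _ _ _ i0) => x; rewrite /w sqn_flip mxE eqxx.
  have -> : lin (flip i0 x) = lin x; last by ring.
  by congr (_ + _); apply: eq_bigr => k /negbTE ki; rewrite mxE ki.
have bound m : step R m <= Num.sqrt r ->
    `|lsum m (fun x => (f x - D * x 0 i0) * (x 0 i0 * w x))| <= e / 2.
  move=> sm.
  have -> : lsum m (fun x => (f x - D * x 0 i0) * (x 0 i0 * w x))
      = lsum m (fun x => (f x - D * x 0 i0 - lin x) * (x 0 i0 * w x)).
    rewrite -[RHS]addr0 -[X in _ + X](odd m) -lsumD.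
    by apply: eq_lsum => x; rewrite -mulrDl subrK.
  have w_out (x : 'rV[R]_N) i : Num.sqrt r < `|x 0 i| -> w x = 0.
    move=> rx; rewrite /w omegab ?mulr0// ler_pdivlMr//.
    apply: (@le_trans _ _ r); first by rewrite ger_pMl// ltW.
    rewrite /sqn (bigD1 i)//= -[leLHS]addr0 lerD ?sumr_ge0//; last first.
      by move=> j _; exact: sqr_ge0.
    rewrite -srr -[leRHS]real_normK ?num_real// ler_pXn2r ?nnegrE ?(ltW sr0)//.
    exact: ltW.
  have K0 : 0 <= N%:R * Num.sqrt r * (e / (2 * c)) * (Num.sqrt r * r^-1 ^+ n'.+2).
    apply: mulr_ge0; last by rewrite mulr_ge0 ?(ltW sr0)// exprn_ge0// invr_ge0 ltW.
    apply: mulr_ge0; first by rewrite mulr_ge0// ltW.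
    by rewrite divr_ge0 ?(ltW e0)// mulr_ge0// ltW.
  apply: (@le_trans _ _ ((N%:R * Num.sqrt r * (e / (2 * c)) * (Num.sqrt r * r^-1 ^+ n'.+2))
      * (2 * Num.sqrt r + step R m) ^+ N)).
    apply: lsum_box => [||x|x i rx].
    - exact: ltW.
    - exact: K0.
    - have [xr|] := pselect (forall i, `|x 0 i| <= Num.sqrt r); last first.
        move=> /existsNP[i /negP]; rewrite -ltNge => xi.
        by rewrite (w_out _ _ xi) !mulr0 normr0.
      rewrite normrM [X in _ * X]normrM; apply: ler_pM; rewrite ?mulr_ge0//.
        have := near_r x xr; rewrite (bigD1 i0)//= -/D.
        by congr (`|_| <= _); rewrite /lin; ring.
      have /andP[w0 w1] := omega01 (sqn x / r).
      apply: ler_pM => //; rewrite /w normrM (ger0_norm w0) ger0_norm; last first.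
        by rewrite exprn_ge0// invr_ge0 ltW.
      by rewrite ler_piMr// exprn_ge0// invr_ge0 ltW.
    - by rewrite (w_out _ _ rx) !mulr0.
  apply: (@le_trans _ _ ((N%:R * Num.sqrt r * (e / (2 * c)) * (Num.sqrt r * r^-1 ^+ n'.+2))
      * (3 * Num.sqrt r) ^+ N)).
    rewrite ler_wpM2l//.
    by apply: lerXn2r; rewrite ?nnegrE; have := step_gt0 R m; lra.
  have NE : N = (n'.+1 * 2)%N.
    by apply/eqP; rewrite -(eqr_nat R) Nn natrM mulrC.
  have sN : Num.sqrt r ^+ N = r ^+ n'.+1 by rewrite NE mulnC exprM srr.
  have -> : N%:R * Num.sqrt r * (e / (2 * c)) * (Num.sqrt r * r^-1 ^+ n'.+2)
      * (3 * Num.sqrt r) ^+ N = (e / 2) * ((3 ^+ N * N%:R) / c).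
    have qr : Num.sqrt r * Num.sqrt r / r = 1 by rewrite -expr2 srr divff// gt_eqF.
    rewrite exprMn sN exprVn [r ^+ n'.+2]exprS -[RHS]mulr1 -{2}qr.
    by field; rewrite ?gt_eqF ?exprn_gt0.
  rewrite ler_piMr ?divr_ge0 ?(ltW e0)// ler_pdivrMr// mul1r /c lerDl//.
have e20 : 0 < e / 2 by rewrite divr_gt0.
have h1 : \forall m \near \oo, `|0 - lsum m (fun x =>
    (f x - D * x 0 i0) * (x 0 i0 * (w x - omega (sqn x))))| <= e / 2.
  exact: (cvgrPdist_le _ _).1 n3 _ e20.
have h2 : \forall m \near \oo, step R m <= Num.sqrt r.
  exact: (cvgr_le _ (@step_cvg0 R)) sr0.
near=> m.
have m1 : `|0 - lsum m (fun x => (f x - D * x 0 i0) * (x 0 i0 * (w x - omega (sqn x))))| <= e / 2.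
  by near: m.
have m2 : step R m <= Num.sqrt r by near: m.
have m3 := bound m m2.
have E : lsum m (fun x => (f x - D * x 0 i0) * (x 0 i0 * omega (sqn x)))
   = lsum m (fun x => (f x - D * x 0 i0) * (x 0 i0 * w x))
   - lsum m (fun x => (f x - D * x 0 i0) * (x 0 i0 * (w x - omega (sqn x)))).
  by rewrite -lsumB; apply: eq_lsum => x; ring.
rewrite E sub0r normrN (le_trans (ler_normB _ _))//.
by move: m1; rewrite sub0r normrN => m1; rewrite [leRHS](splitr e) lerD.
Unshelve. all: by end_near. Qed.

End MeanValue.

(** * The sharp constant at the origin *)

Section GradientAtZero.
Variables (R : realType) (N n' : nat) (J : 'M[R]_N).
Hypotheses (JT : J^T = - J) (JJ : J *m J = - 1%:M).
Hypothesis Nn : N%:R = 2 * n'.+1%:R :> R.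
Variables (f : 'rV[R]_N -> R) (f1 : 'I_N -> 'rV[R]_N -> R)
  (f2 : 'I_N -> 'I_N -> 'rV[R]_N -> R).
Hypothesis harm : harmonic_data J f f1 f2.
Hypothesis f_le1 : forall x, sqn x < 1 -> `|f x| <= 1.
Variable i0 : 'I_N.

Let D := f1 i0 0.

(** The positive part of (s - a) (b - s). *)
Definition bump (a b s : R) : R := (`|(s - a) * (b - s)| + (s - a) * (b - s)) / 2.

Let bumpE (a b s : R) : 0 < a -> a < b -> b < 1 ->
  [/\ 0 <= bump a b s <= 1, s <= a -> bump a b s = 0, b <= s -> bump a b s = 0
    & a < s -> s < b -> 0 < bump a b s].
Proof.
move=> a0 ab b1; rewrite /bump; set g := (s - a) * (b - s).
have [g0|g0] := leP 0 g.
  have g1 : g <= 1.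
    have h0 := sqr_ge0 (2 * s - a - b); have h1 : (b - a) * (b - a) <= 1 by nra.
    have -> : g = ((b - a) * (b - a) - (2 * s - a - b) ^+ 2) / 4 by rewrite /g; field.
    by rewrite ler_pdivrMr//; lra.
  rewrite ger0_norm// (_ : (g + g) / 2 = g); last by field.
  rewrite g0 g1; split=> // [sa|bs|sa sb]; rewrite ?mulr_gt0 ?subr_gt0//.
    by apply/eqP; rewrite eq_le g0 andbT /g; nra.
  by apply/eqP; rewrite eq_le g0 andbT /g; nra.
rewrite ltr0_norm// addNr mul0r lexx ler01; split=> // sa sb.
by move: g0; rewrite ltNge mulr_ge0// ltW// subr_gt0.
Qed.

Let cts_bump (a b s : R) : {for s, continuous (bump a b)}.
Proof.
have ci : {for s, continuous (fun u : R => u)} by exact: cvg_id.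
have ck (k : R) : {for s, continuous (fun _ : R => k)} by exact: cvg_cst.
have c1 : {for s, continuous (fun u : R => (u - a) * (b - u))} :=
  ctsM (ctsB ci (@ck a)) (ctsB (@ck b) ci).
have c2 : {for s, continuous (fun u : R => `|(u - a) * (b - u)|)} by exact: cvg_norm c1.
have h := ctsM (ctsD c2 c1) (@ck 2^-1); exact: h.
Qed.

Let G1 : R := Gamma (n'.+1%:R + 1).
Let G2 : R := Gamma (n'.+1%:R + 2^-1).

Let G1_gt0 : 0 < G1. Proof. by apply: Gamma_gt0; rewrite lerDr. Qed.
Let G2_gt0 : 0 < G2.
Proof. by apply: Gamma_gt0; rewrite ler_wpDr// ?invr_ge0// ler1n. Qed.

(** Up to null sequences, collected in [Z], the chain is G2 |D| M P <= G2 |D| EA ~ G1 G2 |D| A <= G1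
    G2 B ~ G1 EB <= G1 M Q, where [P] and [Q] are the Gaussian sums with exponents -s / a and -s.
    Then [M] and the common powers of sqrt pi cancel. *)
Let gradient_sub (a : R) : 0 < a -> a < 1 ->
  G2 * `|D| * (Num.sqrt pi * (Num.sqrt a) ^+ N.+2) <= 2 * G1.
Proof.
move=> a0 a1; pose b := (a + 1) / 2.
have ab : a < b by rewrite /b; lra.
have b1 : b < 1 by rewrite /b; lra.
pose omega := bump a b.
have comega (s : R) : {for s, continuous omega} by exact: cts_bump.
have bE s := bumpE s a0 ab b1.
have omega01 s : 0 <= omega s <= 1 by case: (bE s).
have omegaa s : s <= a -> omega s = 0 by case: (bE s).
have omegab s : b <= s -> omega s = 0 by case: (bE s).
have omega_gt0 s : a < s -> s < b -> 0 < omega s by case: (bE s).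
have [M M0 EM] := bump_exp_bounds comega omega01 a0 ab b1 omegaa omegab omega_gt0.
pose A m := lsum m (fun x : 'rV[R]_N => `|x 0 i0| ^+ 2 * omega (sqn x)).
pose B m := lsum m (fun x : 'rV[R]_N => `|x 0 i0| ^+ 1 * omega (sqn x)).
pose EA m := lsum m (fun x : 'rV[R]_N => `|x 0 i0| ^+ 2 * bump_exp omega (sqn x)).
pose EB m := lsum m (fun x : 'rV[R]_N => `|x 0 i0| ^+ 1 * bump_exp omega (sqn x)).
pose c m := lsum m (fun x : 'rV[R]_N => (f x - D * x 0 i0) * (x 0 i0 * omega (sqn x))).
have c0 : c m @[m --> \oo] --> (0 : R).
  exact: (null_mean_value JT JJ Nn harm i0 comega omega01 a0 ab b1 omegaa omegab).
have a2 : EA m - G1 * A m @[m --> \oo] --> (0 : R).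
  apply: (@null_bump_exp R N 1 i0 omega a b comega omega01 a0 ab b1 omegaa omegab).
    by rewrite Nn; ring.
  by rewrite lerDr.
have a3 : EB m - G2 * B m @[m --> \oo] --> (0 : R).
  apply: (@null_bump_exp R N 0 i0 omega a b comega omega01 a0 ab b1 omegaa omegab).
    by rewrite Nn; field.
  by rewrite ler_wpDr// ?invr_ge0// ler1n.
have cAB m : `|D| * A m <= B m + `|c m|.
  have E : D * A m = lsum m (fun x : 'rV[R]_N => f x * (x 0 i0 * omega (sqn x))) - c m.
    rewrite /A /c -lsumZ -lsumB; apply: eq_lsum => x.
    by rewrite real_normK ?num_real//; ring.
  have A0 : 0 <= A m.
    by apply: lsum_ge0 => x; rewrite mulr_ge0// ?exprn_ge0//; case/andP: (omega01 (sqn x)).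
  rewrite -{1}(ger0_norm A0) -normrM E (le_trans (ler_normB _ _))// lerD2r.
  rewrite (le_trans (ler_norm_lsum _ _))//; apply: ler_lsum => x.
  have /andP[w0 w1] := omega01 (sqn x).
  rewrite normrM [X in _ * X <= _]normrM (ger0_norm w0) expr1.
  have [xb|xb] := ltP (sqn x) b; last by rewrite omegab// !mulr0.
  by apply: ler_piMl; [exact: mulr_ge0|exact/f_le1/(lt_trans xb)].
pose P m := lsum m (fun x : 'rV[R]_N => `|x 0 i0| ^+ 2 * expR (- ((Num.sqrt a)^-1 ^+ 2 * sqn x))).
pose Q m := lsum m (fun x : 'rV[R]_N => `|x 0 i0| ^+ 1 * expR (- (1 ^+ 2 * sqn x))).
(* The bounds on [bump_exp] are available for s > 0 only; where x_i0 = 0, the weight |x_i0| makes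
   both sides vanish. *)
have sqn_gt0 (x : 'rV[R]_N) : x 0 i0 != 0 -> 0 < sqn x.
  move=> x0; rewrite /sqn (bigD1 i0)//= ltr_wpDr//.
    by apply: sumr_ge0 => j _; exact: sqr_ge0.
  by rewrite exprn_even_gt0.
have PE m : M * P m <= EA m.
  rewrite -lsumZ; apply: ler_lsum => x; rewrite mulrCA.
  have [->|x0] := eqVneq (x 0 i0) 0; first by rewrite normr0 expr0n/= !mul0r.
  rewrite ler_wpM2l ?exprn_ge0//.
  have /andP[+ _] := EM _ (sqn_gt0 x x0); congr (_ * expR (- _) <= _).
  by rewrite exprVn sqr_sqrtr ?(ltW a0)// mulrC.
have QE m : EB m <= M * Q m.
  rewrite -lsumZ; apply: ler_lsum => x; rewrite [X in _ <= X]mulrCA.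
  have [->|x0] := eqVneq (x 0 i0) 0; first by rewrite normr0 expr0n/= !mul0r.
  rewrite ler_wpM2l ?exprn_ge0//.
  have /andP[_ +] := EM _ (sqn_gt0 x x0); congr (_ <= _ * expR (- _)).
  by rewrite expr1n mul1r.
have k0 : 0 < (Num.sqrt a)^-1 by rewrite invr_gt0 sqrtr_gt0.
have cP := lsum_gauss_moment i0 k0 (lsum1_sqr_gaussk k0).
have cQ := lsum_gauss_moment i0 (d := 1) (@ltr01 R) (lsum1_norm_gaussk (@ltr01 R)).
pose Z m := G2 * `|D| * (EA m - G1 * A m) + G1 * G2 * `|c m| - G1 * (EB m - G2 * B m).
have Z0 : Z m @[m --> \oo] --> (0 : R).
  have -> : (0 : R) = G2 * `|D| * 0 + G1 * G2 * `|0 : R| - G1 * 0.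
    by rewrite normr0; ring.
  apply: cvgB; last exact: cvgMr.
  by apply: cvgD; [exact: cvgMr|apply: cvgMr; exact: cvg_norm].
have key m : G2 * `|D| * (M * P m) <= G1 * (M * Q m) + Z m.
  have h1 : G2 * `|D| * (M * P m) <= G2 * `|D| * EA m.
    by rewrite ler_wpM2l// mulr_ge0// ltW.
  have h2 : G1 * G2 * (`|D| * A m) <= G1 * G2 * (B m + `|c m|).
    by rewrite ler_wpM2l// mulr_ge0// ltW.
  have h3 : G1 * EB m <= G1 * (M * Q m) by rewrite ler_wpM2l// ltW.
  by rewrite /Z; nra.
have lim : G2 * `|D| * (M * (Num.sqrt pi / (2 * (Num.sqrt a)^-1 ^+ 3) *
    (Num.sqrt pi / (Num.sqrt a)^-1) ^+ N.-1)) <=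
    G1 * (M * (1 ^- 2 * (Num.sqrt pi / 1) ^+ N.-1)) + 0.
  apply: (@ler_cvg_to nat \oo _ R (fun m => G2 * `|D| * (M * P m))
    (fun m => G1 * (M * Q m) + Z m)).
  - by apply: cvgMr; exact: cvgMr.
  - by apply: cvgD => //; apply: cvgMr; exact: cvgMr.
  - by apply: nearW => m; exact: key.
have N0 : (0 < N)%N by case: (N) i0 => // -[].
have pN : 0 < Num.sqrt pi ^+ N.-1 :> R by rewrite exprn_gt0// sqrtr_gt0 pi_gt0.
move: lim; rewrite addr0 expr1n invr1 mul1r mulr1 invrK.
set q := Num.sqrt a; set w := Num.sqrt pi.
have -> : w / (2 * q^-1 ^+ 3) * (w * q) ^+ N.-1 = w * q ^+ N.+2 / 2 * w ^+ N.-1.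
  have q0 : q != 0 by rewrite gt_eqF// sqrtr_gt0.
  rewrite exprMn (_ : N.+2 = N.-1 + 3)%N; last by rewrite addn3 prednK.
  by rewrite exprD; field.
have -> : G2 * `|D| * (M * (w * q ^+ N.+2 / 2 * w ^+ N.-1)) =
  G2 * `|D| * (w * q ^+ N.+2) / 2 * (M * w ^+ N.-1) by ring.
rewrite ler_pM2r ?mulr_gt0// ler_pdivrMr// => h; rewrite [leRHS]mulrC; exact: h.
Qed.

(** The limit of [gradient_sub] for a -> 1, along squares so that sqrt a is explicit. *)
Lemma gradient_at_zero : Num.sqrt pi * G2 * `|D| <= 2 * G1.
Proof.
apply: (@ler_cvg_to nat \oo _ R
  (fun m => G2 * `|D| * (Num.sqrt pi * (1 - (m.+2%:R)^-1) ^+ N.+2)) (fun=> 2 * G1)) => //.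
- rewrite (_ : _ * G2 * _ = G2 * `|D| * (Num.sqrt pi * (1 - 0) ^+ N.+2)); last first.
    by rewrite subr0 expr1n; ring.
  apply: cvgMr; apply: cvgMr.
  have h : 1 - (m.+2%:R : R)^-1 @[m --> \oo] --> (1 - 0 : R).
    apply: cvgB; first exact: cvg_cst.
    by have := @cvg_harmonic R; rewrite -(cvg_shiftS (@harmonic R)); exact.
  elim: N.+2 => [|j IH].
    by under eq_fun do rewrite expr0; exact: cvg_cst.
  by under eq_fun do rewrite exprS; rewrite exprS; exact: cvgM.
- exact: cvg_cst.
- apply: nearW => m; set q : R := 1 - _.
  have q0 : 0 < q by rewrite subr_gt0 invf_lt1 ?ltr0n// ltr1n.
  have q1 : q < 1 by rewrite gtrBl invr_gt0.
  have := @gradient_sub (q ^+ 2).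
  rewrite sqrtr_sqr (gtr0_norm q0); apply; first exact: exprn_gt0.
  by rewrite exprn_ilt1// ltW.
Qed.

End GradientAtZero.

(** * Complex coordinates *)

Import ComplexField.
Local Open Scope complex_scope.

Section ComplexParts.
Variable R : realType.
Implicit Types (z w : R[i]) (r : R).

Lemma cReD z w : complex.Re (z + w) = complex.Re z + complex.Re w.
Proof. by case: z; case: w. Qed.
Lemma cReN z : complex.Re (- z) = - complex.Re z.
Proof. by case: z. Qed.
Lemma cReB z w : complex.Re (z - w) = complex.Re z - complex.Re w.
Proof. by case: z; case: w. Qed.
Lemma cReM z w : complex.Re (z * w) =
  complex.Re z * complex.Re w - complex.Im z * complex.Im w.
Proof. by case: z; case: w. Qed.
Lemma cReZ r z : complex.Re (r%:C * z) = r * complex.Re z.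
Proof. by rewrite cReM/= mul0r subr0. Qed.
Lemma cImD z w : complex.Im (z + w) = complex.Im z + complex.Im w.
Proof. by case: z; case: w. Qed.
Lemma cImN z : complex.Im (- z) = - complex.Im z.
Proof. by case: z. Qed.
Lemma cImM z w : complex.Im (z * w) =
  complex.Re z * complex.Im w + complex.Im z * complex.Re w.
Proof. by case: z; case: w. Qed.
Lemma cRe_conj z : complex.Re (conjc z) = complex.Re z.
Proof. by case: z. Qed.
Lemma cRe_sum (I : Type) (r : seq I) (F : I -> R[i]) :
  complex.Re (\sum_(i <- r) F i) = \sum_(i <- r) complex.Re (F i).
Proof. by elim: r => [|i r IH]; rewrite ?big_nil// !big_cons cReD IH. Qed.

Lemma complex_eq z w :
  complex.Re z = complex.Re w -> complex.Im z = complex.Im w -> z = w.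
Proof. by case: z; case: w => /= ? ? ? ? -> ->. Qed.

Lemma cRe_prod z w : complex.Re z * complex.Re w = complex.Re (z * w + z * conjc w) / 2.
Proof. by case: z; case: w => a b c d /=; field. Qed.

Lemma cconjM z w : conjc (z * w) = conjc z * conjc w.
Proof. by case: z; case: w => a b c d; apply: complex_eq; rewrite /=; ring. Qed.
Lemma cconjD z w : conjc (z + w) = conjc z + conjc w.
Proof. by case: z; case: w => a b c d; apply: complex_eq; rewrite /=; ring. Qed.
Lemma cconjN z : conjc (- z) = - conjc z.
Proof. by case: z. Qed.
Lemma cconjK z : conjc (conjc z) = z.
Proof. by case: z => a b; rewrite /= opprK. Qed.
Lemma cconj_bool (b : bool) : conjc (b%:R : R[i]) = b%:R.
Proof. by apply: complex_eq; case: b; rewrite //= oppr0. Qed.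
Lemma cconj_sum (I : Type) (r : seq I) (F : I -> R[i]) :
  conjc (\sum_(i <- r) F i) = \sum_(i <- r) conjc (F i).
Proof.
elim: r => [|i r IH]; last by rewrite !big_cons cconjD IH.
by rewrite !big_nil; apply: complex_eq; rewrite //= oppr0.
Qed.

End ComplexParts.

Definition ci {R : realType} : R[i] := 0 +i* 1.

Lemma ci_sqr (R : realType) : ci * ci = -1 :> R[i].
Proof. by apply: complex_eq; rewrite /= ?mulr0 ?mul0r ?mulr1 ?sub0r ?addr0 ?oppr0. Qed.

Lemma cconj_ci (R : realType) : conjc ci = - ci :> R[i].
Proof. by apply: complex_eq; rewrite /= ?oppr0. Qed.

Section RealCoordinates.
Variables (R : realType) (n : nat).
Local Notation N := (n * 2)%N.
Implicit Types (K L : 'I_N) (x : 'rV[R]_N).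

Definition cidx K : 'I_n := mxvec (\matrix_(j < n, k < 2) j) 0 K.

(* The real coordinate K of the vector z is Re (conj (ceps K) * z (cidx K)). *)
Definition ceps K : R[i] :=
  mxvec (\matrix_(j < n, k < 2) (if k == 0 then 1 else ci)) 0 K.

Lemma cidx_x j : cidx (xidx j) = j. Proof. by rewrite /cidx mxvecE mxE. Qed.
Lemma cidx_y j : cidx (yidx j) = j. Proof. by rewrite /cidx mxvecE mxE. Qed.
Lemma ceps_x j : ceps (xidx j) = 1. Proof. by rewrite /ceps mxvecE mxE. Qed.
Lemma ceps_y j : ceps (yidx j) = ci. Proof. by rewrite /ceps mxvecE mxE. Qed.
Definition coordE := (cidx_x, cidx_y, ceps_x, ceps_y).

Lemma coord_ind (P : 'I_N -> Prop) :
  (forall j, P (xidx j)) -> (forall j, P (yidx j)) -> forall K, P K.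
Proof.
move=> Px Py K; case/mxvec_indexP: K => j k.
by case: k => [[|[|//]] k2]; [have := Px j|have := Py j];
  congr (P (mxvec_index _ _)); exact: val_inj.
Qed.

Lemma sum_coord (V : nmodType) (F : 'I_N -> V) :
  \sum_K F K = \sum_j (F (xidx j) + F (yidx j)).
Proof.
rewrite (reindex _ (curry_mxvec_bij n 2))/=.
rewrite (eq_bigr (fun p => (fun j k => F (mxvec_index j k)) p.1 p.2)) => [|[] //].
rewrite -(pair_bigA _ (fun j k => F (mxvec_index j k)))/=.
by apply: eq_bigr => j _; rewrite big_ord_recl big_ord1; congr (_ + F (mxvec_index _ _));
  exact: val_inj.
Qed.

Lemma sum_coord2 (V : nmodType) (F : 'I_N -> 'I_N -> V) :
  \sum_K \sum_L F K L = \sum_i \sum_j ((F (xidx i) (xidx j) + F (xidx i) (yidx j))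
    + (F (yidx i) (xidx j) + F (yidx i) (yidx j))).
Proof.
rewrite sum_coord; apply: eq_bigr => i _.
by rewrite (sum_coord (F (xidx i))) (sum_coord (F (yidx i))) -big_split.
Qed.

Lemma coord_r2c x K : x 0 K = complex.Re (conjc (ceps K) * r2c x 0 (cidx K)).
Proof. by elim/coord_ind: K => j; rewrite !coordE mxE /=; ring. Qed.

Lemma r2c_sum x j : r2c x 0 j = \sum_K (cidx K == j)%:R * ((x 0 K)%:C * ceps K).
Proof.
rewrite sum_coord (bigD1 j)//= big1 => [|k kj].
  by rewrite !coordE eqxx !mul1r mulr1 addr0 mxE; apply: complex_eq; rewrite /=; ring.
by rewrite !coordE (negbTE kj) !mul0r addr0.
Qed.

(** The matrix of multiplication by i, acting on row vectors from the right; see [r2c_tau]. *)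
Definition Jmx : 'M[R]_N :=
  \matrix_(L, K) complex.Re ((cidx L == cidx K)%:R * (conjc (ceps K) * ci * ceps L)).

Lemma Jmx_skew : Jmx^T = - Jmx.
Proof.
apply/matrixP => L K; rewrite !mxE eq_sym; case: eqP => _; rewrite ?mul0r ?oppr0//.
rewrite !mul1r -cReN -[LHS]cRe_conj !cconjM cconjK cconj_ci.
by congr complex.Re; ring.
Qed.

Lemma tau_r2c x K : tau Jmx x K = complex.Re (conjc (ceps K) * (ci * r2c x 0 (cidx K))).
Proof.
rewrite /tau r2c_sum !mulr_sumr cRe_sum; apply: eq_bigr => L _.
rewrite mxE -cReZ; congr complex.Re; ring.
Qed.

Lemma sqn_r2c x : sqn x = cnorm (r2c x) ^+ 2.
Proof.
rewrite /cnorm sqr_sqrtr; last by apply: sumr_ge0 => j _; exact: sqr_ge0.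
rewrite /sqn sum_coord; apply: eq_bigr => j _; rewrite mxE /Normc.normc sqr_sqrtr//.
by rewrite addr_ge0 ?sqr_ge0.
Qed.

Lemma cball_r2c x : @cball R n (r2c x) <-> sqn x < 1.
Proof.
rewrite sqn_r2c /cball/=; split=> h.
  by rewrite expr_lt1// sqrtr_ge0.
by move: h; rewrite expr_lt1// sqrtr_ge0.
Qed.

Lemma r2c_tau x j : r2c (\row_K tau Jmx x K) 0 j = ci * r2c x 0 j.
Proof.
have rowE K : (\row_K tau Jmx x K) 0 K = tau Jmx x K by rewrite mxE.
rewrite [LHS]mxE !rowE !tau_r2c !coordE conjc1 cconj_ci.
by case: (r2c x 0 j) => a b; apply: complex_eq; rewrite /=; ring.
Qed.

Lemma Jmx_sqr : Jmx *m Jmx = - 1%:M.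
Proof.
have tauE x : x *m Jmx = \row_K tau Jmx x K by apply/rowP => K; rewrite !mxE.
have H (x : 'rV[R]_N) : x *m Jmx *m Jmx = - x.
  apply/rowP => K; rewrite !tauE !mxE tau_r2c r2c_tau [ci * (ci * _)]mulrA ci_sqr mulN1r mulrN.
  by rewrite cReN -coord_r2c.
apply/row_matrixP => L; rewrite row_mul -[RHS]mul1mx.
have -> : row L Jmx = delta_mx 0 L *m Jmx by rewrite rowE.
by rewrite H mul1mx raddfN/= rowE mulmx1.
Qed.

(** With u = conj (ceps K) z_i and v = conj (ceps L) z_j, one has x_K = Re u and tau_K = - Im u,
    likewise for L, and Re u Re v + Im u Im v = Re (u conj v). *)
Lemma metricE x K L :
  (K == L)%:R - x 0 K * x 0 L - tau Jmx x K * tau Jmx x L =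
  complex.Re (conjc (ceps K) * ceps L *
    ((cidx K == cidx L)%:R - r2c x 0 (cidx K) * conjc (r2c x 0 (cidx L)))).
Proof.
have -> : (K == L)%:R = complex.Re (conjc (ceps K) * ceps L * (cidx K == cidx L)%:R) :> R.
  have xy (i j : 'I_n) : (xidx i == yidx j) = false.
    apply/negP => /eqP e; have := congr1 ceps e; rewrite !coordE => /eqP.
    by rewrite eq_complex/= oner_eq0.
  have xx (i j : 'I_n) : (xidx i == xidx j) = (i == j).
    apply/eqP/eqP => [e|->//]; have := congr1 cidx e; by rewrite !coordE.
  have yy (i j : 'I_n) : (yidx i == yidx j) = (i == j).
    apply/eqP/eqP => [e|->//]; have := congr1 cidx e; by rewrite !coordE.
  elim/coord_ind: K => i; elim/coord_ind: L => j; rewrite !coordE ?xx ?yy ?xy ?[_ == xidx _]eq_sym ?xy;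
    by case: (i == j) => /=; ring.
rewrite tau_r2c (tau_r2c x L) (coord_r2c x K) (coord_r2c x L) mulrBr cReB -addrA -opprD.
congr (_ - _).
set e := conjc (ceps K); set f := ceps L; set u := r2c x 0 _; set v := r2c x 0 _.
by case: e; case: f; case: u; case: v => /= *; ring.
Qed.

End RealCoordinates.

(** * The invariant Laplacian in real coordinates *)

Section InvariantHarmonic.
Variables (R : realType) (n : nat).
Local Notation N := (n * 2)%N.
Variable h : 'rV[R[i]]_n -> R.
Let f : 'rV[R]_N -> R := h \o @r2c R n.
Let f1 (k : 'I_N) : 'rV[R]_N -> R := 'D_(delta_mx 0 k) f.
Let f2 (k l : 'I_N) : 'rV[R]_N -> R := 'D_(delta_mx 0 l) (f1 k).

Let half : (2^-1 : R[i]) = (2^-1 : R)%:C.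
Proof. by rewrite rmorphV ?rmorph_nat// unitfE pnatr_eq0. Qed.

Let cpartial_real l w : cpartial l (fun z => (h z)%:C) w = (f1 l (c2r w))%:C.
Proof.
rewrite /cpartial; apply: complex_eq => //=.
by rewrite (_ : (fun _ => _) = cst 0) ?derive_cst.
Qed.

Let dz_dzbar (x : 'rV[R]_N) i j : (forall k l : 'I_N, derivable (f1 k) x (delta_mx 0 l)) ->
  dz i (dzbar j (fun z => (h z)%:C)) (r2c x) = (4^-1 : R)%:C *
    ((f2 (xidx j) (xidx i) x + f2 (yidx j) (yidx i) x) +i*
     (f2 (yidx j) (xidx i) x - f2 (xidx j) (yidx i) x)).
Proof.
move=> df.
have cp l : cpartial l (dzbar j (fun z => (h z)%:C)) (r2c x)
    = (2^-1 : R)%:C * (f2 (xidx j) l x +i* f2 (yidx j) l x).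
  rewrite /cpartial r2cK.
  have -> : (fun y => complex.Re (dzbar j (fun z => (h z)%:C) (r2c y)))
      = (fun y => 2^-1 * f1 (xidx j) y).
    apply/funext => y; rewrite /dzbar !cpartial_real r2cK half /=; ring.
  have -> : (fun y => complex.Im (dzbar j (fun z => (h z)%:C) (r2c y)))
      = (fun y => 2^-1 * f1 (yidx j) y).
    apply/funext => y; rewrite /dzbar !cpartial_real r2cK half /=; ring.
  have dZ (k : 'I_N) : 'D_(delta_mx 0 l) (fun y : 'rV[R]_N => 2^-1 * f1 k y) x = 2^-1 * f2 k l x.
    have dk : is_derive x (delta_mx 0 l) (f1 k) (f2 k l x) := derivableP (df k l).
    have [_ ->] := drvM (drvC x (delta_mx 0 l) 2^-1) dk.
    by rewrite mul0r add0r.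
  rewrite (dZ (xidx j)) (dZ (yidx j)).
  by apply: complex_eq => /=; rewrite ?mul0r ?subr0 ?addr0.
rewrite /dz !cp half.
move: (f2 _ _ _) (f2 _ _ _) (f2 _ _ _) (f2 _ _ _) => a b c d.
by apply: complex_eq; rewrite /=; field.
Qed.

(** Inside the ball the factor 1 - |z|^2 can be cancelled. The real part of the remaining sum is a
    quarter of the real operator: each pair of complex indices accounts for a block of four real
    ones. *)
Lemma invariant_harmonic_data : invariant_harmonic h -> harmonic_data (Jmx R n) f f1 f2.
Proof.
move=> [C2 D0] x x1; have bx : @cball R n (r2c x) by apply/cball_r2c.
have [cf df dff] := C2 x bx.
split=> // [k|k l|].
- by have [dk ck] := df k; split=> //; exact: derivableP.
- by have [dk ck] := dff k l; split=> //; exact: derivableP.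
pose G i j : R[i] := ((i == j)%:R - r2c x 0 i * conjc (r2c x 0 j)) *
  dz i (dzbar j (fun z => (h z)%:C)) (r2c x).
have : 4 * (1 - cnorm (r2c x) ^+ 2)%:C * (\sum_i \sum_j G i j) = 0 := D0 _ bx.
move=> /eqP; rewrite mulf_eq0 mulf_eq0 pnatr_eq0/= => /orP[].
  rewrite -sqn_r2c => /eqP/(congr1 (@complex.Re R))/= h0.
  by move: x1; rewrite -subr_gt0 h0 ltxx.
move=> /eqP /(congr1 (@complex.Re R)); rewrite cRe_sum => S0.
(* [dz i (dzbar j _)] differentiates along j first, while the first index of [f2] is the first
   direction; exchanging the sums matches the two orders. *)
rewrite exchange_big/= sum_coord2.
have n4 : (4^-1 : R) != 0 by rewrite invr_eq0 pnatr_eq0.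
apply: (mulfI n4); rewrite mulr0 -[RHS]S0 mulr_sumr.
apply: eq_bigr => i _; rewrite cRe_sum mulr_sumr.
apply: eq_bigr => j _; rewrite !metricE !coordE conjc1 cconj_ci (eq_sym j i).
rewrite /G dz_dzbar; last by move=> k l; have [] := dff k l.
set u := r2c x 0 i; set v := r2c x 0 j.
rewrite -/(f2 (xidx i) (xidx j) x).
move: (f2 _ _ _) (f2 _ _ _) (f2 _ _ _) (f2 _ _ _) => p q r s.
by case: u => u1 u2; case: v => v1 v2; case: (i == j) => /=; field.
Qed.

End InvariantHarmonic.

(** * Calculus of complex-valued functions *)

Definition is_cderive (R : realType) (V : normedModType R) (x v : V)
    (F : V -> R[i]) (d : R[i]) : Prop :=
  is_derive x v (fun y => complex.Re (F y)) (complex.Re d) /\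
  is_derive x v (fun y => complex.Im (F y)) (complex.Im d).

Definition cts_complex (R : realType) (V : topologicalType) (x : V) (F : V -> R[i]) : Prop :=
  {for x, continuous (fun y => complex.Re (F y))} /\
  {for x, continuous (fun y => complex.Im (F y))}.

Definition csqr (R : realType) (z : R[i]) : R :=
  complex.Re z ^+ 2 + complex.Im z ^+ 2.

Section ComplexCalculus.
Variable R : realType.
Implicit Types (z d e : R[i]).

Lemma csqrE z : z * conjc z = (csqr z)%:C.
Proof. by case: z => a b; apply: complex_eq; rewrite /csqr/=; ring. Qed.

Lemma csqrM z d : csqr (z * d) = csqr z * csqr d.
Proof. by case: z => a b; case: d => u v; rewrite /csqr/=; ring. Qed.

Lemma csqr_ge0 z : 0 <= csqr z.
Proof. by rewrite addr_ge0 ?sqr_ge0. Qed.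

Lemma csqr_neq0 z : z != 0 -> csqr z != 0.
Proof.
apply: contra; rewrite paddr_eq0 ?sqr_ge0// !sqrf_eq0 => /andP[/eqP a0 /eqP b0].
by apply/eqP/complex_eq.
Qed.

Lemma csqr_eq0 z : csqr z = 0 -> z = 0.
Proof. by move=> /eqP z0; apply/eqP; apply: contraTT z0; exact: csqr_neq0. Qed.

Lemma cReV z : complex.Re z^-1 = complex.Re z / csqr z.
Proof. by case: z. Qed.

Lemma cImV z : complex.Im z^-1 = - (complex.Im z / csqr z).
Proof. by case: z. Qed.

Variables (V : normedModType R) (x v : V).
Implicit Types (F G : V -> R[i]).

Lemma is_cderiveE F d e : is_cderive x v F d -> d = e -> is_cderive x v F e.
Proof. by move=> h <-. Qed.

Lemma cdrvC d : is_cderive x v (fun _ => d) 0.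
Proof. by split; exact: drvC. Qed.

Lemma cdrvD F G d e : is_cderive x v F d -> is_cderive x v G e ->
  is_cderive x v (fun y => F y + G y) (d + e).
Proof.
move=> [F1 F2] [G1 G2]; split.
  rewrite cReD (_ : (fun _ => _) = fun y => complex.Re (F y) + complex.Re (G y)).
    exact: drvD.
  by apply/funext => y; rewrite cReD.
rewrite cImD (_ : (fun _ => _) = fun y => complex.Im (F y) + complex.Im (G y)).
  exact: drvD.
by apply/funext => y; rewrite cImD.
Qed.

Lemma cdrvM F G d e : is_cderive x v F d -> is_cderive x v G e ->
  is_cderive x v (fun y => F y * G y) (d * G x + F x * e).
Proof.
move=> [F1 F2] [G1 G2]; split.
  rewrite (_ : (fun _ => _) = fun y =>
    complex.Re (F y) * complex.Re (G y) - complex.Im (F y) * complex.Im (G y)).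
    apply: is_deriveE (drvB (drvM F1 G1) (drvM F2 G2)) _.
    by clear; case: (F x) => a b; case: (G x) => a' b'; case: d => p q; case: e => p' q' /=; ring.
  by apply/funext => y; rewrite cReM.
rewrite (_ : (fun _ => _) = fun y =>
  complex.Re (F y) * complex.Im (G y) + complex.Im (F y) * complex.Re (G y)).
  apply: is_deriveE (drvD (drvM F1 G2) (drvM F2 G1)) _.
  by clear; case: (F x) => a b; case: (G x) => a' b'; case: d => p q; case: e => p' q' /=; ring.
by apply/funext => y; rewrite cImM.
Qed.

Lemma cdrvS (I : finType) (F : I -> V -> R[i]) (d : I -> R[i]) :
  (forall i, is_cderive x v (F i) (d i)) ->
  is_cderive x v (fun y => \sum_i F i y) (\sum_i d i).
Proof.
move=> h; elim: (index_enum I) => [|i r IH].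
  rewrite big_nil (_ : (fun _ => _) = fun=> 0); first exact: cdrvC.
  by apply/funext => y; rewrite big_nil.
rewrite big_cons (_ : (fun _ => _) = fun y => F i y + \sum_(j <- r) F j y).
  exact: cdrvD.
by apply/funext => y; rewrite big_cons.
Qed.

Lemma cdrvV F d : is_cderive x v F d -> F x != 0 ->
  is_cderive x v (fun y => (F y)^-1) (- (d * ((F x)^-1 * (F x)^-1))).
Proof.
move=> [F1 F2] F0; have s0 := csqr_neq0 F0.
have ds := drvD (drvX 1 F1) (drvX 1 F2); have dV := drvV ds s0.
split.
  rewrite (_ : (fun _ => _) = fun y => complex.Re (F y) * (csqr (F y))^-1).
    apply: is_deriveE (drvM F1 dV) _.
    by move: s0; rewrite /csqr; clear; case: (F x) => a b; case: d => p q /= s0; field.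
  by apply/funext => y; rewrite cReV.
rewrite (_ : (fun _ => _) = fun y => - (complex.Im (F y) * (csqr (F y))^-1)).
  apply: is_deriveE (drvN (drvM F2 dV)) _.
  by move: s0; rewrite /csqr; clear; case: (F x) => a b; case: d => p q /= s0; field.
by apply/funext => y; rewrite cImV.
Qed.

Lemma drv_Re F d e : is_cderive x v F d ->
  is_derive x v (fun y => complex.Re (e * F y)) (complex.Re (e * d)).
Proof.
move=> Fd; have [h _] := cdrvM (cdrvC e) Fd.
by apply: is_deriveE h _; rewrite mul0r add0r.
Qed.

Lemma ccC d : cts_complex x (fun _ => d).
Proof. by split; exact: cvg_cst. Qed.

Lemma ccN F : cts_complex x F -> cts_complex x (fun y => - F y).
Proof.
move=> [F1 F2]; split.
  rewrite (_ : (fun _ => _) = fun y => - complex.Re (F y)); first exact: ctsN.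
  by apply/funext => y; rewrite cReN.
rewrite (_ : (fun _ => _) = fun y => - complex.Im (F y)); first exact: ctsN.
by apply/funext => y; rewrite cImN.
Qed.

Lemma ccD F G : cts_complex x F -> cts_complex x G ->
  cts_complex x (fun y => F y + G y).
Proof.
move=> [F1 F2] [G1 G2]; split.
  rewrite (_ : (fun _ => _) = fun y => complex.Re (F y) + complex.Re (G y)).
    exact: ctsD.
  by apply/funext => y; rewrite cReD.
rewrite (_ : (fun _ => _) = fun y => complex.Im (F y) + complex.Im (G y)).
  exact: ctsD.
by apply/funext => y; rewrite cImD.
Qed.

Lemma ccM F G : cts_complex x F -> cts_complex x G ->
  cts_complex x (fun y => F y * G y).
Proof.
move=> [F1 F2] [G1 G2]; split.
  rewrite (_ : (fun _ => _) = fun y =>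
    complex.Re (F y) * complex.Re (G y) - complex.Im (F y) * complex.Im (G y)).
    have h := ctsB (ctsM F1 G1) (ctsM F2 G2); exact: h.
  by apply/funext => y; rewrite cReM.
rewrite (_ : (fun _ => _) = fun y =>
  complex.Re (F y) * complex.Im (G y) + complex.Im (F y) * complex.Re (G y)).
  have h := ctsD (ctsM F1 G2) (ctsM F2 G1); exact: h.
by apply/funext => y; rewrite cImM.
Qed.

Lemma ccS (I : finType) (F : I -> V -> R[i]) :
  (forall i, cts_complex x (F i)) -> cts_complex x (fun y => \sum_i F i y).
Proof.
move=> h; elim: (index_enum I) => [|i r IH].
  rewrite (_ : (fun _ => _) = fun=> 0); first exact: ccC.
  by apply/funext => y; rewrite big_nil.
rewrite (_ : (fun _ => _) = fun y => F i y + \sum_(j <- r) F j y).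
  exact: ccD.
by apply/funext => y; rewrite big_cons.
Qed.

Lemma ccV F : cts_complex x F -> F x != 0 -> cts_complex x (fun y => (F y)^-1).
Proof.
move=> [F1 F2] /csqr_neq0 s0.
have cs : {for x, continuous (fun y => csqr (F y))}.
  have h := ctsD (ctsX 2 F1) (ctsX 2 F2); exact: h.
have cV := ctsV cs s0.
split.
  rewrite (_ : (fun _ => _) = fun y => complex.Re (F y) * (csqr (F y))^-1).
    have h := ctsM F1 cV; exact: h.
  by apply/funext => y; rewrite cReV.
rewrite (_ : (fun _ => _) = fun y => - (complex.Im (F y) * (csqr (F y))^-1)).
  have h := ctsN (ctsM F2 cV); exact: h.
by apply/funext => y; rewrite cImV.
Qed.

Lemma cts_Re F e : cts_complex x F -> {for x, continuous (fun y => complex.Re (e * F y))}.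
Proof. by move=> cF; have [h _] := ccM (ccC e) cF; exact: h. Qed.

End ComplexCalculus.

(** * Automorphisms of the ball *)

Section Moebius.
Variables (R : realType) (n : nat).
Local Notation N := (n * 2)%N.
Variables (A : 'I_n -> 'I_n -> R[i]) (b c : 'I_n -> R[i]) (d : R[i]).
Implicit Types (x y : 'rV[R]_N) (i j k l : 'I_n) (K L a e : 'I_N).

(** Numerators of the linear-fractional map z -> (A z + b) / (c . z + d). *)
Definition mnum i x : R[i] := \sum_k A i k * r2c x 0 k + b i.
Definition mden x : R[i] := \sum_k c k * r2c x 0 k + d.
Definition mfrac i x : R[i] := mnum i x * (mden x)^-1.
Definition moebius x : 'rV[R]_N := c2r (\row_i mfrac i x).
(** The complex derivative of [mfrac i] in z_k. It is written through [mfrac] itself, and [mpart2]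
    through [mpart], so that each order follows from the previous one by the product rule. *)
Definition mpart i k x : R[i] := (A i k - mfrac i x * c k) * (mden x)^-1.
Definition mpart2 i k l x : R[i] :=
  - ((mpart i l x * c k + mpart i k x * c l) * (mden x)^-1).

Lemma r2c_moebius x i : r2c (moebius x) 0 i = mfrac i x.
Proof. by rewrite /moebius c2rK mxE. Qed.

Lemma moebius_coord x a : moebius x 0 a = complex.Re (conjc (ceps R a) * mfrac (cidx a) x).
Proof. by rewrite coord_r2c r2c_moebius. Qed.

Lemma cdrv_coord x K k :
  is_cderive x (delta_mx 0 K) (fun y => r2c y 0 k) ((cidx K == k)%:R * ceps R K).
Proof.
have E y : r2c y 0 k = y 0 (xidx k) +i* y 0 (yidx k) by rewrite mxE.
have D L : is_derive x (delta_mx 0 K) (fun y => y 0 L)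
    (complex.Re (conjc (ceps R L) * r2c (delta_mx 0 K : 'rV[R]_N) 0 (cidx L))).
  by rewrite -coord_r2c; exact: is_derive_coord.
have dE : r2c (delta_mx 0 K : 'rV[R]_N) 0 k = (cidx K == k)%:R * ceps R K.
  rewrite r2c_sum (bigD1 K)//= big1 => [|L LK].
    by rewrite mxE !eqxx addr0 mul1r.
  by rewrite mxE eqxx (negbTE LK) mul0r mulr0.
split.
  rewrite (_ : (fun _ => _) = fun y => y 0 (xidx k)); last by apply/funext => y; rewrite E.
  by apply: is_deriveE (D (xidx k)) _; rewrite !coordE conjc1 mul1r dE.
rewrite (_ : (fun _ => _) = fun y => y 0 (yidx k)); last by apply/funext => y; rewrite E.
apply: is_deriveE (D (yidx k)) _; rewrite !coordE cconj_ci dE.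
by case: ((cidx K == k)%:R * ceps R K) => u v /=; ring.
Qed.

Lemma cdrv_linear (C : 'I_n -> R[i]) (u : R[i]) x K :
  is_cderive x (delta_mx 0 K) (fun y => \sum_k C k * r2c y 0 k + u) (C (cidx K) * ceps R K).
Proof.
apply: is_cderiveE (cdrvD (cdrvS (fun k => cdrvM (cdrvC _ _ (C k)) (cdrv_coord x K k)))
  (cdrvC _ _ u)) _.
rewrite addr0 (bigD1 (cidx K))//= big1 => [|k kK].
  by rewrite eqxx mul0r add0r mul1r addr0.
by rewrite eq_sym (negbTE kK) !mul0r mulr0 addr0.
Qed.

Lemma cc_coord x k : cts_complex x (fun y => r2c y 0 k).
Proof.
split.
  rewrite (_ : (fun _ => _) = fun y => y 0 (xidx k)); first exact: coord_continuous.
  by apply/funext => y; rewrite mxE.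
rewrite (_ : (fun _ => _) = fun y => y 0 (yidx k)); first exact: coord_continuous.
by apply/funext => y; rewrite mxE.
Qed.

Lemma cc_linear (C : 'I_n -> R[i]) (u : R[i]) x :
  cts_complex x (fun y => \sum_k C k * r2c y 0 k + u).
Proof. exact: ccD (ccS (fun k => ccM (ccC _ (C k)) (cc_coord x k))) (ccC _ u). Qed.

Section NonzeroDenominator.
Variable x : 'rV[R]_N.
Hypothesis den0 : mden x != 0.

Lemma cdrv_mfrac i K :
  is_cderive x (delta_mx 0 K) (mfrac i) (ceps R K * mpart i (cidx K) x).
Proof.
apply: is_cderiveE (cdrvM (cdrv_linear (A i) (b i) x K)
  (cdrvV (cdrv_linear c d x K) den0)) _.
by rewrite /mpart /mfrac /mnum -/(mden x); ring.
Qed.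

Lemma cdrv_mpart i k L :
  is_cderive x (delta_mx 0 L) (mpart i k) (ceps R L * mpart2 i k (cidx L) x).
Proof.
have h := cdrvD (cdrvC x (delta_mx 0 L) (A i k))
  (cdrvM (cdrvC x (delta_mx 0 L) (- c k)) (cdrv_mfrac i L)).
have h2 := cdrvM h (cdrvV (cdrv_linear c d x L) den0).
rewrite (_ : mpart i k = fun y => (A i k + - c k * mfrac i y) *
    (\sum_k c k * r2c y 0 k + d)^-1); last first.
  by apply/funext => y; rewrite /mpart /mden; ring.
by apply: is_cderiveE h2 _; rewrite /mpart2 /mpart -/(mden x); ring.
Qed.

Lemma cc_den : cts_complex x (fun y => (mden y)^-1).
Proof. exact: ccV (cc_linear c d x) den0. Qed.

Lemma cc_mfrac i : cts_complex x (mfrac i).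
Proof. exact: ccM (cc_linear (A i) (b i) x) cc_den. Qed.

Lemma cc_mpart i k : cts_complex x (mpart i k).
Proof.
apply: ccM cc_den; apply: ccD (ccC _ _) _.
exact: ccN (ccM (cc_mfrac i) (ccC _ _)).
Qed.

Lemma cc_mpart2 i k l : cts_complex x (mpart2 i k l).
Proof.
apply: ccN; apply: ccM cc_den.
exact: ccD (ccM (cc_mpart _ _) (ccC _ _)) (ccM (cc_mpart _ _) (ccC _ _)).
Qed.

Lemma continuous_moebius : {for x, continuous moebius}.
Proof.
apply: (@cvg_rV R _ (nbhs x)) => a; rewrite moebius_coord.
under eq_fun do rewrite moebius_coord.
exact: cts_Re (cc_mfrac (cidx a)).
Qed.

End NonzeroDenominator.

End Moebius.

Section MoebiusInvariance.
Variables (R : realType) (n : nat).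
Local Notation N := (n * 2)%N.
Implicit Types (x y : 'rV[R]_N) (i j k l : 'I_n) (K L a e : 'I_N).

Definition met x K L : R :=
  (K == L)%:R - x 0 K * x 0 L - tau (Jmx R n) x K * tau (Jmx R n) x L.

(* In these terms met x K L = Re (conj (ceps K) * ceps L * hform x i j): a real
   symmetric form is determined by its contractions with ceps K * ceps L and with
   ceps K * conj (ceps L), which is how its covariance is proved. *)
Definition hform x i j : R[i] := (i == j)%:R - r2c x 0 i * conjc (r2c x 0 j).

Let cRN (r : R) : (- r)%:C = - (r%:C).
Proof. by apply: complex_eq; rewrite //= oppr0. Qed.

Let cR2 : (2 : R)%:C = 2.
Proof. by rewrite (rmorph_nat (real_complex R)). Qed.

Let met_xx x i j : met x (xidx i) (xidx j) = complex.Re (hform x i j).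
Proof. by rewrite /met metricE !coordE conjc1 !mul1r. Qed.

Let met_yy x i j : met x (yidx i) (yidx j) = complex.Re (hform x i j).
Proof. by rewrite /met metricE !coordE cconj_ci mulNr ci_sqr opprK mul1r. Qed.

Let met_xy x i j : met x (xidx i) (yidx j) = - complex.Im (hform x i j).
Proof.
rewrite /met metricE !coordE conjc1 mul1r -/(hform x i j).
by case: (hform x i j) => u v /=; ring.
Qed.

Let met_yx x i j : met x (yidx i) (xidx j) = complex.Im (hform x i j).
Proof.
rewrite /met metricE !coordE cconj_ci mulr1 -/(hform x i j).
by case: (hform x i j) => u v /=; ring.
Qed.

(** Multiplying both basis vectors by i preserves the form but changes the sign of ceps K * ceps L,
    so the four terms over each pair of complex indices cancel. *)
Lemma contract_holomorphic x (Q : 'I_n -> 'I_n -> R[i]) :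
  \sum_K \sum_L (met x K L)%:C * (ceps R K * ceps R L * Q (cidx K) (cidx L)) = 0.
Proof.
rewrite sum_coord2 big1// => i _; rewrite big1// => j _.
rewrite met_xx met_yy met_xy met_yx !coordE ci_sqr.
rewrite !mul1r mulr1 cRN.
by move: (complex.Re _)%:C (complex.Im _)%:C (Q i j) ci => z w q r; ring.
Qed.

Lemma contract_hermitian x (Q : 'I_n -> 'I_n -> R[i]) :
  \sum_K \sum_L (met x K L)%:C * (ceps R K * conjc (ceps R L) * Q (cidx K) (cidx L))
  = \sum_i \sum_j (2 : R)%:C * (hform x i j * Q i j).
Proof.
rewrite sum_coord2; apply: eq_bigr => i _; apply: eq_bigr => j _.
rewrite met_xx met_yy met_xy met_yx !coordE conjc1.
have -> : ci * conjc ci = 1 :> R[i] by rewrite cconj_ci mulrN ci_sqr opprK.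
rewrite cconj_ci.
have E : hform x i j = (complex.Re (hform x i j))%:C + ci * (complex.Im (hform x i j))%:C.
  by rewrite {1}[hform x i j]complexE.
rewrite {5}E cRN.
move: (complex.Re _)%:C (complex.Im _)%:C => z w; rewrite cR2.
by move: (Q i j) ci => q r; ring.
Qed.

Variables (A : 'I_n -> 'I_n -> R[i]) (b c : 'I_n -> R[i]) (d : R[i]).
(** The first three conditions say that the block matrix M with rows (A b) and (c d) satisfies M I
    M^* = I for I = diag(1, ..., 1, -1). The last one says that M preserves the form of signature
    (n, 1) on vectors (z, 1); it keeps the ball invariant, while the others give the covariance of
    [hform]. *)
Hypothesis hAA : forall i j,
  \sum_k A i k * conjc (A j k) - b i * conjc (b j) = (i == j)%:R.
Hypothesis hAc : forall i, \sum_k A i k * conjc (c k) = b i * conjc d.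
Hypothesis hcc : \sum_k c k * conjc (c k) = d * conjc d - 1.
Hypothesis hball : forall x,
  \sum_i csqr (mnum A b i x) - csqr (mden c d x) = sqn x - 1.

Local Notation den := (mden c d).
Local Notation frac := (mfrac A b c d).
Local Notation part := (mpart A b c d).
Local Notation part2 := (mpart2 A b c d).
Local Notation Phi := (moebius A b c d).

Lemma den_gt0 x : sqn x < 1 -> 0 < csqr (den x).
Proof.
move=> x1; have S0 : 0 <= \sum_i csqr (mnum A b i x).
  by apply: sumr_ge0 => i _; exact: csqr_ge0.
by have := hball x; lra.
Qed.

Lemma den_neq0 x : sqn x < 1 -> den x != 0.
Proof.
move=> /den_gt0 d0; apply: contraTneq d0 => ->.
by rewrite /csqr/= expr0n/= addr0 ltxx.
Qed.

Lemma csqrV (z : R[i]) : csqr z^-1 = (csqr z)^-1.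
Proof.
have [->|z0] := eqVneq z 0; first by rewrite invr0 /csqr/= expr0n/= addr0 invr0.
have s0 := csqr_neq0 z0.
apply: (mulfI s0); rewrite -csqrM divff// divff//.
by rewrite /csqr/= expr1n expr0n/= addr0.
Qed.

Lemma sqn_moebius x : sqn x < 1 -> sqn (Phi x) < 1.
Proof.
move=> x1; have d0 := den_gt0 x1.
have -> : sqn (Phi x) = (\sum_i csqr (mnum A b i x)) / csqr (den x).
  rewrite /sqn sum_coord mulr_suml; apply: eq_bigr => i _.
  rewrite !moebius_coord !coordE conjc1 cconj_ci -csqrV -csqrM /mfrac.
  by case: (mnum A b i x / den x) => u v; rewrite /csqr/=; ring.
by rewrite ltr_pdivrMr// mul1r; have := hball x; lra.
Qed.

Let comb i k x : R[i] := A i k - frac i x * c k.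

Let comb_coord i x : den x != 0 ->
  \sum_k comb i k x * r2c x 0 k = frac i x * d - b i.
Proof.
move=> d0; have E : frac i x * den x = mnum A b i x by rewrite /mfrac divfK.
under eq_bigr do rewrite /comb mulrBl -mulrA.
rewrite sumrB -mulr_sumr.
have -> : \sum_k A i k * r2c x 0 k = mnum A b i x - b i by rewrite /mnum addrK.
have -> : \sum_k c k * r2c x 0 k = den x - d by rewrite /mden addrK.
by rewrite mulrBr E; ring.
Qed.

Let comb_comb i j x : \sum_k comb i k x * conjc (comb j k x) =
  (i == j)%:R + b i * conjc (b j) - frac i x * (d * conjc (b j))
  - conjc (frac j x) * (b i * conjc d)
  + frac i x * conjc (frac j x) * (d * conjc d - 1).
Proof.
have E k : comb i k x * conjc (comb j k x) = A i k * conjc (A j k)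
    - frac i x * conjc (A j k * conjc (c k)) - conjc (frac j x) * (A i k * conjc (c k))
    + frac i x * conjc (frac j x) * (c k * conjc (c k)).
  by rewrite /comb cconjD cconjN !cconjM cconjK; ring.
under eq_bigr do rewrite E.
rewrite big_split/= !sumrB -!mulr_sumr hcc hAc -cconj_sum hAc cconjM cconjK.
by rewrite -(hAA i j); ring.
Qed.

(** Up to the factor 1 / den, [part] is [comb]. The relations for A A^*, A c^* and c c^* evaluate
    the sum of comb times its conjugate; subtracting the product of the two values given by
    [comb_coord] leaves delta_ij - frac i * conj (frac j). *)
Lemma hform_part i j x : den x != 0 ->
  \sum_k \sum_l hform x k l * (part i k x * conjc (part j l x)) =
  hform (Phi x) i j * ((csqr (den x))^-1)%:C.
Proof.
move=> d0.
have E k l : hform x k l * (part i k x * conjc (part j l x)) =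
    ((k == l)%:R * (comb i k x * conjc (comb j l x))
     - (comb i k x * r2c x 0 k) * conjc (comb j l x * r2c x 0 l))
    * ((csqr (den x))^-1)%:C.
  rewrite -csqrV -csqrE /hform /mpart -/(comb i k x) -/(comb j l x) !cconjM; ring.
under eq_bigr do under eq_bigr do rewrite E.
under eq_bigr do rewrite -mulr_suml sumrB -mulr_sumr -cconj_sum comb_coord//.
rewrite -mulr_suml sumrB -mulr_suml comb_coord//.
have -> : \sum_k \sum_l (k == l)%:R * (comb i k x * conjc (comb j l x))
    = \sum_k comb i k x * conjc (comb j k x).
  apply: eq_bigr => k _; rewrite (bigD1 k)//= big1 => [|l lk].
    by rewrite eqxx mul1r addr0.
  by rewrite eq_sym (negbTE lk) mul0r.
rewrite comb_comb /hform !r2c_moebius cconjD cconjN !cconjM; ring.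
Qed.

Definition dmoebius K a x : R := complex.Re (conjc (ceps R a) * ceps R K * part (cidx a) (cidx K) x).
Definition d2moebius K L a x : R :=
  complex.Re (conjc (ceps R a) * ceps R K * (ceps R L * part2 (cidx a) (cidx K) (cidx L) x)).

(** The map is holomorphic, so its second derivatives only meet the contraction that vanishes. *)
Lemma met_d2moebius x a : \sum_K \sum_L met x K L * d2moebius K L a x = 0.
Proof.
have := contract_holomorphic x (fun k l => conjc (ceps R a) * part2 (cidx a) k l x).
move=> /(congr1 (@complex.Re R)); rewrite cRe_sum/= => H; rewrite -[RHS]H.
apply: eq_bigr => K _; rewrite cRe_sum; apply: eq_bigr => L _.
by rewrite cReZ; congr (_ * complex.Re _); ring.
Qed.

(** By Re z Re w = Re (z w + z conj w) / 2, the sum splits into a holomorphic contraction, which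
    vanishes, and a Hermitian one, which [hform_part] evaluates. *)
Lemma met_dmoebius x a e : den x != 0 ->
  \sum_K \sum_L met x K L * (dmoebius K a x * dmoebius L e x) =
  (csqr (den x))^-1 * met (Phi x) a e.
Proof.
move=> d0; set ea := conjc (ceps R a); set ee := conjc (ceps R e).
pose P k l := part (cidx a) k x * part (cidx e) l x.
pose Q k l := part (cidx a) k x * conjc (part (cidx e) l x).
have H1 := contract_holomorphic x (fun k l => ea * ee * P k l).
have H2 := contract_hermitian x (fun k l => ea * conjc ee * Q k l).
have H3 : \sum_i \sum_j (2 : R)%:C * (hform x i j * (ea * conjc ee * Q i j))
    = (2 : R)%:C * (ea * conjc ee) * (hform (Phi x) (cidx a) (cidx e) * ((csqr (den x))^-1)%:C).
  rewrite -hform_part// mulr_sumr; apply: eq_bigr => i _.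
  rewrite mulr_sumr; apply: eq_bigr => j _; rewrite /Q; ring.
have H4 : \sum_K \sum_L met x K L * (dmoebius K a x * dmoebius L e x)
    = (complex.Re (\sum_K \sum_L (met x K L)%:C * (ceps R K * ceps R L * (ea * ee * P (cidx K) (cidx L))))
    + complex.Re (\sum_K \sum_L (met x K L)%:C * (ceps R K * conjc (ceps R L)
        * (ea * conjc ee * Q (cidx K) (cidx L))))) / 2.
  rewrite !cRe_sum -big_split mulr_suml; apply: eq_bigr => K _.
  rewrite !cRe_sum -big_split mulr_suml; apply: eq_bigr => L _.
  rewrite /= !cReZ -mulrDr -mulrA; congr (_ * _).
  rewrite /dmoebius cRe_prod -cReD; congr (complex.Re _ / 2).
  by rewrite /P /Q /ea /ee !cconjM !cconjK; ring.
rewrite H4 H1 H2 H3 add0r /met metricE -/(hform (Phi x) (cidx a) (cidx e)).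
rewrite /ee cconjK -/ea; case: (ea * _) => u v; case: (hform _ _ _) => s t.
by rewrite /=; field; exact: csqr_neq0.
Qed.

Variables (f : 'rV[R]_N -> R) (f1 : 'I_N -> 'rV[R]_N -> R)
  (f2 : 'I_N -> 'I_N -> 'rV[R]_N -> R).
Hypothesis harm : harmonic_data (Jmx R n) f f1 f2.

Definition moebius_d1 K x : R := \sum_a dmoebius K a x * f1 a (Phi x).
Definition moebius_d2 K L x : R := \sum_a (d2moebius K L a x * f1 a (Phi x)
  + dmoebius K a x * \sum_e dmoebius L e x * f2 a e (Phi x)).

(** By the chain rule the operator applied to the composition has a part with first derivatives of
    [f], zero by [met_d2moebius], and a part with second derivatives, which is |den|^(-2) times the
    operator applied to [f] at the image point. *)
Lemma harmonic_moebius :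
  harmonic_data (Jmx R n) (fun x => f (Phi x)) moebius_d1 moebius_d2.
Proof.
move=> x x1; have d0 := den_neq0 x1; have P1 := sqn_moebius x1.
have nP := open_ball_sqn P1.
have [cf df dff Lf] := harm P1.
have cPhi : {for x, continuous Phi} := @continuous_moebius R n A b c d x d0.
have dPhi K a : is_derive x (delta_mx 0 K) (fun y => Phi y 0 a) (dmoebius K a x).
  rewrite (_ : (fun y => Phi y 0 a) = fun y => complex.Re (conjc (ceps R a) * frac (cidx a) y)).
    apply: is_deriveE (drv_Re (conjc (ceps R a)) (cdrv_mfrac A b d0 (cidx a) K)) _.
    by rewrite mulrA.
  by apply/funext => y; rewrite moebius_coord.
have ddPhi K L a : is_derive x (delta_mx 0 L) (dmoebius K a) (d2moebius K L a x).
  exact: drv_Re (cdrv_mpart A b d0 (cidx a) (cidx K) L).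
have cdPhi K a : {for x, continuous (dmoebius K a)}.
  exact: cts_Re (cc_mpart A b d0 (cidx a) (cidx K)).
have cddPhi K L a : {for x, continuous (d2moebius K L a)}.
  have h := cts_Re (e := conjc (ceps R a) * ceps R K)
    (ccM (ccC x (ceps R L)) (cc_mpart2 A b d0 (cidx a) (cidx K) (cidx L))).
  exact: h.
have cf1 a : {for x, continuous (fun y => f1 a (Phi y))}.
  exact: cts_comp (df a).2 cPhi.
have cf2 a e : {for x, continuous (fun y => f2 a e (Phi y))}.
  exact: cts_comp (dff a e).2 cPhi.
split.
- exact: cts_comp cf cPhi.
- move=> K; split; last first.
    by apply: ctsS => a; have h := ctsM (cdPhi K a) (cf1 a); exact: h.
  apply: chain_derive (dPhi K) => [|a]; last exact: (df a).2.
  by apply: filterS nP => y y1 a; have [_ h _ _] := harm y1; exact: (h a).1.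
- move=> K L; split; last first.
    apply: ctsS => a.
    have cs : {for x, continuous (fun y => \sum_e dmoebius L e y * f2 a e (Phi y))}.
      by apply: ctsS => e; have h := ctsM (cdPhi L e) (cf2 a e); exact: h.
    have h := ctsD (ctsM (cddPhi K L a) (cf1 a)) (ctsM (cdPhi K a) cs); exact: h.
  apply: drvS => a; apply: drvM (ddPhi K L a) _.
  apply: chain_derive (dPhi L) => [|e]; last exact: (dff a e).2.
  by apply: filterS nP => y y1 e; have [_ _ h _] := harm y1; exact: (h a e).1.
have -> : \sum_K \sum_L ((K == L)%:R - x 0 K * x 0 L
    - tau (Jmx R n) x K * tau (Jmx R n) x L) * moebius_d2 K L x
  = \sum_a f1 a (Phi x) * (\sum_K \sum_L met x K L * d2moebius K L a x)
  + \sum_a \sum_e f2 a e (Phi x) *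
      (\sum_K \sum_L met x K L * (dmoebius K a x * dmoebius L e x)).
  rewrite (eq_bigr (fun K => \sum_a \sum_L (f1 a (Phi x) * (met x K L * d2moebius K L a x)
      + \sum_e f2 a e (Phi x) * (met x K L * (dmoebius K a x * dmoebius L e x))))).
    rewrite exchange_big -big_split; apply: eq_bigr => a _ /=.
    under eq_bigr do rewrite big_split/= -mulr_sumr.
    rewrite big_split/= -mulr_sumr; congr (_ + _).
    under eq_bigr do rewrite exchange_big/=.
    rewrite exchange_big/=; apply: eq_bigr => e _.
    by rewrite mulr_sumr; apply: eq_bigr => K _; rewrite mulr_sumr.
  move=> K _; rewrite exchange_big/=; apply: eq_bigr => L _.
  rewrite /moebius_d2 mulr_sumr; apply: eq_bigr => a _.
  rewrite mulrDr -/(met x K L); congr (_ + _); first by ring.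
  by rewrite !mulr_sumr; apply: eq_bigr => e _; ring.
rewrite big1 => [|a _]; last by rewrite met_d2moebius mulr0.
rewrite add0r -[RHS](mulr0 (csqr (den x))^-1) -[X in _ = _ * X]Lf mulr_sumr.
apply: eq_bigr => a _; rewrite mulr_sumr; apply: eq_bigr => e _.
by rewrite met_dmoebius// mulrC mulrA.
Qed.

End MoebiusInvariance.

Section RankOne.
Variables (R : realType) (n : nat).
Variables (theta : R[i]) (mu : R) (p : 'I_n -> R[i]).
Hypothesis theta1 : csqr theta = 1.
Implicit Types (w : 'I_n -> R[i]) (i j k : 'I_n).

(* With p = (first basis vector) + alpha z this is a Householder reflection, up
   to a phase; with p = z it is the linear part of the automorphism 0 |-> z. *)
Definition rank_one i k : R[i] := theta * ((i == k)%:R + mu%:C * (p i * conjc (p k))).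

Definition cdot w : R[i] := \sum_k conjc (p k) * w k.

Let S : R := \sum_k csqr (p k).

Lemma rank_one_mul w i :
  \sum_k rank_one i k * w k = theta * (w i + mu%:C * cdot w * p i).
Proof.
have E k : rank_one i k * w k =
    theta * ((i == k)%:R * w k) + theta * mu%:C * p i * (conjc (p k) * w k).
  by rewrite /rank_one; ring.
under eq_bigr do rewrite E.
rewrite big_split/= -!mulr_sumr (bigD1 i)//= big1 => [|k ki].
  by rewrite eqxx mul1r addr0 /cdot; ring.
by rewrite eq_sym (negbTE ki) mul0r.
Qed.

Lemma sum_csqrC w : \sum_k w k * conjc (w k) = (\sum_k csqr (w k))%:C.
Proof. by rewrite (rmorph_sum (real_complex R)); apply: eq_bigr => k _; rewrite csqrE. Qed.

(** The coefficient 2 mu + mu^2 S governs both uses: it is 0 for the reflection, which is therefore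
    unitary, and 1 / (1 - |z|^2) for the automorphism 0 |-> z. *)
Lemma rank_one_rank_one i j :
  \sum_k rank_one i k * conjc (rank_one j k) =
  (i == j)%:R + (2 * mu + mu ^+ 2 * S)%:C * (p i * conjc (p j)).
Proof.
have tt : theta * conjc theta = 1 by rewrite csqrE theta1.
have cj k : conjc (rank_one j k) =
    conjc theta * ((j == k)%:R + mu%:C * (conjc (p j) * p k)).
  by rewrite /rank_one cconjM cconjD !cconjM cconj_bool conjc_real cconjK.
under eq_bigr do rewrite cj.
rewrite rank_one_mul.
have -> : cdot (fun k => conjc theta * ((j == k)%:R + mu%:C * (conjc (p j) * p k)))
    = conjc theta * (conjc (p j) + mu%:C * conjc (p j) * S%:C).
  rewrite -sum_csqrC /cdot.
  under eq_bigr do rewrite mulrDr mulrDr.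
  rewrite big_split/= (bigD1 j)//= big1 => [|k kj]; last first.
    by rewrite eq_sym (negbTE kj) !mulr0.
  rewrite eqxx addr0 mulr1 mulrDr [conjc (p j) * _]mulrC; congr (_ + _).
  by rewrite !mulr_sumr; apply: eq_bigr => k _; ring.
have -> : (2 * mu + mu ^+ 2 * S)%:C = 2 * mu%:C + mu%:C * mu%:C * S%:C :> R[i].
  by apply: complex_eq; rewrite /=; ring.
rewrite (eq_sym j i).
transitivity (theta * conjc theta *
  ((i == j)%:R + (2 * mu%:C + mu%:C * mu%:C * S%:C) * (p i * conjc (p j)))).
  by move: (mu%:C) (S%:C) => m s; ring.
by rewrite tt mul1r.
Qed.

Lemma csqr_sum_line w (beta : R[i]) :
  \sum_i csqr (theta * (w i + beta * p i)) =
  \sum_i csqr (w i) + 2 * complex.Re (conjc beta * cdot w) + csqr beta * S.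
Proof.
have E i : csqr (theta * (w i + beta * p i)) =
    csqr (w i) + 2 * complex.Re (conjc beta * (conjc (p i) * w i)) + csqr beta * csqr (p i).
  rewrite csqrM theta1 mul1r; case: (w i) => a b; case: beta => c d.
  by case: (p i) => u v; rewrite /csqr/=; ring.
under eq_bigr do rewrite E.
by rewrite !big_split/= -!mulr_sumr -cRe_sum -mulr_sumr.
Qed.

End RankOne.

(** * All directions at the origin *)

Section DirectionalBound.
Variables (R : realType) (n' : nat).
Local Notation n := n'.+1.
Local Notation N := (n * 2)%N.
Implicit Types (w x : 'rV[R]_N).

Lemma sqn_csqr x : sqn x = \sum_i csqr (r2c x 0 i).
Proof. by rewrite /sqn sum_coord; apply: eq_bigr => i _; rewrite mxE /csqr. Qed.

(** Cauchy-Schwarz, from |w - (t / S) p|^2 >= 0 with t = [cdot p w]. *)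
Lemma cdot_le (p w : 'I_n -> R[i]) :
  csqr (cdot p w) <= (\sum_i csqr (p i)) * (\sum_i csqr (w i)).
Proof.
have one : csqr (1 : R[i]) = 1 by rewrite /csqr/= expr1n expr0n/= addr0.
set S := \sum_i csqr (p i).
have S0 : 0 <= S by apply: sumr_ge0 => i _; exact: csqr_ge0.
have [SE|Sn] := eqVneq S 0.
  rewrite SE mul0r /cdot big1 => [|i _]; first by rewrite /csqr/= expr0n/= addr0.
  have pi0 : csqr (p i) = 0.
    apply/eqP; move: SE => /eqP; rewrite psumr_eq0 => [/allP/(_ i)|j _]; last exact: csqr_ge0.
    by rewrite mem_index_enum => /(_ isT).
  by rewrite (csqr_eq0 pi0) conjc0 mul0r.
have Sp : 0 < S by rewrite lt_neqAle eq_sym Sn.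
have := csqr_sum_line p one w (- (cdot p w * (S^-1)%:C)).
rewrite -/S; set W := \sum_i csqr (w i); set t := cdot p w.
have -> : 2 * complex.Re (conjc (- (t * (S^-1)%:C)) * t) = - (2 * csqr t / S).
  by case: t => a b; rewrite /csqr/=; field.
have -> : csqr (- (t * (S^-1)%:C)) * S = csqr t / S.
  by case: t => a b; rewrite /csqr/=; field.
move=> E.
have : 0 <= W - csqr t / S.
  have -> : W - csqr t / S = W + - (2 * csqr t / S) + csqr t / S.
    by rewrite -mulrA; ring.
  by rewrite -E; apply: sumr_ge0 => i _; exact: csqr_ge0.
by rewrite subr_ge0 ler_pdivrMr// mulrC.
Qed.

Variables (f : 'rV[R]_N -> R) (f1 : 'I_N -> 'rV[R]_N -> R)
  (f2 : 'I_N -> 'I_N -> 'rV[R]_N -> R).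

Definition gamma_ratio : R :=
  2 * Gamma (n%:R + 1) / (Num.sqrt pi * Gamma (n%:R + 2^-1)).

Let NE : N%:R = 2 * n%:R :> R. Proof. by rewrite natrM mulrC. Qed.

Let r2c0 i : r2c (0 : 'rV[R]_N) 0 i = 0.
Proof. by rewrite mxE !mxE. Qed.

(** Composing [f] with a unitary map that sends the first basis vector to [w] reduces the claim to
    [gradient_at_zero]. *)
Let unit_direction (harm : harmonic_data (Jmx R n) f f1 f2)
    (f_le1 : forall x, sqn x < 1 -> `|f x| <= 1) w :
  sqn w = 1 -> `|\sum_K w 0 K * f1 K 0| <= gamma_ratio.
Proof.
move=> w1; pose i0 : 'I_n := ord0.
pose z i := r2c w 0 i.
have z1 : \sum_i csqr (z i) = 1 by rewrite -sqn_csqr.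
pose r : R := Num.sqrt (csqr (z i0)).
have r0 : 0 <= r by exact: sqrtr_ge0.
have rr : r ^+ 2 = csqr (z i0) by rewrite sqr_sqrtr// csqr_ge0.
(* The phase [alpha] makes alpha z_0 nonnegative, so that p_0 = 1 + r is never 0 and |p|^2 = 2 (1 +
   r). *)
have [alpha alpha1 az] : exists2 alpha : R[i], csqr alpha = 1 & alpha * z i0 = r%:C.
  have [z0|z0] := eqVneq (z i0) 0.
    exists 1; first by rewrite /csqr/= expr1n expr0n/= addr0.
    by rewrite /r z0 mulr0 /csqr/= expr0n/= addr0 sqrtr0.
  have rn : r != 0 by rewrite -sqrf_eq0 rr csqr_neq0.
  exists (conjc (z i0) * (r^-1)%:C).
    rewrite csqrM (_ : csqr (conjc _) = csqr (z i0)); last first.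
      by case: (z i0) => a b; rewrite /csqr/=; ring.
    by rewrite -rr /csqr/=; field.
  by rewrite mulrAC [conjc _ * _]mulrC csqrE -rr; apply: complex_eq; rewrite /=; field.
have r1 : 1 + r != 0 by rewrite gt_eqF// ltr_wpDr.
pose theta := - conjc alpha.
have theta1 : csqr theta = 1.
  by rewrite -[RHS]alpha1 /theta; case: (alpha) => a b; rewrite /csqr/=; ring.
pose p i := (i == i0)%:R + alpha * z i.
(* The Householder coefficient -2 / |p|^2. As mu conj (p_0) = -1, the first column of [A] is theta
   (e_0 - p) = - theta alpha z = z. *)
pose mu := - (1 + r)^-1.
have S2 : \sum_i csqr (p i) = 2 * (1 + r).
  have E i : csqr (p i) = (i == i0)%:R + 2 * ((i == i0)%:R * r) + csqr (z i).
    have -> : csqr (z i) = csqr (alpha * z i) by rewrite csqrM alpha1 mul1r.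
    rewrite /p.
    have [->|_] := eqVneq i i0; last first.
      by case: (alpha * z i) => a b; rewrite /csqr/=; ring.
    by rewrite az /csqr/=; ring.
  under eq_bigr do rewrite E.
  have d1 : \sum_(i < n) (i == i0)%:R = 1 :> R.
    by rewrite (bigD1 i0)// eqxx big1 => [|k /negbTE->//]; rewrite /= addr0.
  rewrite 2!big_split -mulr_sumr -mulr_suml d1 [X in _ + X = _]z1 /=.
  by ring.
have mu2 : 2 * mu + mu ^+ 2 * \sum_i csqr (p i) = 0 by rewrite S2 /mu; field.
pose A := rank_one theta mu p.
pose o (i : 'I_n) : R[i] := 0.
have hAA i j : \sum_k A i k * conjc (A j k) - o i * conjc (o j) = (i == j)%:R.
  by rewrite rank_one_rank_one// mu2 mul0r addr0 mul0r subr0.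
have hAc i : \sum_k A i k * conjc (o k) = o i * conjc 1.
  by rewrite /o mul0r big1// => k _; rewrite conjc0 mulr0.
have hcc : \sum_k o k * conjc (o k) = 1 * conjc 1 - 1 :> R[i].
  by rewrite conjc1 mulr1 subrr big1// => k _; rewrite mul0r.
have denE x : mden o 1 x = 1.
  by rewrite /mden big1 ?add0r// => k _; rewrite mul0r.
have hball x : \sum_i csqr (mnum A o i x) - csqr (mden o 1 x) = sqn x - 1.
  rewrite denE; congr (_ - _); last by rewrite /csqr/= expr1n expr0n/= addr0.
  rewrite sqn_csqr; under eq_bigr do rewrite /mnum addr0 rank_one_mul.
  rewrite csqr_sum_line//; set t := cdot p _.
  rewrite -addrA (_ : 2 * _ + _ = csqr t * (2 * mu + mu ^+ 2 * \sum_i csqr (p i))).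
    by rewrite mu2 mulr0 addr0.
  by case: t => a b; rewrite /csqr/=; ring.
have fracE i : mfrac A o o 1 i 0 = 0.
  rewrite /mfrac /mnum big1 ?addr0 ?mul0r// => k _.
  by rewrite r2c0 mulr0.
have Phi0 : moebius A o o 1 0 = 0.
  by apply/rowP => a; rewrite moebius_coord fracE mulr0 mxE.
have col i : A i i0 = z i.
  rewrite /A /rank_one {2}/p eqxx az.
  have -> : conjc (true%:R + r%:C) = (1 + r)%:C by apply: complex_eq; rewrite /=; ring.
  have -> : mu%:C * (p i * (1 + r)%:C) = - p i.
    rewrite mulrCA -(rmorphM (real_complex R)) /mu mulNr mulVf//.
    by case: (p i) => a b; apply: complex_eq; rewrite /=; ring.
  rewrite /p opprD addrA subrr sub0r /theta mulrNN mulrA [conjc _ * _]mulrC csqrE alpha1.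
  by rewrite mul1r.
have harmU := harmonic_moebius hAA hAc hcc hball harm.
have bU x : sqn x < 1 -> `|f (moebius A o o 1 x)| <= 1.
  by move=> x1; apply: f_le1; exact: sqn_moebius hball x x1.
have := gradient_at_zero (Jmx_skew R n) (Jmx_sqr R n) NE harmU bU (xidx i0).
have -> : moebius_d1 A o o 1 f1 (xidx i0) 0 = \sum_K w 0 K * f1 K 0.
  apply: eq_bigr => a _; rewrite Phi0; congr (_ * _).
  rewrite /dmoebius /mpart fracE mul0r subr0 denE invr1 mulr1 !coordE mulr1 col.
  by rewrite -coord_r2c.
rewrite /gamma_ratio ler_pdivlMr; first by rewrite mulrC.
rewrite mulr_gt0 ?sqrtr_gt0 ?pi_gt0// Gamma_gt0//.
by rewrite ler_wpDr// ?invr_ge0// ler1n.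
Qed.

Lemma direction_at_zero (harm : harmonic_data (Jmx R n) f f1 f2)
    (f_le1 : forall x, sqn x < 1 -> `|f x| <= 1) w :
  `|\sum_K w 0 K * f1 K 0| <= gamma_ratio * Num.sqrt (sqn w).
Proof.
have [w0|wn] := eqVneq (sqn w) 0.
  rewrite w0 sqrtr0 mulr0 big1 ?normr0// => K _.
  suff -> : w 0 K = 0 by rewrite mul0r.
  apply/eqP; rewrite -sqrf_eq0; move/eqP: w0.
  rewrite psumr_eq0 => [/allP/(_ K)|j _]; last exact: sqr_ge0.
  by rewrite mem_index_enum => /(_ isT).
set L := Num.sqrt (sqn w).
have L0 : 0 < L by rewrite sqrtr_gt0 lt_neqAle eq_sym wn sqn_ge0.
have LL : L ^+ 2 = sqn w by rewrite sqr_sqrtr// sqn_ge0.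
have u1 : sqn (L^-1 *: w) = 1.
  rewrite /sqn; under eq_bigr do rewrite mxE exprMn.
  by rewrite -mulr_sumr -/(sqn w) -LL exprVn mulVf// sqrf_eq0 gt_eqF.
have := unit_direction harm f_le1 u1.
have -> : \sum_K (L^-1 *: w) 0 K * f1 K 0 = L^-1 * \sum_K w 0 K * f1 K 0.
  by rewrite mulr_sumr; apply: eq_bigr => K _; rewrite mxE mulrA.
by rewrite normrM gtr0_norm ?invr_gt0// mulrC ler_pdivrMr.
Qed.

End DirectionalBound.

(** * Arbitrary points of the ball *)

Section PointwiseBound.
Variables (R : realType) (n' : nat).
Local Notation n := n'.+1.
Local Notation N := (n * 2)%N.
Variables (f : 'rV[R]_N -> R) (f1 : 'I_N -> 'rV[R]_N -> R)
  (f2 : 'I_N -> 'I_N -> 'rV[R]_N -> R).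

Lemma gamma_ratio_ge0 : 0 <= gamma_ratio R n'.
Proof.
have G (e : R) : 0 <= e -> 0 < Gamma (n%:R + e).
  by move=> e0; rewrite Gamma_gt0// ler_wpDr// ler1n.
by rewrite /gamma_ratio divr_ge0 ?mulr_ge0 ?sqrtr_ge0// ltW// G.
Qed.

(** The differential at 0 of the automorphism 0 |-> x0 has inverse g A, and |g A v|^2 = g^2 (|v|^2 +
    g^2 |T|^2) <= g^4 |v|^2 by Cauchy-Schwarz for T = <v, z>, as 1 + g^2 s = g^2. *)
Lemma direction_bound (harm : harmonic_data (Jmx R n) f f1 f2)
    (f_le1 : forall x, sqn x < 1 -> `|f x| <= 1) (x0 v : 'rV[R]_N) : sqn x0 < 1 ->
  `|\sum_K v 0 K * f1 K x0| <= gamma_ratio R n' * ((1 - sqn x0)^-1 * Num.sqrt (sqn v)).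
Proof.
move=> x01; have one : csqr (1 : R[i]) = 1 by rewrite /csqr/= expr1n expr0n/= addr0.
pose z i := r2c x0 0 i; pose s := sqn x0.
have zs : \sum_i csqr (z i) = s by rewrite /s sqn_csqr.
have s1 : 0 < 1 - s by rewrite subr_gt0.
pose g : R := (Num.sqrt (1 - s))^-1.
have g0 : 0 < g by rewrite invr_gt0 sqrtr_gt0.
have gg : g ^+ 2 = (1 - s)^-1 by rewrite exprVn sqr_sqrtr// ltW.
have gs : g ^+ 2 * s = g ^+ 2 - 1 by rewrite gg; field; rewrite gt_eqF.
have g1 : 1 + g != 0 by rewrite gt_eqF// addr_gt0.
have gn : g != 0 by rewrite gt_eqF.
(* The blocks A = 1 + k z z^*, b = g z, c = g z^* and d = g form a boost of signature (n, 1). The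
   value of k comes from A z = g z, that is k s = g - 1, and yields A^2 = 1 + g^2 z z^*. *)
pose k : R := g ^+ 2 / (1 + g).
have ks : k * s = g - 1.
  by rewrite /k mulrAC gs; field.
have k2 : 2 * k + k ^+ 2 * s = g ^+ 2.
  have -> : k ^+ 2 * s = k * (k * s) by ring.
  by rewrite ks /k; field.
pose A := rank_one 1 k z.
pose b i := g%:C * z i; pose c i := g%:C * conjc (z i).
have cg : conjc g%:C = g%:C by rewrite conjc_real.
have sC : \sum_i z i * conjc (z i) = s%:C by rewrite sum_csqrC zs.
have hAA i j : \sum_l A i l * conjc (A j l) - b i * conjc (b j) = (i == j)%:R.
  rewrite rank_one_rank_one// zs k2 /b cconjM cg.
  have -> : (g ^+ 2)%:C = g%:C * g%:C by rewrite -(rmorphM (real_complex R)).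
  by ring.
have hAc i : \sum_l A i l * conjc (c l) = b i * conjc g%:C.
  rewrite rank_one_mul /b /c cg mul1r.
  under eq_fun do rewrite cconjM cconjK cg.
  have -> : cdot z (fun l => g%:C * z l) = g%:C * s%:C.
    by rewrite -sC mulr_sumr; apply: eq_bigr => l _; ring.
  have -> : k%:C * (g%:C * s%:C) = g%:C * (g%:C - 1).
    have -> : g%:C - 1 = (g - 1)%:C by apply: complex_eq; rewrite /=; ring.
    by rewrite -ks; apply: complex_eq; rewrite /=; ring.
  by rewrite cconjM cconjK cg; ring.
have hcc : \sum_l c l * conjc (c l) = g%:C * conjc g%:C - 1.
  have E l : c l * conjc (c l) = g%:C * g%:C * (z l * conjc (z l)).
    by rewrite /c cconjM cconjK cg; ring.
  under eq_bigr do rewrite E.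
  rewrite -mulr_sumr sC cg.
  have -> : g%:C * g%:C * s%:C = (g ^+ 2 * s)%:C by apply: complex_eq; rewrite /=; ring.
  by rewrite gs; apply: complex_eq; rewrite /=; ring.
have numE x i : mnum A b i x = 1 * (r2c x 0 i + (k%:C * cdot z (fun l => r2c x 0 l) + g%:C) * z i).
  by rewrite /mnum rank_one_mul /b; ring.
have denE x : mden c g%:C x = g%:C * (cdot z (fun l => r2c x 0 l) + 1).
  rewrite /mden mulrDr mulr1 mulr_sumr; congr (_ + _).
  by apply: eq_bigr => l _; rewrite /c mulrA.
have hball x : \sum_i csqr (mnum A b i x) - csqr (mden c g%:C x) = sqn x - 1.
  rewrite denE; under eq_bigr do rewrite numE.
  rewrite csqr_sum_line// zs sqn_csqr; set t := cdot z _; set W := \sum_i _.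
  have -> : 2 * complex.Re (conjc (k%:C * t + g%:C) * t) = 2 * k * csqr t + 2 * g * complex.Re t.
    by case: t => p q; rewrite /csqr/=; ring.
  have -> : csqr (k%:C * t + g%:C) * s = k ^+ 2 * s * csqr t + 2 * g * (k * s) * complex.Re t
      + g ^+ 2 * s.
    by case: t => p q; rewrite /csqr/=; ring.
  have -> : csqr (g%:C * (t + 1)) = g ^+ 2 * (csqr t + 2 * complex.Re t + 1).
    by case: t => p q; rewrite /csqr/=; ring.
  have -> : k ^+ 2 * s = g ^+ 2 - 2 * k by rewrite -k2; ring.
  by rewrite ks gs; ring.
have r2c0 i : r2c (0 : 'rV[R]_N) 0 i = 0 by rewrite mxE !mxE.
have cdot0 : cdot z (fun l => r2c (0 : 'rV[R]_N) 0 l) = 0.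
  by rewrite /cdot big1// => l _; rewrite r2c0 mulr0.
have gC : g%:C != 0 by apply: contra gn => /eqP[->].
have den0 : mden c g%:C 0 = g%:C by rewrite denE cdot0 add0r mulr1.
have frac0 i : mfrac A b c g%:C i 0 = z i.
  by rewrite /mfrac den0 numE cdot0 r2c0 mulr0 !add0r mul1r mulrAC divff// mul1r.
have Phi0 : moebius A b c g%:C 0 = x0.
  by apply/rowP => a; rewrite moebius_coord frac0 -coord_r2c.
pose vc i := r2c v 0 i; pose T := cdot z vc.
(* This is g A v; [partw] checks that the differential at 0 maps it to [v]. *)
pose wc i := g%:C * (1 * (vc i + k%:C * T * z i)).
pose w : 'rV[R]_N := c2r (\row_i wc i).
have wE i : r2c w 0 i = wc i by rewrite /w c2rK mxE.
have cdw : cdot z wc = g%:C * g%:C * T.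
  have -> : cdot z wc = g%:C * (T + k%:C * s%:C * T).
    rewrite -sC /T /cdot [k%:C * _]mulr_sumr mulr_suml -big_split/= mulr_sumr.
    by apply: eq_bigr => l _; rewrite /wc /T /cdot; ring.
  have -> : k%:C * s%:C = (g - 1)%:C by rewrite -ks; apply: complex_eq; rewrite /=; ring.
  have -> : (g - 1)%:C = g%:C - 1 by apply: complex_eq; rewrite /=; ring.
  by ring.
have partw i : \sum_l mpart A b c g%:C i l 0 * wc l = vc i.
  have E l : mpart A b c g%:C i l 0 * wc l = (A i l * wc l - z i * g%:C * (conjc (z l) * wc l)) * g%:C^-1.
    by rewrite /mpart den0 frac0 /c; ring.
  under eq_bigr do rewrite E.
  rewrite -mulr_suml sumrB -mulr_sumr rank_one_mul -/(cdot z wc) cdw.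
  apply: (mulIf gC); rewrite mulfVK// /wc.
  have kg : k%:C * (1 + g%:C) = g%:C * g%:C.
    have -> : 1 + g%:C = (1 + g)%:C by apply: complex_eq; rewrite /=; ring.
    by rewrite -!(rmorphM (real_complex R)) /k divfK.
  have -> : 1 * (g%:C * (1 * (vc i + k%:C * T * z i)) + k%:C * (g%:C * g%:C * T) * z i)
      - z i * g%:C * (g%:C * g%:C * T)
      = vc i * g%:C + g%:C * T * z i * (k%:C * (1 + g%:C) - g%:C * g%:C) by ring.
  by rewrite kg subrr mulr0 addr0.
have harmU := harmonic_moebius hAA hAc hcc hball harm.
have bU x : sqn x < 1 -> `|f (moebius A b c g%:C x)| <= 1.
  by move=> x1; apply: f_le1; exact: sqn_moebius hball x x1.
have := direction_at_zero harmU bU w.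
have -> : \sum_K w 0 K * moebius_d1 A b c g%:C f1 K 0 = \sum_K v 0 K * f1 K x0.
  rewrite /moebius_d1 Phi0.
  under eq_bigr do rewrite mulr_sumr.
  rewrite exchange_big/=; apply: eq_bigr => a _.
  under eq_bigr do rewrite mulrA.
  rewrite -mulr_suml; congr (_ * _).
  rewrite [RHS]coord_r2c -/(vc (cidx a)) -partw mulr_sumr cRe_sum.
  rewrite sum_coord; apply: eq_bigr => l _.
  rewrite /dmoebius !coordE -wE mxE.
  case: (mpart _ _ _ _ _ _ _) => p q; case: (conjc _) => p' q'.
  by rewrite /=; ring.
move=> /le_trans; apply; rewrite ler_wpM2l ?gamma_ratio_ge0// -gg.
have -> : g ^+ 2 * Num.sqrt (sqn v) = Num.sqrt (g ^+ 4 * sqn v).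
  have -> : g ^+ 4 = (g ^+ 2) ^+ 2 by ring.
  by rewrite sqrtrM ?sqr_ge0// sqrtr_sqr ger0_norm// sqr_ge0.
rewrite ler_wsqrtr//.
have V : \sum_i csqr (vc i) = sqn v by rewrite sqn_csqr.
have -> : sqn w = g ^+ 2 * (sqn v + g ^+ 2 * csqr T).
  rewrite sqn_csqr; under eq_bigr do rewrite wE /wc csqrM.
  rewrite -mulr_sumr csqr_sum_line// zs V -/T.
  have -> : csqr g%:C = g ^+ 2 by rewrite /csqr/=; ring.
  congr (_ * _).
  have -> : 2 * complex.Re (conjc (k%:C * T) * T) = 2 * k * csqr T.
    by case: (T) => p q; rewrite /csqr/=; ring.
  have -> : csqr (k%:C * T) * s = k ^+ 2 * s * csqr T.
    by case: (T) => p q; rewrite /csqr/=; ring.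
  by rewrite -k2; ring.
have CS : csqr T <= s * sqn v by have := cdot_le z vc; rewrite zs V.
have -> : g ^+ 4 * sqn v = g ^+ 2 * (sqn v + g ^+ 2 * (s * sqn v)).
  by rewrite [g ^+ 2 * (s * _)]mulrA gs; ring.
by rewrite ler_wpM2l ?sqr_ge0// lerD2l ler_wpM2l ?sqr_ge0.
Qed.

End PointwiseBound.

Lemma harmonic_data_comb (R : realType) (N m : nat) (J : 'M[R]_N) (u : 'I_m -> R)
    (f : 'I_m -> 'rV[R]_N -> R) (f1 : 'I_m -> 'I_N -> 'rV[R]_N -> R)
    (f2 : 'I_m -> 'I_N -> 'I_N -> 'rV[R]_N -> R) :
  (forall i, harmonic_data J (f i) (f1 i) (f2 i)) ->
  harmonic_data J (fun x => \sum_i u i * f i x) (fun k x => \sum_i u i * f1 i k x)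
    (fun k l x => \sum_i u i * f2 i k l x).
Proof.
move=> harm x x1.
have cZ (F : 'I_m -> 'rV[R]_N -> R) : (forall i, {for x, continuous (F i)}) ->
    {for x, continuous (fun y => \sum_i u i * F i y)}.
  move=> cF; apply: ctsS => i.
  by have h := ctsM (@ctsC R _ x (u i)) (@cF i); exact: h.
have dZ e (F : 'I_m -> 'rV[R]_N -> R) (d : 'I_m -> R) : (forall i, is_derive x e (F i) (d i)) ->
    is_derive x e (fun y => \sum_i u i * F i y) (\sum_i u i * d i).
  by move=> dF; apply: drvS.
split.
- by apply: cZ => i; have [] := harm i x x1.
- move=> k; split.
    by apply: dZ => i; have [_ h _ _] := harm i x x1; exact: (h k).1.
  by apply: cZ => i; have [_ h _ _] := harm i x x1; exact: (h k).2.
- move=> k l; split.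
    by apply: dZ => i; have [_ _ h _] := harm i x x1; exact: (h k l).1.
  by apply: cZ => i; have [_ _ h _] := harm i x x1; exact: (h k l).2.
under eq_bigr do under eq_bigr do rewrite mulr_sumr.
under eq_bigr do rewrite exchange_big/=.
rewrite exchange_big big1//= => i _; have [_ _ _ L] := harm i x x1.
rewrite -[RHS](mulr0 (u i)) -[X in _ = _ * X]L mulr_sumr; apply: eq_bigr => k _.
by rewrite mulr_sumr; apply: eq_bigr => l _; rewrite mulrCA.
Qed.

Lemma enorm_sqr (R : realType) (k : nat) (v : 'rV[R]_k) : enorm v ^+ 2 = \sum_i v 0 i ^+ 2.
Proof. by rewrite sqr_sqrtr// sumr_ge0// => i _; exact: sqr_ge0. Qed.

(** From |u + h|^2 >= 0 and |u - h|^2 >= 0. *)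
Lemma dot_unit_le1 (R : realType) (k : nat) (u h : 'rV[R]_k) :
  enorm u = 1 -> enorm h <= 1 -> `|\sum_i u 0 i * h 0 i| <= 1.
Proof.
move=> u1 h1; have u2 := enorm_sqr u; have h2 := enorm_sqr h.
have h3 : enorm h ^+ 2 <= 1 by rewrite expr_le1// sqrtr_ge0.
rewrite u1 expr1n in u2.
have sq (c : R) : c ^+ 2 = 1 -> 0 <= 1 + 2 * c * (\sum_i u 0 i * h 0 i) + enorm h ^+ 2.
  move=> c1; suff -> : 1 + 2 * c * (\sum_i u 0 i * h 0 i) + enorm h ^+ 2
      = \sum_i (u 0 i + c * h 0 i) ^+ 2 by apply: sumr_ge0 => i _; exact: sqr_ge0.
  rewrite {1}u2 h2 mulr_sumr -!big_split/=; apply: eq_bigr => i _.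
  have -> : h 0 i ^+ 2 = c ^+ 2 * h 0 i ^+ 2 by rewrite c1 mul1r.
  by ring.
have p := sq 1 (expr1n _ _); have q : 0 <= 1 + 2 * (- 1) * (\sum_i u 0 i * h 0 i) + enorm h ^+ 2.
  by apply: sq; rewrite sqrrN expr1n.
by rewrite ler_norml; apply/andP; split; lra.
Qed.

Theorem corollary2 (R : realType) (n m : nat) (hn : (1 <= n)%N) (hm : (1 <= m)%N)
    (H : 'rV[R[i]]_n -> 'rV[R]_m)
    (hH : forall k : 'I_m, invariant_harmonic (fun z => H z 0 k))
    (hH1 : forall z, cball z -> enorm (H z) <= 1)
    (z : 'rV[R[i]]_n) (hz : cball z) :
  opnorm (grad H z)
    <= 2 * Gamma (n%:R + 1) / (Num.sqrt pi * Gamma (n%:R + 2^-1))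
       * (1 / (1 - cnorm z ^+ 2)).
Proof.
case: n hn H hH hH1 z hz => [//|n'] _ H hH hH1 z hz; rewrite -/(gamma_ratio R n').
set x : 'rV[R]_(n'.+1 * 2) := c2r z.
have zx : r2c x = z by rewrite /x c2rK.
have sx : sqn x = cnorm z ^+ 2 by rewrite sqn_r2c zx.
have x1 : sqn x < 1 by apply/cball_r2c; rewrite zx.
have sx1 : 0 <= (1 - sqn x)^-1 by rewrite invr_ge0 subr_ge0 ltW.
rewrite -sx mul1r.
pose f k : 'rV[R]_(n'.+1 * 2) -> R := (fun z => H z 0 k) \o @r2c R n'.+1.
pose f1 k (l : 'I_(n'.+1 * 2)) : 'rV[R]_(n'.+1 * 2) -> R := 'D_(delta_mx 0 l) (f k).
have harm k := invariant_harmonic_data (hH k).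
have d1 k (y : 'rV[R]_(n'.+1 * 2)) (l : 'I_(n'.+1 * 2)) : sqn y < 1 ->
    is_derive y (delta_mx 0 l) (f k) (f1 k l y) /\ {for y, continuous (f1 k l)}.
  by move=> y1; have [_ h _ _] := harm k y y1; exact: h l.
apply: ge_sup.
  exists (enorm (grad H z *m (0 : 'rV[R]_(n'.+1 * 2))^T)^T); exists 0 => //=.
  by rewrite /enorm big1 ?sqrtr0 ?ler01// => i _; rewrite mxE expr0n.
move=> _ [v /= v1 <-].
rewrite trmx_mul trmxK /grad trmxK /jacobian mul_rV_lin1.
set y := 'd _ _ _.
have yE k : y 0 k = \sum_l v 0 l * f1 k l x.
  apply: (@C1_diff R _ _ (H \o @r2c R n'.+1) (fun l k => f1 k l) x v k).
    by apply: filterS (open_ball_sqn x1) => u u1 l j; exact: (d1 j u l u1).1.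
  by move=> l j; exact: (d1 j x l x1).2.
have [->|y0] := eqVneq (enorm y) 0; first by rewrite mulr_ge0 ?gamma_ratio_ge0.
(* Pairing [H] with the unit vector along the image [y] of [v] gives a scalar solution bounded by 1,
   whose derivative along [v] is the norm of [y]. *)
pose u : 'rV[R]_m := (enorm y)^-1 *: y.
have u1 : enorm u = 1.
  rewrite /enorm (_ : \sum_i _ = 1) ?sqrtr1//.
  under eq_bigr do rewrite mxE exprMn.
  by rewrite -mulr_sumr -enorm_sqr -exprMn mulVf// expr1n.
have uy : enorm y = \sum_k u 0 k * y 0 k.
  have E k : u 0 k * y 0 k = (enorm y)^-1 * (y 0 k ^+ 2) by rewrite mxE; ring.
  under eq_bigr do rewrite E.
  by rewrite -mulr_sumr -enorm_sqr expr2 mulKf.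
have harmu := harmonic_data_comb (u 0) harm.
have bu (w : 'rV[R]_(n'.+1 * 2)) : sqn w < 1 -> `|\sum_k u 0 k * f k w| <= 1.
  by move=> /cball_r2c w1; apply: dot_unit_le1 => //; exact: hH1.
have := direction_bound harmu bu v x1.
have -> : \sum_l v 0 l * (\sum_k u 0 k * f1 k l x) = enorm y.
  rewrite uy; under eq_bigr do rewrite mulr_sumr.
  rewrite exchange_big/=; apply: eq_bigr => k _.
  by rewrite yE mulr_sumr; apply: eq_bigr => l _; ring.
rewrite ger0_norm ?sqrtr_ge0// => /le_trans; apply.
(* What is left is Num.sqrt (sqn v) <= 1, which is [v1] up to conversion. *)
rewrite ler_wpM2l ?gamma_ratio_ge0// ler_piMr//.
Qed.
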